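(* There exist an integer $n\ge 1$ and an irreducible hypersurface germ $(X,\bar 0)\subset(\mathbb{C}^{n+1},\bar 0)$ such that all arc-sections of $(X,\bar 0)$ (with respect to all linear projections $\pi:\mathbb{C}^{n+1}\to\mathbb{C}^n$ for which $\pi|_{(X,\bar 0)}$ is finite) are reducible. Moreover, such germs can be found so that, for every germ of analytic change of coordinates (biholomorphism germ) $\Phi:(\mathbb{C}^{n+1},\bar 0)\to(\mathbb{C}^{n+1},\bar 0)$, the germ $(\Phi(X),\bar 0)$ also has all its arc-sections reducible.
   Context: A hypersurface germ $(X,\bar 0)\subset(\mathbb{C}^{n+1},\bar 0)$ is the zero set germ of a (reduced) $F\in\mathbb{C}\{x_1,\dots,x_{n+1}\}$. A linear projection $\pi:\mathbb{C}^{n+1}\to\mathbb{C}^n$ is a surjective linear map; $\pi|_{(X,\bar 0)}$ is finite if $\pi^{-1}(\bar 0)\cap X=\{\bar 0\}$ as germs. After a linear change of coordinates one may take $\pi(x_1,\dots,x_{n+1})=(x_1,\dots,x_n)$, and $F$ to be a Weierstrass polynomial in $x_{n+1}$; the discriminant $\Delta\subset(\mathbb{C}^n,\bar 0)$ of $\pi|_X$ is the zero set of the discriminant of this polynomial with respect to $x_{n+1}$. An arc in $(\mathbb{C}^n,\bar 0)$ is a holomorphic map germ $\alpha:(\mathbb{C},0)\to(\mathbb{C}^n,\bar 0)$; a representative is its restriction to a closed disk $\mathbb{D}\subset\mathbb{C}$ centered at $0$, in the domain of $\alpha$. An arc-section of $(X,\bar 0)$ is a section of the form $\pi^{-1}(\alpha(\mathbb{D}))\cap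 X$, where $\pi$ is a linear projection with $\pi|_{(X,\bar 0)}$ finite and $\alpha:\mathbb{D}\to\mathbb{C}^n$ is an injective representative of an arc (with $\mathbb{D}$ sufficiently small) such that either $\alpha(\mathbb{D})\subset\Delta$ or $\alpha(\mathbb{D})\cap\Delta=\{\bar 0\}$. It is called irreducible or reducible according to whether its germ at $\bar 0$, with reduced structure, is an irreducible or reducible analytic curve germ. *)

(* Defs.v *)
From HB Require Import structures.
From mathcomp Require Import all_boot all_order all_algebra.
From mathcomp Require Import classical_sets functions topology normedtype.
From mathcomp Require Import sequences.

Set Implicit Arguments.
Unset Strict Implicit.
Unset Printing Implicit Defensive.

Import Order.TTheory GRing.Theory Num.Theory.
Import numFieldNormedType.Exports.

Local Open Scope classical_set_scope.
Local Open Scope ring_scope.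

(* The definitions are stated over any [C : numFieldType], with the topology that
   MathComp-Analysis gives to it, and are meant for the complex field [R[i]] over
   [R : realType]: this avoids declaring a topology on [R[i]].  Recall that in
   [R[i]] the relation [0 < r] entails that [r] is real, so that radii can be
   taken in [C]. *)

Section Germs.
Variable C : numFieldType.

(* The germ of [f] at [a] is an element of the ring of convergent power series
   in [N] variables centered at [a].  The bound on the coefficients gives
   absolute convergence on the open polydisc of radius [r], so that the order of
   summation (here along the boxes [0, K[^N) does not matter. *)
Definition analytic_at (N : nat) (f : 'cV[C]_N -> C) (a : 'cV[C]_N) : Prop :=
  exists (c : {ffun 'I_N -> nat} -> C) (r M : C),
    [/\ 0 < r,
        forall m : {ffun 'I_N -> nat}, `|c m| * r ^+ (\sum_i m i) <= M &
        forall h : 'cV[C]_N, (forall i, `|h i 0| < r) ->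
          (\sum_(m : {ffun 'I_N -> 'I_K})
             c [ffun i => m i : nat] * \prod_i h i 0 ^+ m i) @[K --> \oo]
          --> f (a + h)].

Definition analytic_map_at (N k : nat) (f : 'cV[C]_N -> 'cV[C]_k)
    (a : 'cV[C]_N) : Prop :=
  forall j, analytic_at (fun x => f x j 0) a.

(* Set germs at the origin are handled through representatives; all the notions
   below depend on the representatives only up to [germ_eq]. *)
Definition germ_eq (N : nat) (A B : set 'cV[C]_N) : Prop :=
  \forall x \near (0 : 'cV[C]_N), A x <-> B x.

Definition analytic_germ (N : nat) (A : set 'cV[C]_N) : Prop :=
  exists (k : nat) (g : 'I_k -> 'cV[C]_N -> C),
    (forall i, analytic_at (g i) 0) /\
    germ_eq A [set x | forall i, g i x = 0].

Definition reducible_germ (N : nat) (A : set 'cV[C]_N) : Prop :=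
  exists A1 A2 : set 'cV[C]_N,
    [/\ analytic_germ A1, analytic_germ A2, germ_eq A (A1 `|` A2),
        ~ germ_eq A A1 & ~ germ_eq A A2].

(* A nonempty germ of closed set at the origin contains the origin. *)
Definition irreducible_germ (N : nat) (A : set 'cV[C]_N) : Prop :=
  [/\ analytic_germ A, A 0 & ~ reducible_germ A].

(* [F] has no square factor other than the units; in particular its germ is not
   zero. *)
Definition reduced_germ (N : nat) (F : 'cV[C]_N -> C) : Prop :=
  forall g h : 'cV[C]_N -> C, analytic_at g 0 -> analytic_at h 0 ->
    (\forall x \near (0 : 'cV[C]_N), F x = g x ^+ 2 * h x) -> g 0 != 0.

Definition hypersurface_germ (N : nat) (X : set 'cV[C]_N) : Prop :=
  exists F : 'cV[C]_N -> C,
    [/\ analytic_at F 0, F 0 = 0, reduced_germ F &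
        germ_eq X [set x | F x = 0]].

(* [Phi], defined on the open neighborhood [U] of the origin, represents a germ
   of analytic change of coordinates; the image of the germ of [X] is then
   represented by [Phi @` (U `&` X)]. *)
Definition biholomorphism_on (N : nat) (U : set 'cV[C]_N)
    (Phi : 'cV[C]_N -> 'cV[C]_N) : Prop :=
  [/\ open U, U 0, Phi 0 = 0, open (Phi @` U) &
      exists Psi : 'cV[C]_N -> 'cV[C]_N,
        [/\ forall x, U x -> Psi (Phi x) = x,
            forall x, U x -> analytic_map_at Phi x &
            forall y, (Phi @` U) y -> analytic_map_at Psi y]].

End Germs.

Section ArcSections.
Variables (C : numFieldType) (n : nat).

Definition linear_projection (pi : {linear 'cV[C]_(n + 1) -> 'cV[C]_n}) : Prop :=
  forall y, exists x, pi x = y.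

Definition finite_projection (X : set 'cV[C]_(n + 1))
    (pi : {linear 'cV[C]_(n + 1) -> 'cV[C]_n}) : Prop :=
  germ_eq (pi @^-1` [set 0] `&` X) [set 0].

(* A monic polynomial of degree [d] in the last variable, with analytic
   coefficients, the non-leading ones vanishing at the origin. *)
Definition weierstrass_polynomial (d : nat) (P : 'cV[C]_n -> {poly C}) : Prop :=
  [/\ forall i : nat, analytic_at (fun x => (P x)`_i) 0,
      \forall x \near (0 : 'cV[C]_n), P x \is monic /\ size (P x) = d.+1 &
      P 0 = 'X^d].

Definition weierstrass_eval (P : 'cV[C]_n -> {poly C}) (y : 'cV[C]_(n + 1)) : C :=
  (P (usubmx y)).[dsubmx y 0 0].

(* [L] is a linear change of coordinates in which [pi] becomes the projection to
   the first [n] coordinates, and [X] is the zero set of the reduced Weierstrass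
   polynomial [P] in the last coordinate. *)
Definition weierstrass_equation (X : set 'cV[C]_(n + 1))
    (pi : {linear 'cV[C]_(n + 1) -> 'cV[C]_n})
    (L : 'M[C]_(n + 1)) (P : 'cV[C]_n -> {poly C}) : Prop :=
  [/\ L \in unitmx,
      forall x, pi x = usubmx (L *m x),
      exists d, weierstrass_polynomial d P,
      reduced_germ (weierstrass_eval P) &
      germ_eq (mulmx L @` X) [set y | weierstrass_eval P y = 0]].

Definition discriminant (p : {poly C}) : C :=
  (-1) ^+ 'C((size p).-1, 2) * resultant p p^`() / lead_coef p.

Definition discriminant_germ (X : set 'cV[C]_(n + 1))
    (pi : {linear 'cV[C]_(n + 1) -> 'cV[C]_n}) (Delta : set 'cV[C]_n) : Prop :=
  exists L P, weierstrass_equation X pi L P /\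
    germ_eq Delta [set x | discriminant (P x) = 0].

Definition closed_disk (r : C) : set C := [set t | `|t| <= r].

(* [alpha] is holomorphic at every point of the closed disk of radius [r],
   hence on a neighborhood of it ('cV_1 stands for the complex line). *)
Definition injective_arc (r : C) (alpha : C -> 'cV[C]_n) : Prop :=
  [/\ 0 < r,
      forall s, closed_disk r s ->
        analytic_map_at (fun t : 'cV[C]_1 => alpha (t 0 0)) (const_mx s),
      alpha 0 = 0 &
      set_inj (closed_disk r) alpha].

(* The disk may be any one for which the condition on [Delta] holds: as [alpha]
   is injective and continuous on it, shrinking it does not change the germ at
   the origin of the section.  The inclusion in [set 0] (instead of an equality)
   allows for the empty discriminant of an unramified projection. *)
Definition arc_section (X : set 'cV[C]_(n + 1))
    (pi : {linear 'cV[C]_(n + 1) -> 'cV[C]_n}) (S : set 'cV[C]_(n + 1)) : Prop :=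
  exists (Delta : set 'cV[C]_n) (r : C) (alpha : C -> 'cV[C]_n),
    [/\ discriminant_germ X pi Delta,
        injective_arc r alpha,
        alpha @` closed_disk r `<=` Delta \/
        alpha @` closed_disk r `&` Delta `<=` [set 0] &
        S = pi @^-1` (alpha @` closed_disk r) `&` X].

Definition all_arc_sections_reducible (X : set 'cV[C]_(n + 1)) : Prop :=
  forall pi : {linear 'cV[C]_(n + 1) -> 'cV[C]_n},
    linear_projection pi -> finite_projection X pi ->
    forall S, arc_section X pi S -> reducible_germ S.

End ArcSections.

(* Main.v *)
(* The germ is the cone over the tricuspidal quartic
   [x^2 y^2 + y^2 z^2 + z^2 x^2 = 2 x y z (x + y + z)], the image of [C^2] under
   [(s, t) |-> (t^2 (s+t)^2, s^2 (s+t)^2, s^2 t^2)].  Every line of the projective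
   plane meets this quartic in at least two points.  Let [Phi] be a biholomorphism
   germ with linear part [D].  An arc of the plane, with tangent line [T] at the
   origin, is the zero set of some [g] with leading form [l ^ q], where [l = 0] is
   [T].  By Hurwitz' theorem, [g \o pi \o Phi] has zeros on the cone arbitrarily
   close to the origin and to the direction of each point of the quartic on the line
   [l \o pi \o D = 0], so that the arc-section has at least two tangent directions.
   The points of the section above the parameter [t] of the arc are the roots of a
   Weierstrass polynomial with coefficients analytic in [t]; separating its roots by
   their tangent directions, Hensel's lemma splits this polynomial, and hence the
   section is reducible. *)

Require Import Defs.
From HB Require Import structures.
From mathcomp Require Import all_boot all_order all_algebra.
From mathcomp Require Import complex.
From mathcomp Require Import boolp classical_sets functions reals topology normedtype.
From mathcomp Require Import sequences.
From mathcomp Require Import cyclic separable cyclotomic.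
From mathcomp Require Import ring lra zify.

Import Order.TTheory GRing.Theory Num.Theory.
Import numFieldNormedType.Exports.

Local Open Scope classical_set_scope.
Local Open Scope ring_scope.

Set Implicit Arguments.
Unset Strict Implicit.
Unset Printing Implicit Defensive.

(** Two obstacles shape the proof. The Hensel factors are analytic in the parameter [t] of the arc,
    whereas a component of the section has to be cut out by functions of the ambient coordinates, in
    which only [x = t ^ q] and [y = b t] are available. The factors are therefore pushed down from
    [t] to [t ^ q] by norms and by traces (that is, by interpolation) over the [q]-th roots of
    unity. Moreover the ratio [z / x] may be unbounded on the section, so that tangent directions
    are separated in a projective coordinate whose point at infinity is no tangent direction.

    Working with uniform limits of polynomials makes composition, fixed points and averages over
    roots of unity elementary. These averages also replace contour integrals, both in Cauchy's
    estimates and in the minimum principle behind Hurwitz' theorem.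

    The cone is irreducible because its parametrization pulls equations back to germs on [C ^ 2],
    which form a domain. It is reduced because a square factor of a germ gives a square factor of
    its leading form. *)

Section ComplexAbs.
Variable R : realType.
Local Notation C := (R[i]).

(** The norm of [R[i]] takes its values in [R[i]]; with a modulus in [R], estimates live in a
    totally ordered field, where [lra] applies. *)
Definition cabs (z : C) : R := Normc.normc z.
Arguments cabs : simpl never.

Lemma cabsE (z : C) : `|z| = (cabs z)%:C%C.
Proof. by rewrite normc_def; case: z. Qed.

Lemma cabs_ge0 z : 0 <= cabs z.
Proof. by rewrite -lecR -cabsE normr_ge0. Qed.

Lemma cabs0 : cabs 0 = 0.
Proof. by apply: (@complexI R); rewrite -cabsE normr0. Qed.

Lemma cabs1 : cabs 1 = 1.
Proof. by apply: (@complexI R); rewrite -cabsE normr1. Qed.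

Lemma cabsM x y : cabs (x * y) = cabs x * cabs y.
Proof. exact: Normc.normcM. Qed.

Lemma cabsN x : cabs (- x) = cabs x.
Proof. exact: normcN. Qed.

Lemma cabsV x : cabs x^-1 = (cabs x)^-1.
Proof. exact: Normc.normcV. Qed.

Lemma cabsD x y : cabs (x + y) <= cabs x + cabs y.
Proof. exact: le_normcD. Qed.

Lemma cabsB x y : cabs (x - y) <= cabs x + cabs y.
Proof. by rewrite -(cabsN y) cabsD. Qed.

Lemma cabs_distC x y : cabs (x - y) = cabs (y - x).
Proof. by rewrite -cabsN opprB. Qed.

Lemma cabs_tri x y z : cabs (x - z) <= cabs (x - y) + cabs (y - z).
Proof. by rewrite -[x - z](subrKA y) cabsD. Qed.

Lemma cabs_subr x y : cabs x - cabs y <= cabs (x - y).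
Proof. by rewrite lerBlDr -{1}[x](subrK y) cabsD. Qed.

Lemma cabs_eq0 x : (cabs x == 0) = (x == 0).
Proof.
by apply/eqP/eqP=> [|->]; [exact: Normc.eq0_normc | exact: cabs0].
Qed.

Lemma cabs_gt0 x : (0 < cabs x) = (x != 0).
Proof. by rewrite lt0r cabs_eq0 cabs_ge0 andbT. Qed.

Lemma cabsX x n : cabs (x ^+ n) = cabs x ^+ n.
Proof. by elim: n => [|n IH]; rewrite ?cabs1// !exprS cabsM IH. Qed.

Lemma cabs_real (x : R) : cabs x%:C%C = `|x|.
Proof. by rewrite /cabs/= expr0n addr0 sqrtr_sqr. Qed.

Lemma cabs_nat n : cabs n%:R = n%:R.
Proof.
by rewrite -(rmorph_nat (real_complex R)) cabs_real ger0_norm ?ler0n.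
Qed.

Lemma cabs_sum I (s : seq I) (P : pred I) (F : I -> C) :
  cabs (\sum_(i <- s | P i) F i) <= \sum_(i <- s | P i) cabs (F i).
Proof.
elim/big_rec2: _ => [|i x y _ IH]; first by rewrite cabs0.
by rewrite (le_trans (cabsD _ _)) // lerD2l.
Qed.

Lemma cabs_prod I (s : seq I) (P : pred I) (F : I -> C) :
  cabs (\prod_(i <- s | P i) F i) = \prod_(i <- s | P i) cabs (F i).
Proof. by rewrite (big_morph cabs cabsM cabs1). Qed.

Lemma cabs_eq_lim (x y : C) : (forall e : R, 0 < e -> cabs (x - y) <= e) -> x = y.
Proof.
move=> H; apply/eqP; rewrite -subr_eq0 -cabs_eq0 eq_le cabs_ge0 andbT.
by apply/ler_addgt0Pr => e e0; rewrite add0r H.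
Qed.

End ComplexAbs.
Arguments cabs : simpl never.

(** * Analytic germs as uniform limits of polynomials *)

Section PolynomialFunctions.
Variable R : realType.
Local Notation C := (R[i]).

Definition pdisc (N : nat) (r : R) (h : 'cV[C]_N) := forall i, cabs (h i 0) < r.

(** A predicate on functions, so that substitution and averaging need no polynomial ring in several
    variables; coefficients are recovered later, by [polyfun_evalmon]. *)
Inductive polyfun (N : nat) : ('cV[C]_N -> C) -> Prop :=
| polyfun_cst c : polyfun (fun _ => c)
| polyfun_coord i : polyfun (fun h => h i 0)
| polyfunD f g : polyfun f -> polyfun g -> polyfun (fun h => f h + g h)
| polyfunM f g : polyfun f -> polyfun g -> polyfun (fun h => f h * g h).

Lemma polyfunN N (f : 'cV[C]_N -> C) : polyfun f -> polyfun (fun h => - f h).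
Proof.
move=> pf; have -> : (fun h => - f h) = (fun h => -1 * f h).
  by apply/funext => h; rewrite mulN1r.
exact: polyfunM (polyfun_cst _ _) pf.
Qed.

Lemma polyfunB N (f g : 'cV[C]_N -> C) :
  polyfun f -> polyfun g -> polyfun (fun h => f h - g h).
Proof. by move=> pf pg; apply: polyfunD => //; exact: polyfunN. Qed.

Lemma polyfunX N (f : 'cV[C]_N -> C) n : polyfun f -> polyfun (fun h => f h ^+ n).
Proof.
move=> pf; elim: n => [|n IH]; first exact: polyfun_cst.
by under eq_fun => ? do rewrite exprS; exact: polyfunM.
Qed.

Lemma polyfun_sum N I (s : seq I) (P : pred I) (F : I -> 'cV[C]_N -> C) :
  (forall i, P i -> polyfun (F i)) -> polyfun (fun h => \sum_(i <- s | P i) F i h).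
Proof.
move=> pF; elim: s => [|i s IH].
  by under eq_fun => ? do rewrite big_nil; exact: polyfun_cst.
under eq_fun => ? do rewrite big_cons.
by case Pi: (P i) => //; apply: polyfunD => //; exact: pF.
Qed.

Lemma polyfun_prod N I (s : seq I) (P : pred I) (F : I -> 'cV[C]_N -> C) :
  (forall i, P i -> polyfun (F i)) -> polyfun (fun h => \prod_(i <- s | P i) F i h).
Proof.
move=> pF; elim: s => [|i s IH].
  by under eq_fun => ? do rewrite big_nil; exact: polyfun_cst.
under eq_fun => ? do rewrite big_cons.
by case Pi: (P i) => //; apply: polyfunM => //; exact: pF.
Qed.

Lemma polyfun_horner N (f : 'cV[C]_N -> C) (p : {poly C}) :
  polyfun f -> polyfun (fun h => p.[f h]).
Proof.
move=> pf; under eq_fun => ? do rewrite horner_coef.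
by apply: polyfun_sum => i _; apply: polyfunM; [exact: polyfun_cst|exact: polyfunX].
Qed.

Lemma polyfun_bounded N (f : 'cV[C]_N -> C) r : polyfun f ->
  exists2 B : R, 0 < B & forall h, pdisc r h -> cabs (f h) <= B.
Proof.
elim=> [c|i|f1 f2 _ [B1 B10 H1] _ [B2 B20 H2]|f1 f2 _ [B1 B10 H1] _ [B2 B20 H2]].
- by exists (cabs c + 1); [rewrite ltr_pwDr ?cabs_ge0 | move=> h _; lra].
- exists (`|r| + 1); first by rewrite ltr_pwDr ?normr_ge0.
  by move=> h /(_ i) /ltW hr; rewrite (le_trans hr) // (le_trans (ler_norm r)) // lerDl.
- exists (B1 + B2); first exact: addr_gt0.
  by move=> h hr; rewrite (le_trans (cabsD _ _)) // lerD ?H1 ?H2.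
- exists (B1 * B2); first exact: mulr_gt0.
  by move=> h hr; rewrite cabsM ler_pM ?cabs_ge0 ?H1 ?H2.
Qed.

(** No coefficient appears here, which makes products, limits and compositions elementary;
    [approx_on_analytic] goes back to power series. *)
Definition approx_on (N : nat) (r : R) (f : 'cV[C]_N -> C) := forall e : R, 0 < e ->
  exists2 p, polyfun p & forall h, pdisc r h -> cabs (f h - p h) <= e.

Section Closure.
Variables (N : nat) (r : R).
Implicit Types f g : 'cV[C]_N -> C.

Lemma approx_on_ext f g : (forall h, pdisc r h -> f h = g h) ->
  approx_on r f -> approx_on r g.
Proof.
move=> fg af e /af[p pp H]; exists p => // h hr; by rewrite -fg // H.
Qed.

Lemma approx_on_polyfun f : polyfun f -> approx_on r f.
Proof. by move=> pf e e0; exists f => // h _; rewrite subrr cabs0 ltW. Qed.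

Lemma approx_on_cst c : approx_on r (fun _ : 'cV[C]_N => c).
Proof. by apply: approx_on_polyfun; exact: polyfun_cst. Qed.

Lemma approx_on_coord i : approx_on r (fun h : 'cV[C]_N => h i 0).
Proof. by apply: approx_on_polyfun; exact: polyfun_coord. Qed.

Lemma approx_on_lim f : (forall e : R, 0 < e -> exists2 g, approx_on r g &
    forall h, pdisc r h -> cabs (f h - g h) <= e) -> approx_on r f.
Proof.
move=> H e e0; have [|g ag Hg] := H (e / 2); first lra.
have [|p pp Hp] := ag (e / 2); first lra.
exists p => // h hr; rewrite (le_trans (cabs_tri _ (g h) _)) //.
by have := Hg h hr; have := Hp h hr; lra.
Qed.

Lemma approx_onD f g : approx_on r f -> approx_on r g -> approx_on r (fun h => f h + g h).
Proof.
move=> af ag e e0.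
have [|p pp Hp] := af (e / 2); first lra.
have [|q pq Hq] := ag (e / 2); first lra.
exists (fun h => p h + q h); first exact: polyfunD.
move=> h hr; rewrite opprD addrACA (le_trans (cabsD _ _)) //.
by have := Hp h hr; have := Hq h hr; lra.
Qed.

Lemma approx_on_bounded f : approx_on r f ->
  exists2 B : R, 0 < B & forall h, pdisc r h -> cabs (f h) <= B.
Proof.
move=> af; have [p pp Hp] := af 1 ltr01.
have [B B0 HB] := polyfun_bounded r pp.
exists (1 + B); first by rewrite addr_gt0.
by move=> h hr; rewrite -[f h](subrK (p h)) (le_trans (cabsD _ _)) // lerD ?Hp ?HB.
Qed.

Lemma approx_onM f g : approx_on r f -> approx_on r g -> approx_on r (fun h => f h * g h).
Proof.
move=> af ag; have [A A0 HA] := approx_on_bounded af.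
have [B B0 HB] := approx_on_bounded ag.
apply: approx_on_lim => e e0.
have [|p pp Hp] := af (e / 2 / B); first by rewrite !divr_gt0.
have [B' B'0 HB'] := polyfun_bounded r pp.
(* The tolerance for [g] depends on a bound of the polynomial already chosen for [f]. *)
have [|q pq Hq] := ag (e / 2 / B'); first by rewrite !divr_gt0.
exists (fun h => p h * q h); first by apply: approx_on_polyfun; exact: polyfunM.
move=> h hr.
have -> : f h * g h - p h * q h = (f h - p h) * g h + p h * (g h - q h) by ring.
rewrite (le_trans (cabsD _ _)) // !cabsM.
have -> : e = e / 2 / B * B + B' * (e / 2 / B') by field; rewrite !gt_eqF.
by rewrite lerD // ler_pM ?cabs_ge0 ?Hp ?HB ?Hq ?HB'.
Qed.

Lemma approx_onN f : approx_on r f -> approx_on r (fun h => - f h).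
Proof.
move=> af; apply: (@approx_on_ext (fun h => -1 * f h)).
  by move=> h _; rewrite mulN1r.
by apply: approx_onM => //; exact: approx_on_cst.
Qed.

Lemma approx_onB f g : approx_on r f -> approx_on r g -> approx_on r (fun h => f h - g h).
Proof. by move=> af ag; apply: approx_onD => //; exact: approx_onN. Qed.

Lemma approx_onX f n : approx_on r f -> approx_on r (fun h => f h ^+ n).
Proof.
move=> af; elim: n => [|n IH]; first exact: approx_on_cst.
by under eq_fun => ? do rewrite exprS; exact: approx_onM.
Qed.

Lemma approx_on_sum I (s : seq I) (P : pred I) (F : I -> 'cV[C]_N -> C) :
  (forall i, P i -> approx_on r (F i)) ->
  approx_on r (fun h => \sum_(i <- s | P i) F i h).
Proof.
move=> pF; elim: s => [|i s IH].
  by under eq_fun => ? do rewrite big_nil; exact: approx_on_cst.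
under eq_fun => ? do rewrite big_cons.
by case Pi: (P i) => //; apply: approx_onD => //; exact: pF.
Qed.

Lemma approx_on_polyfun_comp M (p : 'cV[C]_M -> C) (g : 'cV[C]_N -> 'cV[C]_M) :
  polyfun p -> (forall i, approx_on r (fun h => g h i 0)) -> approx_on r (p \o g).
Proof.
move=> pf pg; elim: pf => [c|i|f1 f2 _ IH1 _ IH2|f1 f2 _ IH1 _ IH2] /=.
- exact: approx_on_cst.
- exact: pg.
- exact: approx_onD.
- exact: approx_onM.
Qed.

End Closure.

Lemma approx_on_le N r r' (f : 'cV[C]_N -> C) : r' <= r -> approx_on r f -> approx_on r' f.
Proof.
move=> r'r af e /af[p pp Hp]; exists p => // h hr; apply: Hp => i.
exact: lt_le_trans (hr i) r'r.
Qed.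

Lemma approx_on_comp N M r s (f : 'cV[C]_N -> C) (g : 'cV[C]_M -> 'cV[C]_N) :
  approx_on r f -> (forall i, approx_on s (fun h => g h i 0)) ->
  (forall h, pdisc s h -> pdisc r (g h)) -> approx_on s (f \o g).
Proof.
move=> af ag gsr; apply: approx_on_lim => e /af[p pp Hp].
exists (p \o g); first exact: approx_on_polyfun_comp.
by move=> h /gsr/Hp.
Qed.

End PolynomialFunctions.

(** * Neighborhoods and limits with real radii *)

Section Topology.
Variable R : realType.
Local Notation C := (Num.NumField.sort (R[i] : numFieldType)).

Lemma gt0_complex (e : C) : 0 < e -> exists2 r : R, 0 < r & e = r%:C%C.
Proof.
move=> e0; have /complex_realP[r re] : e \is Num.real by rewrite realE ltW.
by exists r; rewrite // -ltcR -re.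
Qed.

Lemma near0P N (Q : 'cV[C]_N -> Prop) : (\forall x \near (0 : 'cV[C]_N), Q x) <->
  exists2 r : R, 0 < r & forall h, pdisc r h -> Q h.
Proof.
split.
  move=> /nbhs_ballP[e /= /gt0_complex[r r0 ->] HQ]; exists r => // h hr.
  apply: HQ; split; first by rewrite ltcR.
  move=> i j; rewrite ord1 -ball_normE /= mxE sub0r normrN cabsE ltcR; exact: hr.
move=> [r r0 HQ]; apply/nbhs_ballP; exists r%:C%C; first by rewrite /= ltcR.
move=> h [_ hr]; apply: HQ => i; have := hr i 0.
by rewrite -ball_normE /= mxE sub0r normrN cabsE ltcR.
Qed.

Lemma cvg_seqP (u : nat -> C) (l : C) : (u @ \oo --> l) <->
  forall e : R, 0 < e -> exists n0, forall n, (n0 <= n)%N -> cabs (l - u n) <= e.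
Proof.
split.
  move=> /cvgrPdist_le H e e0.
  have [|n0 _ Hn] := H e%:C%C; first by rewrite ltcR.
  by exists n0 => n /Hn /=; rewrite cabsE lecR.
move=> H; apply/cvgrPdist_le => _ /gt0_complex[e e0 ->].
have [n0 Hn] := H _ e0; exists n0 => // n /= /Hn.
by rewrite cabsE lecR.
Qed.

End Topology.

(** * Homogeneous expansion of an analytic germ *)

Section Expansion.
Variable R : realType.
Local Notation C := (R[i]).
Variable N : nat.

Definition hmon (h : 'cV[C]_N) (m : 'I_N -> nat) := \prod_i h i 0 ^+ m i.
Definition mdeg (m : 'I_N -> nat) := (\sum_i m i)%N.

Lemma cabs_hmon_le (s : R) (h : 'cV[C]_N) m : (forall i, cabs (h i 0) <= s) ->
  cabs (hmon h m) <= s ^+ mdeg m.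
Proof.
move=> hs; rewrite /mdeg -prodrXr /hmon cabs_prod.
apply: ler_prod => i _; rewrite cabs_ge0 cabsX lerXn2r ?nnegrE ?cabs_ge0//.
exact: le_trans (cabs_ge0 _) (hs i).
Qed.

Lemma hmonZ l h m : hmon (l *: h) m = l ^+ mdeg m * hmon h m.
Proof.
rewrite /mdeg -prodrXr /hmon -big_split /=; apply: eq_bigr => i _.
by rewrite mxE exprMn.
Qed.

Lemma sum_half_le K : \sum_(j < K) (2^-1 : R) ^+ j <= 2.
Proof.
elim: K => [|K IH]; first by rewrite big_ord0.
rewrite big_ord_recl expr0; under eq_bigr do rewrite exprS.
rewrite -mulr_sumr; lra.
Qed.

Lemma box_half_le K :
  \sum_(m : {ffun 'I_N -> 'I_K}) (2^-1 : R) ^+ mdeg (fun i => m i) <= 2 ^+ N.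
Proof.
rewrite (eq_bigr (fun m : {ffun 'I_N -> 'I_K} => \prod_i (2^-1 : R) ^+ m i)); last first.
  by move=> m _; rewrite prodrXr.
rewrite -(bigA_distr_bigA (fun _ (j : 'I_K) => (2^-1 : R) ^+ j)).
have -> : (2 : R) ^+ N = \prod_(i < N) 2 by rewrite prodr_const card_ord.
apply: ler_prod => i _.
by rewrite sum_half_le sumr_ge0 // => j _; rewrite exprn_ge0 ?invr_ge0.
Qed.

(** The entries of a multi-index of degree [k] are at most [k], so that every large enough box
    contains all of them. *)
Lemma boxsum_homog k K (G : ('I_N -> nat) -> C) : (k < K)%N ->
  \sum_(m : {ffun 'I_N -> 'I_K} | mdeg (fun i => m i) == k) G (fun i => m i) =
  \sum_(m : {ffun 'I_N -> 'I_k.+1} | mdeg (fun i => m i) == k) G (fun i => m i).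
Proof.
case: K => // K kK.
have vN (m : 'I_N -> nat) i : mdeg m = k -> (m i < k.+1)%N.
  by move=> <-; rewrite /mdeg (bigD1 i) //= ltnS leq_addr.
rewrite (reindex_onto (fun m : {ffun 'I_N -> 'I_k.+1} => [ffun i => inord (m i) : 'I_K.+1])
  (fun m : {ffun 'I_N -> 'I_K.+1} => [ffun i => inord (m i) : 'I_k.+1])) /=; last first.
  move=> m /eqP mk; apply/ffunP => i; rewrite !ffunE; apply: val_inj => /=.
  by rewrite !inordK ?(vN _ _ mk).
have E (m : {ffun 'I_N -> 'I_k.+1}) :
  (fun i => [ffun i => inord (m i) : 'I_K.+1] i : nat) = (fun i => m i : nat).
  apply/funext => i; rewrite ffunE /= inordK //.
  exact: leq_trans (ltn_ord _) _.
apply: eq_big => [m|m _]; rewrite E //.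
case: (_ == k) => //=; apply/eqP/ffunP => i; rewrite !ffunE; apply: val_inj => /=.
by rewrite !inordK //; exact: leq_trans (ltn_ord _) _.
Qed.

(** The remainder is bounded uniformly in the order [n] and in the scale [s]: continuity is the case
    [n = 1], the derivative the case [n = 2], and the leading form comes from the first nonzero
    [w k]. *)
Definition homog_expansion (f : 'cV[C]_N -> C) (w : nat -> 'cV[C]_N -> C) (r K : R) :=
  [/\ 0 < r, 0 < K, forall k, polyfun (w k),
      forall k l h, w k (l *: h) = l ^+ k * w k h &
      forall n (s : R) (h : 'cV[C]_N), 0 <= s <= 1 -> (forall i, cabs (h i 0) <= s * r) ->
        cabs (f h - \sum_(k < n) w k h) <= K * s ^+ n].

Lemma analytic_expansion (f : 'cV[C]_N -> C) :
  analytic_at f 0 -> exists w r K, homog_expansion f w r K.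
Proof.
move=> [c [r0 [M [/gt0_complex[r r_gt0 ->] cM cvgf]]]].
pose w k h := \sum_(m : {ffun 'I_N -> 'I_k.+1} | mdeg (fun i => m i) == k)
  c [ffun i => m i : nat] * hmon h (fun i => m i).
have {}cM m : cabs (c m) * r ^+ mdeg m <= complex.Re M.
  have := cM m; rewrite cabsE -rmorphXn -rmorphM lecE => /andP[_] /le_trans -> //.
have M0 : 0 <= complex.Re M.
  by apply: le_trans (cM [ffun=> 0%N]); rewrite mulr_ge0 ?cabs_ge0 // exprn_ge0 // ltW.
(* Halving the radius gains a factor [2^-1 ^+ mdeg m] in each term, and these factors sum to at most
   [2 ^+ N] over any box. *)
exists w, (r / 2), (complex.Re M * 2 ^+ N + 1); split.
- lra.
- by rewrite ltr_pwDr // mulr_ge0 // exprn_ge0.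
- move=> k; apply: polyfun_sum => m _; apply: polyfunM; first exact: polyfun_cst.
  by apply: polyfun_prod => i _; apply: polyfunX; exact: polyfun_coord.
- move=> k l h; rewrite /w mulr_sumr; apply: eq_bigr => m /eqP mk.
  by rewrite hmonZ mk mulrCA.
move=> n s h /andP[s0 s1] hs.
have sr : s * (r / 2) < r.
  by rewrite (@le_lt_trans _ _ (r / 2)) ?ler_piMl //; lra.
have {cvgf} := cvgf h (fun i => _); rewrite add0r.
have Hh i : `|h i 0| < r%:C%C by rewrite cabsE ltcR (le_lt_trans (hs i)).
move=> /(_ Hh) /cvg_seqP cvgf.
apply/ler_addgt0Pr => e e0; have [n0 Hn0] := cvgf e e0.
(* This box is large enough both for the precision [e] and for containing all multi-indices of
   degree less than [n]. *)
pose K := maxn n n0; have {Hn0} := Hn0 K (leq_maxr _ _).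
set B := \sum_(m : {ffun _}) _ => HB.
suff BK : cabs (B - \sum_(k < n) w k h) <= (complex.Re M * 2 ^+ N + 1) * s ^+ n.
  by rewrite (le_trans (cabs_tri _ B _)) // addrC lerD.
pose G (m : 'I_N -> nat) := c [ffun i => m i : nat] * hmon h m.
have -> : \sum_(k < n) w k h =
   \sum_(m : {ffun 'I_N -> 'I_K} | (mdeg (fun i => m i) < n)%N) G (fun i => m i).
  transitivity (\sum_(k < n) \sum_(m : {ffun 'I_N -> 'I_K} | mdeg (fun i => m i) == k)
      G (fun i => m i)).
    apply: eq_bigr => k _; apply/esym/(@boxsum_homog k K G).
    exact: leq_trans (ltn_ord k) (leq_maxl _ _).
  rewrite (exchange_big_dep xpredT) //= [RHS]big_mkcond; apply: eq_bigr => m _.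
  case: ltnP => [mn|nm].
    rewrite (big_pred1 (Ordinal mn)) // => k /=.
  by rewrite big_pred0 // => k; apply/eqP => E; move: nm; rewrite E leqNgt ltn_ord.
have -> : B = \sum_(m : {ffun 'I_N -> 'I_K}) G (fun i => m i) by [].
rewrite (bigID (fun m : {ffun 'I_N -> 'I_K} => (mdeg (fun i => m i) < n)%N)) /= addrC addrK.
rewrite (le_trans (cabs_sum _ _ _)) //.
rewrite (@le_trans _ _ (\sum_(m : {ffun 'I_N -> 'I_K})
   complex.Re M * s ^+ n * (2^-1) ^+ mdeg (fun i => m i))) //; last first.
  rewrite -mulr_sumr mulrAC ler_wpM2r ?exprn_ge0 //.
  apply: ler_wpDr => //; apply: ler_wpM2l => //; exact: box_half_le.
rewrite big_mkcond /=; apply: ler_sum => m _.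
case: ltnP => /= [_|nm]; first by rewrite !mulr_ge0 ?exprn_ge0 ?invr_ge0.
rewrite /G cabsM (@le_trans _ _ (cabs (c [ffun i => m i : nat]) *
   (s * (r / 2)) ^+ mdeg (fun i => m i))) //.
  by rewrite ler_wpM2l ?cabs_ge0 // cabs_hmon_le.
have E : mdeg (fun i => m i) = mdeg [ffun i => m i : nat].
  by rewrite /mdeg; apply: eq_bigr => i _; rewrite ffunE.
rewrite E in nm *; rewrite [s * _]mulrA [s * _]mulrC exprMn exprMn !mulrA.
rewrite ler_wpM2r ?exprn_ge0 ?invr_ge0 //.
rewrite ler_pM ?mulr_ge0 ?cabs_ge0 ?exprn_ge0 // ?cM //; first exact: ltW.
by rewrite ler_wiXn2l.
Qed.

End Expansion.

(** * Roots of unity *)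

Section RootsOfUnity.
Variable R : realType.
Local Notation C := (R[i]).

Lemma prim_root_complex n : (0 < n)%N -> exists z : C, n.-primitive_root z.
Proof.
move=> n0; pose p : {poly C} := 'X^n - 1; have [r Dp] := closed_field_poly_normal p.
rewrite (monicP _) ?monicXnsubC // scale1r in Dp.
have rn1: all n.-unity_root r by apply/allP=> z; rewrite -root_prod_XsubC -Dp.
have sz_r: (n < (size r).+1)%N.
  by rewrite -(size_prod_XsubC r id) -Dp size_XnsubC.
have [|z] := hasP (has_prim_root n0 rn1 _ sz_r); last by exists z.
by rewrite -separable_prod_XsubC -Dp separable_Xn_sub_1 // pnatr_eq0 -lt0n.
Qed.

Lemma cabs_unity n (z : C) : (0 < n)%N -> z ^+ n = 1 -> cabs z = 1.
Proof.
move=> n0 zn; apply/eqP; rewrite -(@pexpr_eq1 _ _ n) ?cabs_ge0 //.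
by rewrite -cabsX zn cabs1.
Qed.

Lemma unity_sum n (z : C) k : (0 < n)%N -> n.-primitive_root z ->
  \sum_(j < n) z ^+ (j * k) = if (n %| k)%N then n%:R else 0.
Proof.
move=> n0 pz; case: ifPn => [/dvdnP[q ->]|nk].
  rewrite (eq_bigr (fun => 1)) ?sumr_const ?card_ord // => j _.
  by rewrite mulnA mulnC exprM (prim_expr_order pz) expr1n.
have zk : z ^+ k - 1 != 0 by rewrite subr_eq0 -(prim_order_dvd pz).
apply: (mulfI zk); rewrite mulr0.
under eq_bigr do rewrite mulnC exprM.
by rewrite -subrX1 -exprM mulnC exprM (prim_expr_order pz) expr1n subrr.
Qed.

End RootsOfUnity.

(** * Cauchy sequences with explicit error bounds *)

Section RealLimits.
Variable R : realType.
Local Notation C := (R[i]).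

(** The limit is the supremum of the lower ends of the intervals of radius [e n] around [u n]: each
    lower end is below each upper end. *)
Lemma cauchy_real (u e : nat -> R) :
  (forall n m, (n <= m)%N -> `|u n - u m| <= e n) -> exists l, forall n, `|u n - l| <= e n.
Proof.
move=> H; pose A : set R := [set u n - e n | n in setT].
have e0 n : 0 <= e n by rewrite (le_trans _ (H n n _)).
have AP n m : u m - e m <= u n + e n.
  have [/H|/ltnW/H] := leqP n m; rewrite ler_norml => /andP[];
  have := e0 n; have := e0 m; lra.
have supA : has_sup A.
  split; first by exists (u 0%N - e 0%N), 0%N.
  by exists (u 0%N + e 0%N) => _ [n _ <-].
exists (sup A) => n; rewrite ler_norml.
have : sup A <= u n + e n by apply: ge_sup; [exact: supA.1 | move=> _ [m _ <-]].
have : u n - e n <= sup A by apply: ub_le_sup; [exact: supA.2 | exists n].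
lra.
Qed.

Lemma ReB (x y : C) : complex.Re (x - y) = complex.Re x - complex.Re y.
Proof. by case: x y => [a b] [c d]. Qed.

Lemma ImB (x y : C) : complex.Im (x - y) = complex.Im x - complex.Im y.
Proof. by case: x y => [a b] [c d]. Qed.

Lemma Re_le_cabs (x : C) : `|complex.Re x| <= cabs x.
Proof. by rewrite -lecR -cabsE normc_ge_Re. Qed.

Lemma Im_le_cabs (x : C) : `|complex.Im x| <= cabs x.
Proof.
case: x => a b; rewrite /cabs /= -sqrtr_sqr ler_sqrt ?addr_ge0 ?sqr_ge0 //.
by rewrite lerDr sqr_ge0.
Qed.

Lemma cabs_le_ReIm (x : C) : cabs x <= `|complex.Re x| + `|complex.Im x|.
Proof.
rewrite {1}[x]complexE (le_trans (cabsD _ _)) // cabsM !cabs_real.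
by rewrite [cabs 'i%C](_ : _ = 1) ?mul1r // /cabs /= expr0n expr1n add0r sqrtr1.
Qed.

Lemma cauchy_complex (u : nat -> C) (e : nat -> R) :
  (forall n m, (n <= m)%N -> cabs (u n - u m) <= e n) ->
  exists l, forall n, cabs (u n - l) <= 2 * e n.
Proof.
move=> H.
have [a Ha] : exists l, forall n, `|complex.Re (u n) - l| <= e n.
  apply: cauchy_real => n m nm; rewrite -ReB.
  exact: le_trans (Re_le_cabs _) (H _ _ nm).
have [b Hb] : exists l, forall n, `|complex.Im (u n) - l| <= e n.
  apply: cauchy_real => n m nm; rewrite -ImB.
  exact: le_trans (Im_le_cabs _) (H _ _ nm).
exists (a +i* b)%C => n; rewrite (le_trans (cabs_le_ReIm _)) // ReB ImB /=.
by have := Ha n; have := Hb n; lra.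
Qed.

End RealLimits.

(** * Coefficients of polynomial functions and Cauchy's estimates *)

Section Monomials.
Variable R : realType.
Local Notation C := (R[i]).
Variable N : nat.
Local Notation expo := {ffun 'I_N -> nat}.

Definition evalmon (s : seq (C * expo)) (h : 'cV[C]_N) := \sum_(a <- s) a.1 * hmon h a.2.
Definition coefmon (s : seq (C * expo)) (m : expo) := \sum_(a <- s | a.2 == m) a.1.

Lemma hmonD h (m m' : expo) : hmon h (fun i => m i + m' i)%N = hmon h m * hmon h m' :> C.
Proof. by rewrite /hmon -big_split /=; apply: eq_bigr => i _; rewrite exprD. Qed.

Lemma polyfun_evalmon (p : 'cV[C]_N -> C) : polyfun p -> exists s, p =1 evalmon s.
Proof.
elim=> [c|i|f g _ [s Hs] _ [t Ht]|f g _ [s Hs] _ [t Ht]].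
- exists [:: (c, [ffun=> 0%N])] => h; rewrite /evalmon big_seq1 /hmon /= big1 ?mulr1 // => i _.
  by rewrite ffunE.
- exists [:: (1, [ffun j => (j == i) : nat])] => h; rewrite /evalmon big_seq1 mul1r /hmon /=.
  rewrite (bigD1 i) //= big1 ?ffunE ?eqxx ?mulr1 // => j /negbTE ji.
  by rewrite ffunE ji.
- by exists (s ++ t) => h; rewrite /evalmon big_cat /= Hs Ht.
- exists (allpairs (fun a b : C * expo => (a.1 * b.1, [ffun i => a.2 i + b.2 i]%N) : C * expo) s t) => h.
  rewrite /evalmon big_allpairs_dep /= Hs Ht /evalmon mulr_suml; apply: eq_bigr => a _.
  rewrite mulr_sumr; apply: eq_bigr => b _ /=.
  rewrite mulrACA -hmonD; congr (_ * _); apply: eq_bigr => i _; by rewrite ffunE.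
Qed.

Lemma coefmonB s t m :
  coefmon (s ++ [seq (- a.1, a.2) | a <- t]) m = coefmon s m - coefmon t m.
Proof.
by rewrite /coefmon big_cat big_map /= -sumrN.
Qed.

Lemma evalmonB s t h :
  evalmon (s ++ [seq (- a.1, a.2) | a <- t]) h = evalmon s h - evalmon t h.
Proof.
rewrite /evalmon big_cat big_map /= -sumrN; congr (_ + _).
by apply: eq_bigr => a _; rewrite mulNr.
Qed.

Definition expo_bound (s : seq (C * expo)) := (\max_(a <- s) \max_i a.2 i)%N.

Lemma expo_boundP s (a : C * expo) i : a \in s -> (a.2 i <= expo_bound s)%N.
Proof.
move=> sa; rewrite /expo_bound (leq_trans (leq_bigmax i)) //.
by rewrite (big_rem a) //= leq_max leqnn.
Qed.

Lemma evalmon_box s K h : (expo_bound s < K)%N ->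
  evalmon s h = \sum_(m : {ffun 'I_N -> 'I_K}) coefmon s [ffun i => m i : nat] * hmon h (fun i => m i).
Proof.
case: K => // K sK; rewrite /coefmon; under [RHS]eq_bigr do rewrite mulr_suml.
rewrite (exchange_big_dep xpredT) //= /evalmon big_seq_cond [RHS]big_seq_cond.
apply: eq_bigr => a; rewrite andbT => sa.
pose m0 : {ffun 'I_N -> 'I_K.+1} := [ffun i => inord (a.2 i)].
have m0E i : m0 i = a.2 i :> nat.
  by rewrite ffunE inordK // (leq_ltn_trans (expo_boundP i sa)).
rewrite (big_pred1 m0) /=.
  by congr (_ * _); apply: eq_bigr => i _; rewrite m0E.
move=> m /=; apply/eqP/eqP => [am|->].
  by apply/ffunP => i; apply: val_inj; rewrite /= m0E am ffunE.
by apply/ffunP => i; rewrite ffunE m0E.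
Qed.

(** Cauchy's estimate, with the integral over the torus of radius [rho] replaced by a finite Fourier
    sum over the [K]-th roots of unity. Since [K] exceeds all the exponents, two of them are equal
    as soon as they are congruent modulo [K], and the sum isolates the coefficient exactly. *)
Lemma coefmon_bound s (rho B : R) m : 0 < rho ->
  (forall h : 'cV[C]_N, (forall i, cabs (h i 0) = rho) -> cabs (evalmon s h) <= B) ->
  cabs (coefmon s m) * rho ^+ mdeg m <= B.
Proof.
move=> rho0 HB; pose K := (expo_bound s + mdeg m).+1.
have [z pz] := prim_root_complex R (isT : 0 < K)%N.
have z1 : cabs z = 1 by apply: (@cabs_unity _ K) => //; exact: prim_expr_order.
pose pt (f : {ffun 'I_N -> 'I_K}) : 'cV[C]_N := \col_i (rho%:C%C * z ^+ f i).
(* The conjugate character: [K - m i] stands for the opposite of [m i] modulo [K]. *)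
pose wt (f : {ffun 'I_N -> 'I_K}) : C := \prod_i z ^+ (f i * (K - m i)).
have mK i : (m i < K)%N.
  by rewrite ltnS (leq_trans _ (leq_addl _ _)) // /mdeg (bigD1 i) //= leq_addr.
have HS : \sum_f evalmon s (pt f) * wt f =
    coefmon s m * rho%:C%C ^+ mdeg m * K%:R ^+ N.
  rewrite /coefmon !mulr_suml /evalmon; under eq_bigr do rewrite mulr_suml.
  rewrite exchange_big /= [RHS]big_mkcond /= big_seq_cond [RHS]big_seq_cond.
  apply: eq_bigr => a; rewrite andbT => sa.
  transitivity (a.1 * rho%:C%C ^+ mdeg a.2 *
     \prod_i \sum_(j < K) z ^+ (j * (a.2 i + (K - m i)))).
    rewrite bigA_distr_bigA mulr_sumr; apply: eq_bigr => f _.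
    rewrite -!mulrA; congr (_ * _); rewrite /mdeg -prodrXr /hmon /wt -!big_split /=.
    apply: eq_bigr => i _; rewrite mxE exprMn mulnDr exprD -mulrA; congr (_ * _).
    by rewrite -exprM.
  under eq_bigr do rewrite unity_sum //.
  have E i : (K %| a.2 i + (K - m i))%N = (a.2 i == m i).
    have aK : (a.2 i < K)%N.
      by rewrite ltnS (leq_trans (expo_boundP i sa)) // leq_addr.
    have {}mK := mK i; apply/idP/eqP => [/dvdnP[[|[|q]] Hq]|->]; try nia.
    by rewrite subnKC // ltnW.
  case: eqP => [am|/eqP am].
    under eq_bigr => i _ do rewrite E am eqxx.
    rewrite am.
    by rewrite prodr_const card_ord.
  have [i ami] : exists i, a.2 i != m i.
    apply/existsP; rewrite -negb_forall; apply: contra am => /forallP am.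
    by apply/eqP/ffunP => i; apply/eqP.
  by rewrite (bigD1 i) //= E (negbTE ami) mul0r mulr0.
have K0 : 0 < (K%:R : R) ^+ N by rewrite exprn_gt0 // ltr0n.
rewrite -(ler_pM2r K0).
have -> : cabs (coefmon s m) * rho ^+ mdeg m * K%:R ^+ N =
   cabs (\sum_f evalmon s (pt f) * wt f).
  by rewrite HS !cabsM !cabsX cabs_nat cabs_real gtr0_norm.
rewrite (le_trans (cabs_sum _ _ _)) //.
rewrite (@le_trans _ _ (\sum_(f : {ffun 'I_N -> 'I_K}) B)) //.
  apply: ler_sum => f _; rewrite cabsM /wt cabs_prod big1 ?mulr1; last first.
    by move=> i _; rewrite cabsX z1 expr1n.
  by apply: HB => i; rewrite mxE cabsM cabs_real cabsX z1 expr1n mulr1 gtr0_norm.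
by rewrite sumr_const card_ffun !card_ord -natrX mulr_natr.
Qed.

End Monomials.

(** * Uniform limits of polynomials are analytic *)

Section Weierstrass.
Variable R : realType.
Local Notation C := (R[i]).
Variable N : nat.

Lemma half_lt (B e : R) : 0 < e -> exists n, B * 2^-1 ^+ n <= e.
Proof.
move=> e0; have [n Bn] : exists n : nat, B / e <= n%:R.
  by exists (Num.trunc (B / e)).+1; rewrite ltW // truncnS_gt.
exists n; rewrite ler_pdivrMr // in Bn.
have n2 : (n%:R : R) <= 2 ^+ n by rewrite -natrX ler_nat ltnW // ltn_expl.
rewrite exprVn ler_pdivrMr ?exprn_gt0 //.
by rewrite (le_trans Bn) // mulrC ler_wpM2l // ltW.
Qed.

(* By Cauchy's estimates, obtained by averaging over roots
   of unity, the coefficients of uniformly convergent polynomials converge. *)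
Lemma approx_on_analytic (f : 'cV[C]_N -> C) r : 0 < r -> approx_on r f -> analytic_at f 0.
Proof.
move=> r0 af; pose q : R := 2^-1; have q0 : 0 < q by rewrite invr_gt0.
have [n|s Hs] := @choice nat (seq (C * {ffun 'I_N -> nat}))
  (fun n s => forall h, pdisc r h -> cabs (f h - evalmon s h) <= q ^+ n).
  have [|p /polyfun_evalmon[s ps] Hp] := af (q ^+ n).
    by rewrite exprn_gt0.
  by exists s => h hr; rewrite -ps; exact: Hp.
pose rho := r / 2; have rho0 : 0 < rho by rewrite divr_gt0.
have rhor : rho < r by rewrite /rho; lra.
have cauchy m n n' : (n <= n')%N ->
    cabs (coefmon (s n) m - coefmon (s n') m) * rho ^+ mdeg m <= 2 * q ^+ n.
  move=> nn'; rewrite -coefmonB; apply: coefmon_bound => // h hrho.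
  have hr : pdisc r h by move=> i; rewrite hrho.
  rewrite evalmonB (le_trans (cabs_tri _ (f h) _)) // cabs_distC.
  have : q ^+ n' <= q ^+ n by rewrite ler_wiXn2l // ?invf_le1 ?ltW //; lra.
  have := Hs n h hr; have := Hs n' h hr; lra.
have rd m : 0 < rho ^+ m by rewrite exprn_gt0.
have [m|c Hc] := @choice {ffun 'I_N -> nat} C
  (fun m c => forall n, cabs (coefmon (s n) m - c) * rho ^+ mdeg m <= 4 * q ^+ n).
  have [n n' nn'|c Hc] := @cauchy_complex _ (fun n => coefmon (s n) m)
      (fun n => 2 * q ^+ n / rho ^+ mdeg m); first by rewrite ler_pdivlMr ?cauchy.
  exists c => n; rewrite -ler_pdivlMr // (le_trans (Hc n)) // !mulrA.
  by rewrite -natrM.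
have [B B0 HB] := approx_on_bounded af.
(* The polynomial [s 0] is at most [1 + B] on the torus of radius [rho], and its coefficients,
   scaled by powers of [rho], are within [4] of those of the limit. The radius is halved for the
   sums over boxes, as in [analytic_expansion]. *)
exists c, (rho / 2)%:C%C, (4 + (1 + B))%:C%C; split.
- by rewrite ltcR divr_gt0.
- move=> m; rewrite cabsE -rmorphXn -rmorphM lecR.
  rewrite (@le_trans _ _ (cabs (c m) * rho ^+ mdeg m)) //.
    rewrite ler_wpM2l ?cabs_ge0 // lerXn2r ?nnegrE ?ltW ?divr_gt0 //; lra.
  have H1 : cabs (coefmon (s 0%N) m) * rho ^+ mdeg m <= 1 + B.
    apply: coefmon_bound => // h hrho.
    have hr : pdisc r h by move=> i; rewrite hrho.
    rewrite -[evalmon _ _](subrK (f h)) (le_trans (cabsD _ _)) // cabs_distC.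
    by have := Hs 0%N h hr; have := HB h hr; rewrite expr0; lra.
  have := Hc m 0%N; rewrite expr0.
  have := cabs_tri (c m) (coefmon (s 0%N) m) 0; rewrite !subr0 cabs_distC.
  move=> /(ler_wpM2r (ltW (rd (mdeg m)))); rewrite mulrDl; lra.
move=> h hr; rewrite add0r.
have {}hr i : cabs (h i 0) <= rho / 2.
  by have := hr i; rewrite cabsE ltcR => /ltW.
apply/cvg_seqP => e e0.
have [n Hn] := half_lt (1 + 4 * 2 ^+ N) e0.
exists (expo_bound (s n)).+1 => K sK.
apply: le_trans Hn; rewrite (le_trans (cabs_tri _ (evalmon (s n) h) _)) // mulrDl mul1r.
rewrite lerD ?Hs //; first by move=> i; rewrite (le_lt_trans (hr i)) // /rho; lra.
rewrite (evalmon_box h sK) -sumrB (le_trans (cabs_sum _ _ _)) //.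
rewrite -mulrA [_ * _ ^+ n]mulrC mulrA.
rewrite (@le_trans _ _ (4 * q ^+ n * \sum_(m : {ffun 'I_N -> 'I_K}) q ^+ mdeg (fun i => m i))) //.
  rewrite mulr_sumr; apply: ler_sum => m _.
  rewrite -mulrBl cabsM.
  have hm : cabs (hmon h (fun i => m i)) <= (rho * q) ^+ mdeg (fun i => m i) by exact: cabs_hmon_le.
  rewrite (le_trans (ler_wpM2l (cabs_ge0 _) hm)) // exprMn mulrA ler_wpM2r ?exprn_ge0 ?(ltW q0) //.
  have E : mdeg (fun i => m i) = mdeg [ffun i => m i : nat].
    by rewrite /mdeg; apply: eq_bigr => i _; rewrite ffunE.
  by rewrite E Hc.
by rewrite ler_wpM2l ?box_half_le // mulr_ge0 // exprn_ge0 // ltW.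
Qed.

Lemma homog_expansion_approx (f : 'cV[C]_N -> C) w r K :
  homog_expansion f w r K -> approx_on (r / 2) f.
Proof.
move=> [r0 K0 pw wZ H] e e0; have [n Hn] := half_lt K e0.
exists (fun h => \sum_(k < n) w k h); first exact: polyfun_sum.
move=> h hr; apply: le_trans Hn; apply: H; first lra.
by move=> i; rewrite mulrC ltW.
Qed.

Lemma analytic_approx (f : 'cV[C]_N -> C) : analytic_at f 0 <->
  exists2 r, 0 < r & approx_on r f.
Proof.
split=> [/analytic_expansion[w [r [K wrK]]]|[r r0]]; last exact: approx_on_analytic.
exists (r / 2); last exact: homog_expansion_approx wrK.
by case: wrK => r0 _ _ _ _; rewrite divr_gt0.
Qed.

End Weierstrass.

(** * Analytic germs *)

Section AnalyticGerms.
Variable R : realType.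
Local Notation C := (R[i]).

Definition an (N : nat) (f : 'cV[C]_N -> C) := exists2 r, 0 < r & approx_on r f.

Section Closure.
Variable N : nat.
Implicit Types f g : 'cV[C]_N -> C.

Lemma an_polyfun f : polyfun f -> an f.
Proof. by move=> pf; exists 1 => //; exact: approx_on_polyfun. Qed.

Lemma an_cst c : an (fun _ : 'cV[C]_N => c).
Proof. by apply: an_polyfun; exact: polyfun_cst. Qed.

Lemma an_coord i : an (fun h : 'cV[C]_N => h i 0).
Proof. by apply: an_polyfun; exact: polyfun_coord. Qed.

Lemma an2 f g : an f -> an g ->
  exists2 r, 0 < r & approx_on r f /\ approx_on r g.
Proof.
move=> [r r0 rf] [s s0 sg]; exists (Num.min r s); first by rewrite lt_min r0.
by split; [apply: approx_on_le rf | apply: approx_on_le sg]; rewrite ge_min lexx ?orbT.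
Qed.

Lemma anD f g : an f -> an g -> an (fun h => f h + g h).
Proof.
by move=> af ag; have [r r0 []] := an2 af ag; exists r => //; exact: approx_onD.
Qed.

Lemma anM f g : an f -> an g -> an (fun h => f h * g h).
Proof.
by move=> af ag; have [r r0 []] := an2 af ag; exists r => //; exact: approx_onM.
Qed.

Lemma anB f g : an f -> an g -> an (fun h => f h - g h).
Proof.
by move=> af ag; have [r r0 []] := an2 af ag; exists r => //; exact: approx_onB.
Qed.

Lemma anX f n : an f -> an (fun h => f h ^+ n).
Proof. by move=> [r r0 rf]; exists r => //; exact: approx_onX. Qed.

Lemma an_sum I (s : seq I) (P : pred I) (F : I -> 'cV[C]_N -> C) :
  (forall i, P i -> an (F i)) -> an (fun h => \sum_(i <- s | P i) F i h).
Proof.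
move=> pF; elim: s => [|i s IH].
  by under eq_fun => ? do rewrite big_nil; exact: an_cst.
under eq_fun => ? do rewrite big_cons.
by case Pi: (P i) => //; apply: anD => //; exact: pF.
Qed.

Lemma an_prod I (s : seq I) (P : pred I) (F : I -> 'cV[C]_N -> C) :
  (forall i, P i -> an (F i)) -> an (fun h => \prod_(i <- s | P i) F i h).
Proof.
move=> pF; elim: s => [|i s IH].
  by under eq_fun => ? do rewrite big_nil; exact: an_cst.
under eq_fun => ? do rewrite big_cons.
by case Pi: (P i) => //; apply: anM => //; exact: pF.
Qed.

Lemma an_near f g r : 0 < r -> (forall h, pdisc r h -> f h = g h) -> an f -> an g.
Proof.
move=> r0 fg [s s0 sf]; exists (Num.min r s); first by rewrite lt_min r0.
apply: (@approx_on_ext _ _ _ f).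
  by move=> h hr; apply: fg => i; rewrite (lt_le_trans (hr i)) // ge_min lexx.
by apply: approx_on_le sf; rewrite ge_min lexx orbT.
Qed.

Lemma an_lip0 f : an f -> exists r K : R, [/\ 0 < r, 0 < K &
  forall (s : R) (h : 'cV[C]_N), 0 <= s <= r -> (forall i, cabs (h i 0) <= s) -> cabs (f h - f 0) <= K * s].
Proof.
move=> /analytic_approx/analytic_expansion[w [r [K [r0 K0 pw wZ H]]]].
exists r, (K / r); split; rewrite ?divr_gt0 // => s h /andP[s0 sr] hs.
have w0 h' : w 0%N h' = w 0%N 0 by have := wZ 0%N 0 h'; rewrite scale0r expr0 mul1r.
have f0 : f 0 = w 0%N 0.
  apply/eqP; rewrite -subr_eq0 -cabs_eq0 eq_le cabs_ge0 andbT.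
  have := H 1%N 0 0; rewrite big_ord1 expr1 mulr0; apply; rewrite ?lexx //=.
  by move=> i; rewrite mxE cabs0 mul0r.
have := H 1%N (s / r) h; rewrite big_ord1 expr1 f0 w0.
have -> : K / r * s = K * (s / r) by ring.
apply; first by apply/andP; split; [rewrite divr_ge0 // ltW | rewrite ler_pdivrMr ?mul1r].
by move=> i; rewrite divfK ?gt_eqF.
Qed.

Lemma an_cont0 f (e : R) : an f -> 0 < e ->
  exists2 r, 0 < r & forall h, pdisc r h -> cabs (f h - f 0) <= e.
Proof.
move=> /an_lip0[r [K [r0 K0 H]]] e0; exists (Num.min r (e / K)).
  by rewrite lt_min r0 divr_gt0.
move=> h hr; rewrite (le_trans (H (Num.min r (e / K)) h _ _)) //.
- by rewrite ge_min lexx andbT ltW // lt_min r0 divr_gt0.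
- by move=> i; rewrite ltW.
- by rewrite mulrC -ler_pdivlMr // ge_min lexx orbT.
Qed.

(** Geometric series in [1 - f h / f 0], which is at most [1 / 2] near the origin. *)
Lemma an_inv f : an f -> f 0 != 0 -> an (fun h => (f h)^-1).
Proof.
move=> af f0; pose c := f 0; pose g h := 1 - f h / c.
have ag : an g by apply: anB; [exact: an_cst | apply: anM => //; exact: an_cst].
have [r r0 Hr] := @an_cont0 g (2^-1) ag (ltac:(by rewrite invr_gt0)).
have g0 : g 0 = 0 by rewrite /g divff ?subrr.
have {}Hr h : pdisc r h -> cabs (g h) <= 2^-1 by move=> /Hr; rewrite g0 subr0.
have [r' r'0 [agr _]] := an2 ag ag.
exists (Num.min r r'); first by rewrite lt_min r0.
have {agr} : approx_on (Num.min r r') g.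
  by apply: approx_on_le agr; rewrite ge_min lexx orbT.
have {}Hr h : pdisc (Num.min r r') h -> cabs (g h) <= 2^-1.
  by move=> hr; apply: Hr => i; rewrite (lt_le_trans (hr i)) // ge_min lexx.
move: (Num.min r r') Hr => {r0 r'0 r'}{}r Hr agr.
apply: approx_on_lim => e e0.
have [n Hn] := half_lt (2 / cabs c) e0.
exists (fun h => c^-1 * \sum_(k < n) g h ^+ k).
  by apply: approx_onM; [exact: approx_on_cst | apply: approx_on_sum => i _; exact: approx_onX].
move=> h /Hr gh; have fE : f h = c * (1 - g h) by rewrite /g; field.
have g1 : 2^-1 <= cabs (1 - g h).
  by have := cabs_subr 1 (g h); rewrite cabs1; lra.
have g1n : 1 - g h != 0 by rewrite -cabs_gt0; lra.
apply: le_trans Hn.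
have -> : (f h)^-1 - c^-1 * \sum_(k < n) g h ^+ k = c^-1 * (1 - g h)^-1 * g h ^+ n.
  have H : 1 - g h ^+ n = (1 - g h) * \sum_(k < n) g h ^+ k.
    by rewrite -[1 - g h ^+ n]opprB subrX1 -mulNr opprB.
  have -> : g h ^+ n = 1 - (1 - g h) * \sum_(k < n) g h ^+ k by rewrite -H; ring.
  by rewrite fE; field; apply/andP.
rewrite !cabsM !cabsV cabsX.
rewrite ler_pM ?exprn_ge0 ?mulr_ge0 ?invr_ge0 ?cabs_ge0 //; last first.
  by rewrite lerXn2r ?nnegrE ?cabs_ge0 ?invr_ge0.
rewrite mulrC ler_wpM2r ?invr_ge0 ?cabs_ge0 //.
by rewrite invf_ple ?posrE //; lra.
Qed.

End Closure.

Lemma fin_radius (I : finType) (P : I -> R -> Prop) :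
  (forall i (r r' : R), 0 < r' -> r' <= r -> P i r -> P i r') ->
  (forall i, exists2 r, 0 < r & P i r) -> exists2 r, 0 < r & forall i, P i r.
Proof.
move=> Ple Pi.
suff H (l : seq I) : exists2 r, 0 < r & forall i, i \in l -> P i r.
  by have [r r0 Hr] := H (enum I); exists r => // i; apply: Hr; rewrite mem_enum.
elim: l => [|i l [s s0 IH]]; first by exists 1.
have [t t0 Pt] := Pi i; have m0 : 0 < Num.min s t by rewrite lt_min s0.
exists (Num.min s t) => // j; rewrite inE => /predU1P[->|/IH].
  by apply: Ple Pt; rewrite // ge_min lexx orbT.
by apply: Ple; rewrite // ge_min lexx.
Qed.

Lemma pdisc_le N r r' (h : 'cV[C]_N) : r' <= r -> pdisc r' h -> pdisc r h.
Proof. by move=> rr hr i; exact: lt_le_trans (hr i) rr. Qed.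

Lemma an_comp N M (f : 'cV[C]_N -> C) (g : 'cV[C]_M -> 'cV[C]_N) :
  an f -> (forall i, an (fun h => g h i 0)) -> g 0 = 0 -> an (f \o g).
Proof.
move=> [r r0 rf] ag g0.
have [i s s' s'0 s's [H1 H2]|i|s s0 Hs] := @fin_radius _ (fun i s =>
    approx_on s (fun h => g h i 0) /\ forall h, pdisc s h -> cabs (g h i 0) < r).
- by split; [exact: approx_on_le H1 | move=> h /(pdisc_le s's)/H2].
- have r20 : 0 < r / 2 by rewrite divr_gt0.
  have [t t0 Ht] := an_cont0 (ag i) r20; have [u u0 Hu] := ag i.
  exists (Num.min t u); first by rewrite lt_min t0.
  split; first by apply: approx_on_le Hu; rewrite ge_min lexx orbT.
  move=> h hr; have := Ht h; rewrite g0 mxE subr0 => /(_ _)/le_lt_trans; apply; last lra.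
  by apply: pdisc_le hr; rewrite ge_min lexx.
exists s => //; apply: approx_on_comp rf _ _ => [i|h hs i]; first by case: (Hs i).
by case: (Hs i) => _; apply.
Qed.

End AnalyticGerms.

(** * Germs of functions of one variable *)

Section OneVariable.
Variable R : realType.
Local Notation C := (R[i]).
Implicit Types f u : C -> C.

Definition cfun1 f (h : 'cV[C]_1) := f (h 0 0).
Definition an1 f := an (cfun1 f).

Lemma pdisc1 r (h : 'cV[C]_1) : pdisc r h <-> cabs (h 0 0) < r.
Proof. by split=> [|hr i]; [exact | rewrite (ord1 i)]. Qed.

Lemma an1_comp N u (f : 'cV[C]_N -> C) : an1 u -> an f -> f 0 = 0 -> an (fun h => u (f h)).
Proof.
move=> au af f0; have := @an_comp _ _ _ (cfun1 u) (fun h => const_mx (f h)) au.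
have -> : cfun1 u \o (fun h => const_mx (f h)) = (fun h => u (f h)).
  by apply/funext => h; rewrite /= /cfun1 mxE.
apply; last by apply/matrixP => i j; rewrite !mxE f0.
by move=> i; under eq_fun => ? do rewrite mxE.
Qed.

Lemma an1_cst c : an1 (fun=> c). Proof. exact: an_cst. Qed.
Lemma an1_id : an1 id. Proof. exact: an_coord. Qed.
Lemma an1B f u : an1 f -> an1 u -> an1 (fun t => f t - u t). Proof. exact: anB. Qed.
Lemma an1M f u : an1 f -> an1 u -> an1 (fun t => f t * u t). Proof. exact: anM. Qed.
Lemma an1X f n : an1 f -> an1 (fun t => f t ^+ n). Proof. exact: anX. Qed.
Lemma an1V f : an1 f -> f 0 != 0 -> an1 (fun t => (f t)^-1).
Proof. by move=> af f0; apply: an_inv; rewrite /cfun1 ?mxE. Qed.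
Lemma an1_cont0 f (e : R) : an1 f -> 0 < e ->
  exists2 r, 0 < r & forall t, cabs t < r -> cabs (f t - f 0) <= e.
Proof.
move=> af e0; have [r r0 H] := an_cont0 af e0; exists r => // t tr.
have := H (const_mx t); rewrite /cfun1 !mxE; apply; apply/pdisc1; by rewrite mxE.
Qed.

Lemma an1_lip0 f : an1 f -> exists r K : R, [/\ 0 < r, 0 < K &
  forall t, cabs t <= r -> cabs (f t - f 0) <= K * cabs t].
Proof.
move=> /an_lip0[r [K [r0 K0 H]]]; exists r, K; split=> // t tr.
have := H (cabs t) (const_mx t); rewrite /cfun1 !mxE cabs_ge0 tr; apply=> // i.
by rewrite mxE.
Qed.

Definition power_series f (c : nat -> C) (r K : R) :=
  [/\ 0 < r, 0 < K & forall n s t, 0 <= s <= 1 -> cabs t <= s * r ->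
    cabs (f t - \sum_(k < n) c k * t ^+ k) <= K * s ^+ n].

Lemma an1_power_series f : an1 f -> exists c r K, power_series f c r K.
Proof.
move=> /analytic_approx/analytic_expansion[w [r [K [r0 K0 pw wZ H]]]].
exists (fun k => w k (const_mx 1)), r, K; split=> // n s t s01 ts.
have := H n s (const_mx t) s01; rewrite /cfun1 mxE.
under eq_bigr => k _.
  rewrite (_ : const_mx t = t *: const_mx 1); last first.
    by apply/matrixP => i j; rewrite !mxE mulr1.
  rewrite wZ mulrC; over.
by apply=> i; rewrite mxE.
Qed.

(** Division by [t ^+ k] at the level of remainders. Since the bound of [f] holds at every scale, it
    can be applied at the scale of [t] itself, where the division costs only [r ^+ k]. *)
Lemma power_series_shift f c r K k u : power_series f c r K ->
  (forall i, (i < k)%N -> c i = 0) -> u 0 = c k ->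
  (forall t, t != 0 -> f t = t ^+ k * u t) ->
  power_series u (fun i => c (k + i)%N) r (2 * K / r ^+ k).
Proof.
move=> [r0 K0 H] ck u0 fu; have rk n : 0 < r ^+ n by exact: exprn_gt0.
split; rewrite ?divr_gt0 ?mulr_gt0 // => n s t /andP[s0 s1] ts.
have [->|t0] := eqVneq t 0.
  case: n => [|n].
    rewrite big_ord0 subr0 mulr1 u0 ler_pdivlMr //.
    rewrite -(gtr0_norm r0) -cabs_real -cabsX -cabsM.
    (* Two consecutive remainders at the point [r] bound the coefficient [c k], whence the factor
       [2]. *)
    have := H k.+1 1 r%:C%C; have := H k 1 r%:C%C.
    rewrite big_ord_recr /= !expr1n !mulr1 !mul1r cabs_real gtr0_norm // lexx ler01.
    rewrite big1 ?add0r ?subr0; last by move=> i _; rewrite ck ?mul0r.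
    move=> /(_ isT (lexx _)) H1 /(_ isT (lexx _)) H2.
    have -> : c k * r%:C%C ^+ k = f r%:C%C - (f r%:C%C - c k * r%:C%C ^+ k) by ring.
    by rewrite (le_trans (cabsB _ _)) //; lra.
  rewrite big_ord_recl expr0 mulr1 addn0 u0 big1 ?addr0 ?subrr ?cabs0; last first.
    by move=> i _; rewrite expr0n mulr0.
  by rewrite mulr_ge0 ?exprn_ge0 // divr_ge0 ?mulr_ge0 ?ltW.
have tk : 0 < cabs t ^+ k by rewrite exprn_gt0 // cabs_gt0.
have sE : cabs t <= cabs t / r * r by rewrite divfK ?gt_eqF.
have s'1 : 0 <= cabs t / r <= 1.
  by rewrite divr_ge0 ?cabs_ge0 ?(ltW r0) //= ler_pdivrMr // (le_trans ts) // ler_wpM2r // ltW.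
have := H (k + n)%N _ t s'1 sE.
rewrite fu // big_split_ord /= big1 ?add0r; last by move=> i _; rewrite ck ?mul0r.
under eq_bigr do rewrite exprD mulrCA.
rewrite -mulr_sumr -mulrBr cabsM cabsX -ler_pdivlMl // => /le_trans; apply.
have -> : (cabs t ^+ k)^-1 * (K * (cabs t / r) ^+ (k + n)) = K / r ^+ k * (cabs t / r) ^+ n.
  rewrite exprD expr_div_n; field; by rewrite !gt_eqF // exprn_gt0 // cabs_gt0.
have [/andP[q0 _] Kr0] : 0 <= cabs t / r <= 1 /\ 0 < K / r ^+ k by rewrite divr_gt0.
apply: ler_pM; rewrite ?exprn_ge0 ?(ltW Kr0) //.
  by rewrite ler_wpM2r ?invr_ge0 ?(ltW (rk k)) //; lra.
by rewrite lerXn2r ?nnegrE // ler_pdivrMr.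
Qed.

Lemma power_series_an1 f c r K : power_series f c r K -> an1 f.
Proof.
move=> [r0 K0 H]; exists (r / 2); first lra.
move=> e e0; have [n Hn] := half_lt K e0.
exists (fun h : 'cV[C]_1 => \sum_(k < n) c k * h 0 0 ^+ k).
  apply: polyfun_sum => k _; apply: polyfunM; first exact: polyfun_cst.
  by apply: polyfunX; exact: polyfun_coord.
move=> h /pdisc1 hr; apply: le_trans Hn; apply: H; first lra.
by rewrite mulrC ltW.
Qed.

Lemma power_series0 f c r K : power_series f c r K -> f 0 = c 0%N.
Proof.
move=> [r0 K0 H]; apply/eqP; rewrite -subr_eq0 -cabs_eq0 eq_le cabs_ge0 andbT.
by have := H 1%N 0 0; rewrite big_ord1 !expr1 mulr0 mulr1 cabs0 mul0r lexx ler01; apply.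
Qed.

Lemma an1_divX f : an1 f -> f 0 = 0 ->
  exists2 u, an1 u & forall t, f t = t * u t.
Proof.
move=> /an1_power_series[c [r [K H]]] f0; have c0 := power_series0 H.
exists (fun t => if t == 0 then c 1%N else f t / t).
  apply: (@power_series_an1 _ (fun i => c (1 + i)%N) r); apply: power_series_shift H _ _ _.
  - by case=> // _; rewrite -c0.
  - by rewrite eqxx.
  - by move=> t t0; rewrite (negbTE t0) expr1 mulrC divfK.
by move=> t; case: eqVneq => [->|t0]; rewrite ?f0 ?mul0r // mulrC divfK.
Qed.

Lemma an1_order f : an1 f -> (exists2 r, 0 < r & forall t, cabs t < r -> f t = 0) \/
  exists k u, [/\ an1 u, u 0 != 0 & forall t, t != 0 -> f t = t ^+ k * u t].
Proof.
move=> /an1_power_series[c [r [K H]]].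
have [ex_c|no_c] := pselect (exists k, c k != 0); last first.
  left; have [r0 K0 Hf] := H; exists (r / 2); first lra.
  move=> t tr; apply: cabs_eq_lim => e e0; have [n Hn] := half_lt K e0.
  apply: le_trans Hn; have := Hf n 2^-1 t; rewrite big1; last first.
    by move=> i _; case: (eqVneq (c i) 0) => [->|ci]; [rewrite mul0r|case: no_c; exists i].
  by apply; [lra | rewrite mulrC ltW].
right; pose k := ex_minn ex_c; exists k.
have [ck cmin] : c k != 0 /\ forall i, (i < k)%N -> c i = 0.
  rewrite /k; case: ex_minnP => m cm mmin; split=> // i im.
  by apply/eqP; apply: contraLR im => /mmin; rewrite -leqNgt.
exists (fun t => if t == 0 then c k else f t / t ^+ k).
have fE t : t != 0 -> f t = t ^+ k * (if t == 0 then c k else f t / t ^+ k).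
  by move=> t0; rewrite (negbTE t0) mulrC divfK // expf_neq0.
split; rewrite ?eqxx //.
apply: (@power_series_an1 _ (fun i => c (k + i)%N) r).
by apply: power_series_shift H cmin _ fE; rewrite eqxx.
Qed.

(** Term by term, through the factorization of [t ^+ k - t' ^+ k]. On the disk of radius [r / 4] the
    number [k] of summands is absorbed by a power of [2], which leaves a geometric series of ratio
    [1 / 2]. *)
Lemma an1_lipschitz f : an1 f -> exists r K : R, [/\ 0 < r, 0 < K &
  forall t t', cabs t <= r -> cabs t' <= r -> cabs (f t - f t') <= K * cabs (t - t')].
Proof.
move=> /an1_power_series[c [r [K [r0 K0 H]]]].
have ck k : cabs (c k) * r ^+ k <= 2 * K.
  have -> : cabs (c k) * r ^+ k = cabs (c k * r%:C%C ^+ k).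
    by rewrite cabsM cabsX cabs_real gtr0_norm.
  have := H k.+1 1 r%:C%C; have := H k 1 r%:C%C.
  rewrite big_ord_recr /= !expr1n !mulr1 !mul1r cabs_real gtr0_norm // lexx ler01.
  set S := \sum_(i < k) _ => /(_ isT (lexx _)) H1 /(_ isT (lexx _)) H2.
  have -> : c k * r%:C%C ^+ k = (f r%:C%C - S) - (f r%:C%C - (S + c k * r%:C%C ^+ k)) by ring.
  by rewrite (le_trans (cabsB _ _)) //; lra.
exists (r / 4), (8 * K / r); split; rewrite ?divr_gt0 ?mulr_gt0 // => t t' tr tr'.
apply/ler_addgt0Pr => e e0; have [n Hn] := half_lt (2 * K) e0.
pose S x := \sum_(k < n) c k * x ^+ k.
have Hs x : cabs x <= r / 4 -> cabs (f x - S x) <= K * 2^-1 ^+ n.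
  by move=> xr; apply: H; [lra | rewrite (le_trans xr) //; lra].
have -> : f t - f t' = (f t - S t) - (f t' - S t') + (S t - S t') by ring.
rewrite (le_trans (cabsD _ _)) // addrC lerD //; last first.
  by rewrite (le_trans (cabsB _ _)) //; have := Hs t tr; have := Hs t' tr'; lra.
rewrite /S -sumrB (le_trans (cabs_sum _ _ _)) //.
rewrite (@le_trans _ _ (\sum_(k < n) 4 * K / r * 2^-1 ^+ k * cabs (t - t'))) //; last first.
  rewrite -mulr_suml -mulr_sumr ler_wpM2r ?cabs_ge0 //.
  have := sum_half_le R n; have : 0 < 4 * K / r by rewrite divr_gt0 ?mulr_gt0.
  set A := 4 * K / r; have -> : 8 * K / r = A * 2 by rewrite /A; ring.
  by move=> A0 S2; rewrite ler_wpM2l // ltW.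
apply: ler_sum => k _; rewrite -mulrBr subrXX mulrCA !cabsM mulrC ler_wpM2r ?cabs_ge0 //.
case: k => -[|k] kn /=; first by rewrite big_ord0 cabs0 mulr0 mulr_ge0 // divr_ge0 ?mulr_ge0 ?ltW.
have Hk : cabs (\sum_(i < k.+1) t ^+ (k.+1.-1 - i) * t' ^+ i) <= k.+1%:R * (r / 4) ^+ k.
  rewrite (le_trans (cabs_sum _ _ _)) //.
  rewrite (@le_trans _ _ (\sum_(i < k.+1) (r / 4) ^+ k)) //; last by rewrite sumr_const card_ord mulr_natl.
  apply: ler_sum => i _; rewrite cabsM !cabsX.
  have -> : (r / 4) ^+ k = (r / 4) ^+ (k.+1.-1 - i) * (r / 4) ^+ i.
    by rewrite -exprD subnK // -ltnS.
  by rewrite ler_pM ?exprn_ge0 ?cabs_ge0 // lerXn2r ?nnegrE ?cabs_ge0 ?divr_ge0 ?(ltW r0).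
have ckE : cabs (c k.+1) <= 2 * K / r ^+ k.+1 by rewrite ler_pdivlMr ?exprn_gt0.
rewrite (le_trans (ler_pM (cabs_ge0 _) (cabs_ge0 _) ckE Hk)) //.
have -> : 2 * K / r ^+ k.+1 * (k.+1%:R * (r / 4) ^+ k) = 2 * K / r * (4^-1 ^+ k * k.+1%:R).
  by rewrite exprMn exprS; field; rewrite !gt_eqF // exprn_gt0.
have -> : 4 * K / r * 2^-1 ^+ k.+1 = 2 * K / r * (4^-1 ^+ k * 2 ^+ k).
  have E : 4^-1 * 2 = 2^-1 :> R by field.
  by rewrite -exprMn E exprS; field; rewrite gt_eqF.
apply: ler_wpM2l; first by rewrite divr_ge0 ?mulr_ge0 ?ltW.
apply: ler_wpM2l; first by rewrite exprn_ge0 ?invr_ge0.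
by rewrite -natrX ler_nat ltn_expl.
Qed.

End OneVariable.

(** * Analytic fixed points and Hensel factorization *)

Section FixedPoint.
Variable R : realType.
Local Notation C := (R[i]).

Definition an1_on r (f : C -> C) := approx_on r (cfun1 f).

Section Statement.
Variables (I : Type) (d eta : R) (T : C -> (I -> C) -> I -> C).
Hypothesis eta0 : 0 <= eta.
Definition small (y : I -> C) := forall i, cabs (y i) <= eta.
Hypothesis Tsmall : forall t y, cabs t < d -> small y -> small (T t y).
Hypothesis Tcontr : forall t y y' (D : R), cabs t < d -> small y -> small y' ->
  (forall i, cabs (y i - y' i) <= D) -> forall i, cabs (T t y i - T t y' i) <= D / 2.

Lemma fixed_point_unique t y y' : cabs t < d -> small y -> small y' ->
  T t y = y -> T t y' = y' -> y = y'.
Proof.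
move=> td sy sy' Ty Ty'.
have H n : forall i, cabs (y i - y' i) <= 2 * eta * 2^-1 ^+ n.
  elim: n => [|n IH] i.
    by rewrite mulr1 (le_trans (cabsB _ _)) //; have := sy i; have := sy' i; lra.
  rewrite -Ty -Ty' exprSr mulrA; exact: Tcontr.
apply/funext => i; apply: cabs_eq_lim => e e0.
by have [n Hn] := half_lt (2 * eta) e0; rewrite (le_trans (H n i)).
Qed.

Hypothesis Tan : forall y : C -> I -> C, (forall i, an1_on d (y^~ i)) ->
  (forall t, cabs t < d -> small (y t)) -> forall i, an1_on d (fun t => T t (y t) i).

(** The steps of the iteration from [0] are halved uniformly on the whole disk, so that the fixed
    point is a uniform limit of analytic functions. The sup norm on [I -> C] enters only through its
    upper bounds [D], as [I] may be infinite. *)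
Lemma fixed_point : exists2 y : C -> I -> C, forall i, an1_on d (y^~ i) &
  forall t, cabs t < d -> small (y t) /\ T t (y t) = y t.
Proof.
pose z := fix z n t : I -> C := if n is n'.+1 then T t (z n' t) else fun=> 0.
have zs n t : cabs t < d -> small (z n t).
  by move=> td; elim: n => [|n IH] /=; [move=> i; rewrite cabs0 | exact: Tsmall].
have zan n i : an1_on d ((z n)^~ i).
  elim: n i => [|n IH] i; first exact: approx_on_cst.
  by apply: Tan => // t td; exact: zs.
have zd n t i : cabs t < d -> cabs (z n t i - z n.+1 t i) <= 2 * eta * 2^-1 ^+ n.
  move=> td; elim: n i => [|n IH] i.
    rewrite mulr1 (le_trans (cabsB _ _)) // mulr_natl mulr2n.
    by rewrite lerD // ?(zs 0%N) ?(zs 1%N).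
  by rewrite exprSr mulrA; apply: Tcontr IH i => //; [exact: zs | exact: (zs n.+1)].
have zc n m t i : cabs t < d -> (n <= m)%N ->
    cabs (z n t i - z m t i) <= 4 * eta * 2^-1 ^+ n.
  move=> td nm; have q0 k : 0 <= (2^-1 : R) ^+ k by rewrite exprn_ge0 ?invr_ge0.
  (* The subtracted term makes the bound telescope, as the induction on [m - n] requires. *)
  suff : cabs (z n t i - z m t i) <= 4 * eta * 2^-1 ^+ n - 4 * eta * 2^-1 ^+ m.
    have : 0 <= eta * 2^-1 ^+ m by rewrite mulr_ge0.
    by lra.
  rewrite -(subnKC nm); elim: (m - n)%N => [|k IH]; first by rewrite addn0 !subrr cabs0.
  rewrite addnS (le_trans (cabs_tri _ (z (n + k)%N t i) _)) //.
  have := zd (n + k)%N t i td; rewrite exprSr; lra.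
have [p|y Hy] := @choice (C * I) C (fun p y => cabs p.1 < d ->
    forall n, cabs (z n p.1 p.2 - y) <= 8 * eta * 2^-1 ^+ n).
  have [pd|] := boolP (cabs p.1 < d); last by exists 0.
  have [n m nm|y Hy] := @cauchy_complex _ (fun n => z n p.1 p.2)
     (fun n => 4 * eta * 2^-1 ^+ n); first exact: zc.
  by exists y => _ n; rewrite (le_trans (Hy n)) // !mulrA -natrM.
have ys t : cabs t < d -> small (fun i => y (t, i)).
  move=> td i; apply/ler_addgt0Pr => e e0; have [n Hn] := half_lt (8 * eta) e0.
  have := Hy (t, i) td n => /= H.
  have -> : y (t, i) = z n t i - (z n t i - y (t, i)) by ring.
  rewrite (le_trans (cabsB _ _)) //; have := zs n t td i; lra.
exists (fun t i => y (t, i)) => [i|t td].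
  apply: approx_on_lim => e e0; have [n Hn] := half_lt (8 * eta) e0.
  exists (cfun1 ((z n)^~ i)); first exact: zan.
  move=> h /pdisc1 hd; rewrite cabs_distC (le_trans _ Hn) //; exact: (Hy (h 0 0, i)).
split; first exact: ys.
apply/funext => i; apply: cabs_eq_lim => e e0; have [n Hn] := half_lt (8 * eta) e0.
rewrite (le_trans _ Hn) // (le_trans (cabs_tri _ (z n.+1 t i) _)) //.
have H1 := Hy (t, i) td n.+1.
have H2 : cabs (T t (fun i => y (t, i)) i - z n.+1 t i) <= 8 * eta * 2^-1 ^+ n / 2.
  apply: Tcontr; [by []|exact: ys|exact: zs|].
  by move=> j; rewrite cabs_distC; exact: (Hy (t, j)).
by move: H1 => /=; rewrite exprSr; lra.
Qed.

End Statement.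

Lemma an1_on_an1 r f : 0 < r -> an1_on r f -> an1 f.
Proof. by move=> r0 rf; exists r. Qed.

(* [t] inverts [x / k x]; for [k 0 = 0] it is the zero germ. *)
Lemma an1_inverse (k : C -> C) : an1 k -> exists (t : C -> C) (d eta : R),
  [/\ 0 < d, 0 < eta, an1 t, forall s, cabs s < d -> t s = s * k (t s) &
      forall s x, cabs s < d -> cabs x <= eta -> x = s * k x -> x = t s].
Proof.
move=> ak; have [r1 [K [r10 K0 Hk]]] := an1_lipschitz ak; have [r2 r20 kr2] := ak.
have [B B0 HB] := approx_on_bounded kr2.
pose eta := Num.min r1 (r2 / 2).
have eta0 : 0 < eta by rewrite lt_min r10 divr_gt0.
have eta1 : eta <= r1 by rewrite ge_min lexx.
have eta2 : eta < r2 by rewrite (@le_lt_trans _ _ (r2 / 2)) ?ge_min ?lexx ?orbT //; lra.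
pose d := Num.min (eta / B) (2^-1 / K).
have d0 : 0 < d by rewrite lt_min !divr_gt0 ?invr_gt0.
have HB' x : cabs x <= eta -> cabs (k x) <= B.
  move=> xe; have := HB (const_mx x); rewrite /cfun1 mxE; apply; apply/pdisc1.
  by rewrite mxE (le_lt_trans xe).
pose T (s : C) (x : unit -> C) (_ : unit) := s * k (x tt).
have dB s : cabs s < d -> cabs s * B <= eta.
  by rewrite -ler_pdivlMr // => /ltW/le_trans; apply; rewrite ge_min lexx.
have dK s : cabs s < d -> cabs s * K <= 2^-1.
  by rewrite -ler_pdivlMr // => /ltW/le_trans; apply; rewrite ge_min lexx orbT.
have Tsmall s x : cabs s < d -> small eta x -> small eta (T s x).
  move=> sd sx i; rewrite cabsM (le_trans _ (dB s sd)) // ler_wpM2l ?cabs_ge0 //.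
  exact: HB'.
have Tcontr s x x' (D : R) : cabs s < d -> small eta x -> small eta x' ->
  (forall i, cabs (x i - x' i) <= D) -> forall i, cabs (T s x i - T s x' i) <= D / 2.
  move=> sd sx sx' xD i; rewrite -mulrBr cabsM.
  have H := Hk (x tt) (x' tt) (le_trans (sx _) eta1) (le_trans (sx' _) eta1).
  rewrite (le_trans (ler_wpM2l (cabs_ge0 s) H)) // mulrA [D / 2]mulrC.
  by rewrite ler_pM ?mulr_ge0 ?cabs_ge0 ?(ltW K0) ?dK.
have [|x xan xT] := fixed_point (ltW eta0) Tsmall Tcontr _.
  move=> x xan xs i; apply: approx_onM; first exact: approx_on_coord.
  have := @approx_on_comp R 1 1 r2 d (cfun1 k) (fun h => const_mx (x (h 0 0) tt)) kr2.
  have -> : cfun1 k \o (fun h : 'cV[C]_1 => const_mx (x (h 0 0) tt)) = cfun1 (fun t => k (x t tt)).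
    by apply/funext => h; rewrite /cfun1 /= mxE.
  apply=> [j|h /pdisc1 hd]; last first.
    by apply/pdisc1; rewrite mxE (le_lt_trans _ eta2) //; exact: xs.
  under eq_fun => ? do rewrite mxE.
  exact: (xan tt).
exists (x^~ tt), d, eta; split=> //.
- by exists d => //; exact: xan.
- by move=> s sd; have [_ /(congr1 (@^~ tt))] := xT s sd.
move=> s y sd ys yE; have [xs xE] := xT s sd.
have -> // : x s = fun=> y.
apply: (fixed_point_unique Tcontr) sd xs _ xE _ => //.
by apply/funext => -[]; rewrite /T -yE.
Qed.

End FixedPoint.

Section Hensel.
Variable R : realType.
Local Notation C := (R[i]).

Lemma cabs_coef_bound (p : {poly C}) : exists2 A : R, 0 < A & forall j, cabs p`_j <= A.
Proof.
exists (1 + \sum_(j < size p) cabs p`_j).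
  by rewrite ltr_pwDl // sumr_ge0 // => j _; exact: cabs_ge0.
move=> j; have [js|js] := ltnP j (size p); last first.
  by rewrite nth_default // cabs0 addr_ge0 ?sumr_ge0 // => i _; exact: cabs_ge0.
rewrite (bigD1 (Ordinal js)) //= addrCA lerDl addr_ge0 ?sumr_ge0 // => i _.
exact: cabs_ge0.
Qed.

(** On monomials, the inverse of the linear map [(G, H) |-> g * H + h * G] of Hensel's lemma.
    Reducing modulo [g] controls the size of [a i]; that of [b i] then follows from the degree of
    ['X^i]. *)
Lemma bezout_monomials (g h : {poly C}) e e' : g \is monic -> h \is monic ->
  size g = e.+1 -> size h = e'.+1 -> coprimep g h ->
  exists a b : nat -> {poly C}, forall i, (i < e + e')%N ->
    [/\ (size (a i) <= e)%N, (size (b i) <= e')%N & g * b i + h * a i = 'X^i].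
Proof.
move=> gm hm sg sh /Bezout_eq1_coprimepP[[u v] /= uv].
have g0 : g != 0 by rewrite monic_neq0.
exists (fun i => (v * 'X^i) %% g), (fun i => ('X^i - h * ((v * 'X^i) %% g)) %/ g) => i ie.
set a := _ %% g.
have sa : (size a <= e)%N by rewrite -ltnS -sg ltn_modp.
have ga : g %| 'X^i - h * a.
  have -> : a = v * 'X^i - (v * 'X^i) %/ g * g by apply/eqP; rewrite eq_sym subr_eq addrC -divp_eq.
  have -> : 'X^i - h * (v * 'X^i - v * 'X^i %/ g * g) =
     g * (u * 'X^i + h * (v * 'X^i %/ g)) + (1 - (u * g + v * h)) * 'X^i by ring.
  by rewrite uv subrr mul0r addr0 dvdp_mulr.
split=> //; last by rewrite mulrC divpK // subrK.
rewrite size_divp // sg /= leq_subLR (leq_trans (size_polyD _ _)) // size_polyN geq_max size_polyXn ie.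
rewrite (leq_trans (size_polyMleq _ _)) // sh addSn /= addnC leq_add2r; exact: sa.
Qed.

Lemma cabs_coefM_le (p q : {poly C}) (A B : R) i : (forall j, cabs p`_j <= A) ->
  (forall j, cabs q`_j <= B) -> cabs (p * q)`_i <= i.+1%:R * (A * B).
Proof.
move=> pA qB; rewrite coefM (le_trans (cabs_sum _ _ _)) //.
rewrite (@le_trans _ _ (\sum_(j < i.+1) A * B)) //; last first.
  by rewrite sumr_const card_ord mulr_natl.
by apply: ler_sum => j _; rewrite cabsM ler_pM ?cabs_ge0.
Qed.

Definition an_poly (f : C -> {poly C}) := forall i, an1 (fun t => (f t)`_i).

(* The deviations of the factors from [g0] and [h0] solve
   [g0 * H + h0 * G = f t - f 0 - G * H], whose left-hand side is inverted by the
   Bezout coefficients; this is a contraction for small [t]. *)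
Lemma hensel (f : C -> {poly C}) (g0 h0 : {poly C}) e e' (r : R) : 0 < r ->
  an_poly f -> (forall t, cabs t < r -> f t \is monic /\ size (f t) = (e + e').+1) ->
  g0 \is monic -> h0 \is monic -> size g0 = e.+1 -> size h0 = e'.+1 ->
  coprimep g0 h0 -> f 0 = g0 * h0 ->
  exists (g h : C -> {poly C}) (d : R), [/\ 0 < d /\ (g 0 = g0 /\ h 0 = h0),
    an_poly g, an_poly h,
    forall t, cabs t < d -> (g t \is monic /\ size (g t) = e.+1) /\
                            (h t \is monic /\ size (h t) = e'.+1) &
    forall t, cabs t < d -> f t = g t * h t].
Proof.
move=> r0 af fm g0m h0m sg sh cgh f0.
have [a [b ab]] := bezout_monomials g0m h0m sg sh cgh.
set dd := (e + e')%N in fm ab.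
pose c (x : bool) i := if x then a i else b i.
have [A A0 HA] : exists2 A : R, 0 < A & forall i x j, (i < dd)%N -> cabs (c x i)`_j <= A.
  have [p|p H] := @choice (bool * nat) R
      (fun p A => 0 < A /\ forall j, cabs (c p.1 p.2)`_j <= A).
    by have [A A0 HA] := cabs_coef_bound (c p.1 p.2); exists A.
  have p0 x i : 0 < p (x, i) by case: (H (x, i)).
  exists (\sum_(i < dd) (p (true, i : nat) + p (false, i : nat)) + 1).
    by rewrite ltr_pwDr // sumr_ge0 // => i _; rewrite addr_ge0 // ltW.
  move=> i x j id; rewrite (bigD1 (Ordinal id)) //= -!addrA.
  have S0 : 0 <= \sum_(k < dd | k != Ordinal id) (p (true, k : nat) + p (false, k : nat)).
    by apply: sumr_ge0 => k _; rewrite addr_ge0 // ltW.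
  have [pt /(_ j) Ht] := H (true, i); have [pf /(_ j) Hf] := H (false, i).
  by case: x => /=; rewrite /= in Ht Hf *; lra.
pose D : R := dd.+1%:R; have D1 : 1 <= D by rewrite ler1n.
pose M := D * A; have M0 : 0 < M by rewrite mulr_gt0 // (lt_le_trans ltr01).
(* [M] bounds the inverse of the linear part and [D] the number of terms in a coefficient of a
   product. On deviations of size [eta] the quadratic term contributes at most [eta / 4] to [T] and
   is contracted by [1 / 2]; the choice of [eps] leaves [eta / 2] for [f t - f 0]. *)
pose eta := (4 * M * D)^-1.
have eta0 : 0 < eta by rewrite invr_gt0 !mulr_gt0 // (lt_le_trans ltr01).
have Meta : M * D * eta = 4^-1.
  have Dn0 : D != 0 by rewrite gt_eqF // (lt_le_trans ltr01).
  have Mn0 : M != 0 by rewrite gt_eqF.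
  by rewrite /eta; move: (D) (M) Dn0 Mn0 => u v u0 v0; field; rewrite u0 v0.
pose eps := eta / (2 * M).
have eps0 : 0 < eps by rewrite divr_gt0 ?mulr_gt0.
have Meps : M * eps = eta / 2.
  have Mn0 : M != 0 by rewrite gt_eqF.
  by rewrite /eps; move: (M) (eta) Mn0 => u v u0; field.
clearbody eps eta.
have [i s s' s'0 s's [H1 H2]|i|d1 d10 Hd1] := @fin_radius R 'I_dd (fun i s =>
   an1_on s (fun t => (f t)`_i) /\ forall t, cabs t < s -> cabs ((f t)`_i - (f 0)`_i) <= eps).
- by split; [exact: approx_on_le H1 | move=> t ts; apply: H2; exact: lt_le_trans ts s's].
- have [s s0 Hs] := an1_cont0 (af i) eps0; have [u u0 Hu] := af i.
  exists (Num.min s u); first by rewrite lt_min s0.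
  split; first by apply: approx_on_le Hu; rewrite ge_min lexx orbT.
  by move=> t; rewrite lt_min => /andP[ts _]; exact: Hs.
have Dge : 0 <= D by exact: le_trans D1.
have etage : 0 <= eta by exact: ltW.
have epsge : 0 <= eps by exact: ltW.
pose d := Num.min d1 r; have d0 : 0 < d by rewrite lt_min d10.
have dr t : cabs t < d -> cabs t < r by rewrite lt_min => /andP[].
have dd1 t : cabs t < d -> cabs t < d1 by rewrite lt_min => /andP[].
(* The unknown [y] holds the coefficients of the deviations of both factors, told apart by the
   boolean. *)
pose G (y : bool * nat -> C) := \poly_(j < e) y (true, j).
pose H (y : bool * nat -> C) := \poly_(j < e') y (false, j).
pose Q t y := f t - f 0 - G y * H y.
pose T t y (x : bool * nat) := \sum_(i < dd) (Q t y)`_i * (c x.1 i)`_x.2.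
have Gs y j : small eta y -> cabs (G y)`_j <= eta.
  by move=> sy; rewrite coef_poly; case: ifP => _; rewrite ?cabs0 ?(ltW eta0).
have Hs y j : small eta y -> cabs (H y)`_j <= eta.
  by move=> sy; rewrite coef_poly; case: ifP => _; rewrite ?cabs0 ?(ltW eta0).
have TQ (q : nat -> C) (B : R) x : (forall i, (i < dd)%N -> cabs (q i) <= B) -> 0 <= B ->
    cabs (\sum_(i < dd) q i * (c x.1 i)`_x.2) <= M * B.
  move=> qB B0; rewrite (le_trans (cabs_sum _ _ _)) //.
  rewrite (@le_trans _ _ (\sum_(i < dd) B * A)) //.
    by apply: ler_sum => i _; rewrite cabsM ler_pM ?cabs_ge0 ?qB ?HA.
  rewrite sumr_const card_ord -[leLHS]mulr_natl /M -[leRHS]mulrA [B * A]mulrC.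
  by apply: ler_wpM2r; [rewrite mulr_ge0 // ltW | rewrite ler_nat leqnSn].
have iD i : (i < dd)%N -> i.+1%:R <= D by move=> ?; rewrite ler_nat ltnW.
have Tsmall t y : cabs t < d -> small eta y -> small eta (T t y).
  move=> td sy x; have [_] : 0 <= eps + D * eta ^+ 2 /\ M * (eps + D * eta ^+ 2) <= eta.
    split; first by apply: addr_ge0 => //; apply: mulr_ge0 => //; exact: exprn_ge0.
    rewrite mulrDr expr2 !mulrA Meta.
    by rewrite Meps; lra.
  apply: le_trans; apply: TQ; last first.
    by apply: addr_ge0 => //; apply: mulr_ge0 => //; exact: exprn_ge0.
  move=> i id; rewrite coefB (le_trans (cabsB _ _)) // lerD //.
    by rewrite coefB; case: (Hd1 (Ordinal id)) => _; apply; exact: dd1.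
  rewrite (le_trans (@cabs_coefM_le _ _ eta eta i _ _)) //; try by move=> j; auto.
  by rewrite expr2 ler_wpM2r ?mulr_ge0 // iD.
have Tcontr t y y' (B : R) : cabs t < d -> small eta y -> small eta y' ->
  (forall i, cabs (y i - y' i) <= B) -> forall i, cabs (T t y i - T t y' i) <= B / 2.
  move=> td sy sy' yB x.
  have B0 : 0 <= B by exact: le_trans (cabs_ge0 _) (yB x).
  have -> : T t y x - T t y' x = \sum_(i < dd) (Q t y - Q t y')`_i * (c x.1 i)`_x.2.
    by rewrite /T -sumrB; apply: eq_bigr => i _; rewrite [(Q t y - Q t y')`_i]coefB mulrBl.
  have [_] : 0 <= D * (2 * eta * B) /\ M * (D * (2 * eta * B)) <= B / 2.
    split; first by rewrite !mulr_ge0 ?ler0n.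
    have -> : M * (D * (2 * eta * B)) = M * D * eta * (2 * B) by ring.
    by rewrite Meta; lra.
  apply: le_trans; apply: TQ; last by rewrite !mulr_ge0 ?ler0n.
  move=> i id.
  have -> : Q t y - Q t y' = (G y' - G y) * H y' + G y * (H y' - H y) by rewrite /Q; ring.
  have GB j : cabs (G y' - G y)`_j <= B.
    by rewrite coefB !coef_poly; case: ifP => _; rewrite ?subrr ?cabs0 // cabs_distC.
  have HB j : cabs (H y' - H y)`_j <= B.
    by rewrite coefB !coef_poly; case: ifP => _; rewrite ?subrr ?cabs0 // cabs_distC.
  rewrite coefD (le_trans (cabsD _ _)) //.
  have E1 : cabs ((G y' - G y) * H y')`_i <= i.+1%:R * (B * eta).
    by apply: cabs_coefM_le => // j; auto.
  have E2 : cabs (G y * (H y' - H y))`_i <= i.+1%:R * (eta * B).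
    by apply: cabs_coefM_le => // j; auto.
  rewrite (le_trans (lerD E1 E2)) // [eta * B]mulrC -mulrDr.
  have -> : B * eta + B * eta = 2 * eta * B by ring.
  by rewrite ler_wpM2r ?iD // !mulr_ge0.
have [|y yan yT] := fixed_point (ltW eta0) Tsmall Tcontr _.
  move=> y yan ys x; apply: approx_on_sum => i _; apply: approx_onM; last exact: approx_on_cst.
  under eq_fun => ? do rewrite !coefB coefM.
  apply: approx_onB.
    apply: approx_onB; last exact: approx_on_cst.
    by case: (Hd1 i) => Hi _; apply: approx_on_le Hi; rewrite ge_min lexx.
  have polyan (n : nat) x' j : approx_on d (fun t : 'cV[C]_1 => (\poly_(j < n) y (t 0 0) (x', j))`_j).
    under eq_fun => ? do rewrite coef_poly.
    by case: (ltnP j n) => _; [exact: yan | exact: approx_on_cst].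
  by apply: approx_on_sum => j _; apply: approx_onM; exact: polyan.
have Gan n x : an_poly (fun t => \poly_(j < n) y t (x, j)).
  move=> i; apply: an1_on_an1 d0 _; rewrite /an1_on /cfun1.
  under eq_fun => ? do rewrite coef_poly.
  by case: (ltnP i n) => _; [exact: yan | exact: approx_on_cst].
have y0 : y 0 = fun=> 0.
  have d00 : cabs (0 : C) < d by rewrite cabs0.
  have [ys yE] := yT 0 d00; apply: (fixed_point_unique Tcontr d00 ys _ yE).
    by move=> i; rewrite cabs0 ltW.
  apply/funext => x; rewrite /T big1 // => i _.
  by rewrite /Q /G (_ : \poly_(j < e) _ = 0) ?mul0r ?subrr ?subr0 ?coef0 ?mul0r //;
    apply/polyP => j; rewrite coef_poly coef0; case: ifP.
have anD p (q : C -> {poly C}) : an_poly q -> an_poly (fun t => p + q t).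
  move=> aq i; rewrite /an1 /cfun1; under eq_fun => ? do rewrite coefD.
  by apply: anD; [exact: an_cst | exact: aq].
have szG t : (size (G (y t)) <= e)%N by exact: size_poly.
have szH t : (size (H (y t)) <= e')%N by exact: size_poly.
have monicD (p q : {poly C}) k : p \is monic -> size p = k.+1 -> (size q <= k)%N ->
    p + q \is monic /\ size (p + q) = k.+1.
  move=> pm sp sq; have qp : (size q < size p)%N by rewrite sp.
  by rewrite monicE lead_coefDl // -monicE size_polyDl.
exists (fun t => g0 + G (y t)), (fun t => h0 + H (y t)), d; split.
- split=> //; rewrite y0; split; rewrite -[RHS]addr0; congr (_ + _);
  by apply/polyP => j; rewrite coef_poly coef0; case: ifP.
- exact/anD/Gan.
- exact/anD/Gan.
- by move=> t td; split; apply: monicD.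
move=> t td; have [_ yE] := yT t td.
have sQ : (size (Q t (y t)) <= dd)%N.
  have sf : (size (f t - f 0)%R <= dd)%N.
    have [m1 s1] := fm t (dr t td); have [|m2 s2] := fm 0; first by rewrite cabs0.
    apply/leq_sizeP => j; rewrite leq_eqVlt => /orP[/eqP<-|dj].
      move: m1 m2; rewrite !monicE !lead_coefE s1 s2 /= => /eqP m1 /eqP m2.
      by rewrite coefB m1 m2 subrr.
    by rewrite coefB !nth_default ?subrr // ?s1 ?s2.
  rewrite /Q (leq_trans (size_polyD _ _)) // size_polyN geq_max sf /=.
  rewrite (leq_trans (size_polyMleq _ _)) // (leq_trans (leq_pred _)) //.
  exact: leq_add.
have GE : G (y t) = \sum_(i < dd) (Q t (y t))`_i *: a i.
  apply/polyP => j; rewrite coef_poly coef_sum.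
  case: ltnP => je.
    by rewrite -[in LHS]yE; apply: eq_bigr => i _; rewrite coefZ.
  rewrite big1 // => i _; have [sa _ _] := ab i (ltn_ord i).
  by rewrite coefZ (nth_default _ (leq_trans sa je)) mulr0.
have HE : H (y t) = \sum_(i < dd) (Q t (y t))`_i *: b i.
  apply/polyP => j; rewrite coef_poly coef_sum.
  case: ltnP => je.
    by rewrite -[in LHS]yE; apply: eq_bigr => i _; rewrite coefZ.
  rewrite big1 // => i _; have [_ sb _] := ab i (ltn_ord i).
  by rewrite coefZ (nth_default _ (leq_trans sb je)) mulr0.
have E : g0 * H (y t) + h0 * G (y t) = Q t (y t).
  have -> : Q t (y t) = \poly_(i < dd) (Q t (y t))`_i.
    apply/polyP => j; rewrite coef_poly; case: ltnP => // jd.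
    by rewrite nth_default // (leq_trans sQ).
  rewrite poly_def {1}GE {1}HE !mulr_sumr -big_split /=.
  apply: eq_bigr => i _; rewrite -!scalerAr -scalerDr.
  by have [_ _ ->] := ab i (ltn_ord i).
by rewrite mulrDl !mulrDr -f0 addrA -(addrA (f 0)) [G (y t) * h0]mulrC E /Q; ring.
Qed.

End Hensel.

(** * Hurwitz' theorem *)

Section Hurwitz.
Variable R : realType.
Local Notation C := (R[i]).

Lemma bernoulli (y : R) n : 0 <= y -> 1 + n%:R * y <= (1 + y) ^+ n.
Proof.
move=> y0; elim: n => [|n IH]; first by rewrite mul0r addr0.
have ny : 0 <= (n%:R : R) * (y * y) by rewrite !mulr_ge0 // ler0n.
have y1 : 0 <= 1 + y by rewrite addr_ge0.
by rewrite exprS (le_trans _ (ler_wpM2l y1 IH)) // -natr1; lra.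
Qed.

(** Suppose that all the roots [z] lie outside the disk. The product of [p] over [N] equidistributed
    points of the circle is, up to sign, the product of the [z ^+ N - rho ^+ N] times a power of the
    leading coefficient. As [cabs z > rho], its modulus is at most [2 ^+ size r * cabs p.[0] ^+ N].
    It is also at least [m ^+ N], which Bernoulli's inequality contradicts for large [N]. *)
Lemma poly_min_principle (p : {poly C}) (rho m : R) : 0 < rho -> 0 < m ->
  (forall x, cabs x = rho -> m <= cabs p.[x]) -> cabs p.[0] < m ->
  exists2 x, cabs x <= rho & p.[x] = 0.
Proof.
move=> rho0 m0 pm p0m; apply: contrapT => noroot.
have {}noroot x : cabs x <= rho -> p.[x] != 0.
  by move=> xr; apply/eqP => px; apply: noroot; exists x.
have [r Dp] := closed_field_poly_normal p; set c := lead_coef p in Dp.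
have rrho z : z \in r -> rho < cabs z.
  move=> zr; rewrite ltNge; apply/negP => /noroot/negP; apply.
  rewrite Dp hornerZ mulf_eq0; apply/orP; right.
  by rewrite -/(root _ z) root_prod_XsubC.
pose a := cabs p.[0].
have a0 : 0 < a by rewrite cabs_gt0 noroot // cabs0 ltW.
have pE x : p.[x] = c * \prod_(z <- r) (x - z).
  rewrite {1}Dp hornerZ horner_prod; congr (_ * _).
  by apply: eq_bigr => z _; rewrite hornerXsubC.
have H N : (0 < N)%N -> m ^+ N <= 2 ^+ size r * a ^+ N.
  move=> N0; have [w pw] := prim_root_complex R N0.
  have w1 : cabs w = 1 by apply: (cabs_unity N0); exact: prim_expr_order.
  have wE z : \prod_(j < N) (rho%:C%C * w ^+ j - z) = (-1) ^+ N * (z ^+ N - rho%:C%C ^+ N).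
    have rn0 : rho%:C%C != 0 by rewrite -cabs_gt0 cabs_real gtr0_norm.
    set x := z / rho%:C%C.
    have E1 : (\prod_(0 <= i < N) ('X - (w ^+ i)%:P)).[x] = x ^+ N - 1.
      by rewrite (factor_Xn_sub_1 pw) hornerD hornerXn hornerN hornerC.
    rewrite horner_prod in E1.
    have -> : z ^+ N - rho%:C%C ^+ N = rho%:C%C ^+ N * (x ^+ N - 1).
      by rewrite /x expr_div_n; field; rewrite expf_neq0.
    have cst (y : C) : y ^+ N = \prod_(j < N) y by rewrite prodr_const card_ord.
    rewrite -E1 big_mkord !cst -!big_split /=.
    by apply: eq_bigr => j _; rewrite hornerXsubC /x; field.
  have -> : 2 ^+ size r * a ^+ N = (\prod_(j < N) cabs c) * \prod_(z <- r) (2 * cabs z ^+ N).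
    have -> : \prod_(z <- r) (2 * cabs z ^+ N) = 2 ^+ size r * \prod_(z <- r) cabs z ^+ N.
      by rewrite big_split /= big_const_seq count_predT iter_mulr_1.
    rewrite mulrCA; congr (_ * _).
    rewrite /a pE cabsM cabs_prod exprMn prodr_const card_ord; congr (_ * _).
    by rewrite -prodrXl; apply: eq_bigr => z _; rewrite sub0r cabsN.
  rewrite (@le_trans _ _ (\prod_(j < N) cabs p.[rho%:C%C * w ^+ j])) //.
    have -> : m ^+ N = \prod_(j < N) m by rewrite prodr_const card_ord.
    apply: ler_prod => j _.
    rewrite (ltW m0) pm // cabsM cabs_real cabsX w1 expr1n mulr1 gtr0_norm //.
  rewrite (eq_bigr (fun j : 'I_N => cabs c * \prod_(z <- r) cabs (rho%:C%C * w ^+ j - z))); last first.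
    by move=> j _; rewrite pE cabsM cabs_prod.
  rewrite big_split /= ler_wpM2l ?prodr_ge0 // => [j _|]; first exact: cabs_ge0.
  rewrite exchange_big /= big_seq_cond [leRHS]big_seq_cond; apply: ler_prod => z.
  rewrite andbT => /rrho zr; rewrite -cabs_prod cabs_ge0 wE cabsM cabsX cabsN cabs1 expr1n mul1r.
  rewrite (le_trans (cabsB _ _)) // !cabsX cabs_real gtr0_norm // mulr_natl mulr2n lerD2l.
  by rewrite lerXn2r ?nnegrE ?cabs_ge0 ?(ltW rho0) ?(ltW zr).
pose y := m / a - 1.
have y0 : 0 < y by rewrite subr_gt0 ltr_pdivlMr // mul1r.
pose N := (Num.trunc (2 ^+ size r / y)).+1.
have : 2 ^+ size r < N%:R * y by rewrite -ltr_pdivrMr // truncnS_gt.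
have := bernoulli N (ltW y0).
have -> : 1 + y = m / a by rewrite /y; ring.
have := H N isT; rewrite -ler_pdivrMr ?exprn_gt0 // -expr_div_n.
set A := _ ^+ N; set B := N%:R * y; lra.
Qed.

Lemma complex_bolzano_weierstrass (u : nat -> C) (B : R) : (forall n, cabs (u n) <= B) ->
  exists l, forall e, 0 < e -> forall n0, exists2 n, (n0 <= n)%N & cabs (u n - l) <= e.
Proof.
move=> uB; pose v n : R * R := (complex.Re (u n), complex.Im (u n)).
have cK : compact (`[- B, B] `*` `[- B, B] : set (R * R)).
  by apply: compact_setX; exact: segment_compact.
have [|[a b] [_ cab]] := cK (v @ \oo) _.
  exists 0%N => // n _; split => /=; rewrite in_itv /= -ler_norml.
    exact: le_trans (Re_le_cabs _) (uB n).
  exact: le_trans (Im_le_cabs _) (uB n).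
exists (a +i* b)%C => e e0 n0; have e20 : 0 < e / 2 by rewrite divr_gt0.
have [||p [[n n0n <-] [/= B1 B2]]] := cab [set v n | n in [set n | (n0 <= n)%N]] (ball (a, b) (e / 2)).
- by exists n0 => // n /= n0n; exists n.
- exact: nbhsx_ballx.
exists n => //.
rewrite (le_trans (cabs_le_ReIm _)) // ReB ImB /=.
move: B1 B2; rewrite -!ball_normE /= => B1 B2.
by rewrite distrC (distrC (complex.Im _)); lra.
Qed.

(** Good polynomial approximations of [f] inherit the gap between the center and the circle, hence
    have roots in the disk by [poly_min_principle]; an accumulation point of these roots is a zero
    of [f]. *)
Lemma hurwitz (f : C -> C) (rho m : R) : 0 < rho -> 0 < m ->
  (forall e : R, 0 < e -> exists p : {poly C}, forall x, cabs x <= rho -> cabs (f x - p.[x]) <= e) ->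
  (forall x, cabs x = rho -> m <= cabs (f x)) -> cabs (f 0) < m ->
  exists2 x, cabs x <= rho & f x = 0.
Proof.
move=> rho0 m0 fp fm f0m.
pose gap := m - cabs (f 0); have gap0 : 0 < gap by rewrite subr_gt0.
have fgap (p : {poly C}) e : e <= gap / 3 -> e < m ->
    (forall x, cabs x <= rho -> cabs (f x - p.[x]) <= e) ->
    exists2 x, cabs x <= rho & p.[x] = 0.
  move=> eg em pe; apply: (@poly_min_principle _ _ (m - e)) => //.
  - by rewrite subr_gt0.
  - move=> x xr; have := pe x; rewrite xr lexx => /(_ isT).
    have := fm x xr; have := cabs_subr (f x) p.[x]; lra.
  - have := pe 0; rewrite cabs0 ltW // => /(_ isT).
    have := cabs_subr p.[0] (f 0); rewrite cabs_distC; rewrite /gap in eg gap0; lra.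
have e0 n : 0 < Num.min (gap / 3) (2^-1 ^+ n) by rewrite lt_min divr_gt0 //= exprn_gt0 ?invr_gt0.
have [n|x Hx] := @choice nat C (fun n x => cabs x <= rho /\ cabs (f x) <= 2^-1 ^+ n).
  have [p Hp] := fp _ (e0 n).
  have [| |x xr px] := @fgap p _ _ _ Hp.
  - by rewrite ge_min lexx.
  - rewrite (@le_lt_trans _ _ (gap / 3)) ?ge_min ?lexx //.
    by have := cabs_ge0 (f 0); rewrite /gap in gap0 *; lra.
  exists x; split=> //; have := Hp x xr; rewrite px subr0 => /le_trans; apply.
  by rewrite ge_min lexx orbT.
have [l Hl] := @complex_bolzano_weierstrass x rho (fun n => (Hx n).1).
have lr : cabs l <= rho.
  apply/ler_addgt0Pr => e e'0; have [n _ Hn] := Hl e e'0 0%N.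
  rewrite -[l](subrKC (x n)) (le_trans (cabsD _ _)) // lerD // ?(Hx n).1 // cabs_distC.
  exact: Hn.
exists l => //; apply: cabs_eq_lim => e e'0.
have e40 : 0 < e / 4 by rewrite divr_gt0.
have [p Hp] := fp _ e40.
(* A Lipschitz bound of [p] at [l], from the factorization of [p - p.[l]] by ['X - l]. *)
have [K K0 HK] : exists2 K : R, 0 < K & forall y, cabs (p.[y] - p.[l]) <= K * cabs (y - l) \/ rho < cabs y.
  have pp : (p - p.[l]%:P).[l] = 0 by rewrite !hornerE subrr.
  have /factor_theorem[q Dq] : root (p - p.[l]%:P) l by apply/eqP.
  have [K K0 HK] := polyfun_bounded (rho + 1) (polyfun_horner q (polyfun_coord R (ord0 : 'I_1))).
  exists K => // y; have [yr|] := leP (cabs y) rho; last by right.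
  left; have -> : p.[y] - p.[l] = q.[y] * (y - l).
    have /(congr1 (horner^~ y)) := Dq; rewrite hornerM hornerXsubC => <-.
    by rewrite hornerD hornerN hornerC.
  rewrite cabsM ler_wpM2r ?cabs_ge0 //; have := HK (const_mx y); rewrite mxE; apply.
  by move=> i; rewrite mxE; lra.
have eK0 : 0 < e / 4 / K by rewrite !divr_gt0.
have [n0 Hn0] := half_lt 1 e40; rewrite mul1r in Hn0.
have [n n0n Hn] := Hl _ eK0 n0; have [xr fx] := Hx n.
have qn : (2^-1 : R) ^+ n <= 2^-1 ^+ n0 by rewrite ler_wiXn2l // ?invr_ge0 // invf_le1 // ler1n.
have pl : cabs (p.[x n] - p.[l]) <= e / 4.
  case: (HK (x n)) => [H|]; last by rewrite ltNge xr.
  by rewrite (le_trans H) // mulrC -ler_pdivlMr.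
have -> : f l - 0 = (f l - p.[l]) - (p.[x n] - p.[l]) - (f (x n) - p.[x n]) + f (x n) by ring.
have := cabsD ((f l - p.[l]) - (p.[x n] - p.[l]) - (f (x n) - p.[x n])) (f (x n)).
have := cabsB ((f l - p.[l]) - (p.[x n] - p.[l])) (f (x n) - p.[x n]).
have := cabsB (f l - p.[l]) (p.[x n] - p.[l]).
have := Hp l lr; have := Hp _ xr; lra.
Qed.

End Hurwitz.

(** * Arcs in the plane *)

Section Descend.
Variable R : realType.
Local Notation C := (R[i]).

Definition setfst N (h : 'cV[C]_N.+1) (x : C) : 'cV[C]_N.+1 :=
  \col_i (if i == 0 then x else h i 0).

Lemma setfst_id N (h : 'cV[C]_N.+1) : setfst h (h 0 0) = h.
Proof. by apply/matrixP => i j; rewrite !mxE !ord1; case: eqP => // ->. Qed.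

Lemma hmon_setfst N (h : 'cV[C]_N.+1) x (m : 'I_N.+1 -> nat) :
  hmon (setfst h x) m = x ^+ m 0 * \prod_(i | i != 0) h i 0 ^+ m i.
Proof.
rewrite /hmon (bigD1 0) //= mxE eqxx; congr (_ * _).
by apply: eq_bigr => i /negbTE i0; rewrite mxE i0.
Qed.

Lemma rootC_lt q (x : C) (r : R) : (0 < q)%N -> 0 < r -> cabs x < r ^+ q -> cabs (q.-root x) < r.
Proof.
move=> q0 r0 xr; rewrite -(@ltr_pXn2r _ q) ?nnegrE ?cabs_ge0 ?ltW //.
by rewrite -cabsX rootCK.
Qed.

(* Averaging over the [q]-th roots of unity turns the approximating polynomials
   into polynomials in the [q]-th power of the first variable. *)
Lemma an_descend N q (w : C) (G : 'cV[C]_N.+1 -> C) : (0 < q)%N -> q.-primitive_root w ->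
  an G -> (forall h, G (setfst h (w * h 0 0)) = G h) ->
  exists2 c, an c & forall h, G h = c (setfst h (h 0 0 ^+ q)).
Proof.
move=> q0 pw [r r0 aG] invG.
have invGj j h : G (setfst h (w ^+ j * h 0 0)) = G h.
  elim: j => [|j IH]; first by rewrite expr0 mul1r setfst_id.
  rewrite -IH -[RHS]invG; congr G; apply/matrixP => i k; rewrite !mxE eqxx.
  by case: eqP => // _; rewrite exprS mulrA.
(* By invariance the choice of the root does not matter, although [q.-root] is not continuous. *)
pose c h := G (setfst h (q.-root (h 0 0))).
exists c; last first.
  move=> h; rewrite /c mxE eqxx.
  have : q.-root (h 0 0 ^+ q) ^+ q = h 0 0 ^+ q by rewrite rootCK.
  have [h0 _|h0] := eqVneq (h 0 0) 0.
    rewrite h0 expr0n gtn_eqF //= rootC0; congr G; apply/matrixP => i k; rewrite !mxE ord1.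
    by case: eqP => [->|].
  move=> /(congr1 (fun z => z / h 0 0 ^+ q)); rewrite divff ?expf_neq0 // -expr_div_n.
  move=> /(prim_rootP pw)[j Ej].
  rewrite -(invGj j); congr G; apply/matrixP => i k; rewrite !mxE.
  by case: eqP => // _; rewrite -Ej divfK.
pose r' := Num.min r (r ^+ q).
have r'0 : 0 < r' by rewrite lt_min r0 exprn_gt0.
exists r' => // e /aG[p /polyfun_evalmon[s ps] Hp].
have w1 : cabs w = 1 by apply: (cabs_unity q0); exact: prim_expr_order.
pose pt (h : 'cV[C]_N.+1) := \sum_(a <- s | (q %| a.2 0%R)%N) a.1 *
  (h 0 0 ^+ (a.2 0%R %/ q)%N * \prod_(i | i != 0) h i 0 ^+ a.2 i).
exists pt.
  apply: polyfun_sum => a _; apply: polyfunM; first exact: polyfun_cst.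
  apply: polyfunM; first by apply: polyfunX; exact: polyfun_coord.
  by apply: polyfun_prod => i _; apply: polyfunX; exact: polyfun_coord.
move=> h hr; pose x := q.-root (h 0 0).
have xq : x ^+ q = h 0 0 by rewrite rootCK.
have xr : cabs x < r.
  by apply: rootC_lt => //; rewrite (lt_le_trans (hr 0)) // ge_min lexx orbT.
have ptE : pt h = q%:R^-1 * \sum_(j < q) p (setfst h (w ^+ j * x)).
  have -> : \sum_(j < q) p (setfst h (w ^+ j * x)) =
      \sum_(a <- s) \sum_(j < q) a.1 * hmon (setfst h (w ^+ j * x)) a.2.
    by rewrite exchange_big; apply: eq_bigr => j _; rewrite ps.
  rewrite mulr_sumr /pt big_mkcond; apply: eq_bigr => a _ /=.
  have -> : \sum_(j < q) a.1 * hmon (setfst h (w ^+ j * x)) a.2 =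
      a.1 * ((\sum_(j < q) w ^+ (j * a.2 0%R)) * x ^+ a.2 0%R * \prod_(i | i != 0) h i 0 ^+ a.2 i).
    rewrite !mulr_suml mulr_sumr; apply: eq_bigr => j _.
    by rewrite hmon_setfst exprMn -exprM.
  rewrite unity_sum //.
  have qn0 : q%:R != 0 :> C by rewrite pnatr_eq0 -lt0n.
  case: ifP => [/dvdnP[k ->]|_]; last by rewrite !(mulr0, mul0r).
  by rewrite mulnK // [(k * q)%N]mulnC exprM xq; field.
have -> : c h - pt h = q%:R^-1 * \sum_(j < q) (c h - p (setfst h (w ^+ j * x))).
  rewrite ptE sumrB mulrBr sumr_const card_ord -[c h *+ q]mulr_natl mulKf //.
  by rewrite pnatr_eq0 -lt0n.
rewrite cabsM cabsV cabs_nat ler_pdivrMl ?ltr0n // (le_trans (cabs_sum _ _ _)) //.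
rewrite (@le_trans _ _ (\sum_(j < q) e)) //; last by rewrite sumr_const card_ord mulr_natl.
apply: ler_sum => j _.
have -> : c h = G (setfst h (w ^+ j * x)).
  rewrite /c -(invGj j); congr G; apply/matrixP => i k; rewrite !mxE eqxx.
  by case: eqP.
apply: Hp => i; rewrite mxE; case: eqP => _.
  by rewrite cabsM cabsX w1 expr1n mul1r.
by rewrite (lt_le_trans (hr i)) // ge_min lexx.
Qed.

End Descend.

Section Arcs.
Variable R : realType.
Local Notation C := (R[i]).

Lemma analytic_at_shift N (f : 'cV[C]_N -> C) a :
  analytic_at f a -> analytic_at (fun h => f (a + h)) 0.
Proof.
move=> [c [r [M [r0 cM H]]]]; exists c, r, M; split; [exact: r0 | exact: cM | move=> h hr].
have E : 0 + h = h :> 'cV[C]_N by rewrite add0r.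
by rewrite E; exact: H.
Qed.

Lemma analytic_at_unshift N (f : 'cV[C]_N -> C) a :
  analytic_at (fun h => f (a + h)) 0 -> analytic_at f a.
Proof.
move=> [c [r [M [r0 cM H]]]]; exists c, r, M; split; [exact: r0 | exact: cM | move=> h hr].
have E : 0 + h = h :> 'cV[C]_N by rewrite add0r.
by have := H h hr; rewrite E.
Qed.

(** Hensel's lemma applied to ['X^q - v t]: at [t = 0] a root is simple because [v 0 != 0], and the
    linear factor that lifts it carries the analytic root. *)
Lemma an1_root (v : C -> C) q : (0 < q)%N -> an1 v -> v 0 != 0 ->
  exists k d, [/\ 0 < d, an1 k & forall t, cabs t < d -> k t ^+ q = v t].
Proof.
case: q => // q _ av v0.
pose f t : {poly C} := 'X^(q.+1) - (v t)%:P.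
have fm t : f t \is monic /\ size (f t) = (1 + q).+1 by rewrite monicXnsubC ?size_XnsubC.
have af : an_poly f.
  move=> i; rewrite /an1 /cfun1; under eq_fun => ? do rewrite coefB coefC.
  by case: (i == 0%N); apply: anB => //; exact: an_cst.
pose ka := q.+1.-root (v 0); have kaE : ka ^+ q.+1 = v 0 by rewrite rootCK.
have ka0 : ka != 0 by rewrite rootC_eq0.
have /factor_theorem[h0 Dh0] : root (f 0) ka by apply/eqP; rewrite !hornerE kaE subrr.
have h0m : h0 \is monic.
  by have [+ _] := fm 0; rewrite Dh0 monicMr ?monicXsubC.
have sh0 : size h0 = q.+1.
  have [_] := fm 0; rewrite Dh0 size_Mmonic ?monicXsubC ?monic_neq0 // size_XsubC addn2 /=.
  by rewrite add1n => -[].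
have ch0 : coprimep ('X - ka%:P) h0.
  rewrite coprimep_sym coprimep_XsubC; apply/negP => /rootP h0k.
  have /(congr1 (fun p => p^`().[ka])) := Dh0.
  rewrite derivM hornerD !hornerM h0k hornerXsubC subrr mul0r mulr0 addr0.
  rewrite derivB derivXn derivC subr0 hornerMn hornerXn => /eqP.
  by rewrite mulrn_eq0 /= expf_eq0 (negbTE ka0) andbF.
have [|g [h [d [[d0 [g0 _]] ag _ gm gh]]]] := @hensel _ f ('X - ka%:P) h0 1 q 1 ltr01 af
   (fun t _ => fm t) (monicXsubC _) h0m (size_XsubC _) sh0 ch0.
  by rewrite Dh0 mulrC.
exists (fun t => - (g t)`_0), d; split=> //.
  have -> : (fun t => - (g t)`_0) = (fun t => 0 - (g t)`_0) by apply/funext => t; rewrite sub0r.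
  by apply: an1B; [exact: an1_cst | exact: ag].
move=> t td; have [[gtm gts] _] := gm t td.
have gtE : g t = 'X + ((g t)`_0)%:P.
  apply/polyP => -[|[|i]]; rewrite coefD coefX coefC /= ?add0r ?addr0 //.
    by move: gtm; rewrite monicE lead_coefE gts => /eqP.
  by rewrite nth_default ?gts ?addr0.
have : (f t).[- (g t)`_0] = 0.
  by rewrite gh // hornerM {1}gtE hornerD hornerX hornerC addNr mul0r.
by rewrite hornerD hornerN hornerXn hornerC => /eqP; rewrite subr_eq0 => /eqP.
Qed.

End Arcs.

Section ArcNormalForm.
Variable R : realType.
Local Notation C := (R[i]).
Local Notation K := (Num.NumField.sort (R[i] : numFieldType)).

(** The germ [f] is nonzero, of order [q], and divides [g]. *)
Definition dominates (f g : C -> C) := exists q u v (d : R), [/\ 0 < d, an1 u /\ u 0 != 0, an1 v &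
  forall t, t != 0 -> cabs t < d -> f t = t ^+ q * u t /\ g t = t ^+ q * v t].

Lemma dominates_total f g : an1 f -> an1 g ->
  [\/ exists2 d : R, 0 < d & forall t, cabs t < d -> f t = 0 /\ g t = 0,
      dominates f g | dominates g f].
Proof.
move=> af ag; case: (an1_order af) (an1_order ag) =>
  [[d d0 f0]|[k [u [au u0 fE]]]] [[d' d'0 g0]|[k' [u' [au' u'0 gE]]]].
- constructor 1; exists (Num.min d d'); first by rewrite lt_min d0.
  by move=> t; rewrite lt_min => /andP[td td']; rewrite f0 ?g0.
- constructor 3; exists k', u', (fun=> 0), d; split=> //; first exact: an1_cst.
  by move=> t t0 td; rewrite f0 // mulr0 gE.
- constructor 2; exists k, u, (fun=> 0), d'; split=> //; first exact: an1_cst.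
  by move=> t t0 td; rewrite g0 // mulr0 fE.
have [kk|/ltnW kk] := leqP k k'.
  constructor 2; exists k, u, (fun t => t ^+ (k' - k) * u' t), 1; split=> //.
    by apply: an1M => //; apply: an1X; exact: an1_id.
  by move=> t t0 _; rewrite fE // gE // mulrA -exprD subnKC.
constructor 3; exists k', u', (fun t => t ^+ (k - k') * u t), 1; split=> //.
  by apply: an1M => //; apply: an1X; exact: an1_id.
by move=> t t0 _; rewrite fE // gE // mulrA -exprD subnKC.
Qed.

(* After a change of parameter the arc is [t |-> (t ^ q, b t)], in the coordinates
   [i0] and [i1], with tangent direction [(1, bq)]; the last two clauses say that
   this parametrization is injective and covers the germ of [A]. *)
Definition arc_normal_form (A : set 'cV[C]_2) (i0 i1 : 'I_2) q (b : C -> C) bq (d B : R) :=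
  [/\ i1 != i0 /\ (0 < q)%N, 0 < d /\ an1 b,
    forall t, cabs t < d -> cabs (b t - bq * t ^+ q) <= B * cabs t ^+ q.+1,
    forall t z, cabs t < d -> t != 0 -> z ^+ q = 1 -> b (z * t) = b t -> z = 1 &
    forall d', 0 < d' -> d' <= d -> exists2 rho, 0 < rho & forall x, pdisc rho x ->
      (A x <-> exists t, [/\ cabs t < d', x i0 0 = t ^+ q & x i1 0 = b t])].

Lemma analytic_cont N (f : 'cV[C]_N -> C) a (e : R) : analytic_at (f : 'cV[K]_N -> K) a -> 0 < e ->
  exists2 r, 0 < r & forall h, pdisc r h -> cabs (f (a + h) - f a) <= e.
Proof.
move=> /analytic_at_shift/analytic_approx af e0.
have [r r0 H] := an_cont0 af e0; exists r => // h /H.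
have E : a + 0 = a :> 'cV[C]_N by rewrite addr0.
by rewrite E.
Qed.

(** Compactness of the closed disk: an accumulation point of parameters away from [0] whose images
    tend to the origin would be another parameter of the origin. Hence the germ of the image is that
    of its restriction to any smaller disk. *)
Lemma arc_small (r : R) (alpha : C -> 'cV[C]_2) (d : R) :
  (forall s, cabs s <= r -> analytic_map_at (fun t : 'cV[K]_1 => alpha (t 0 0)) (const_mx s)) ->
  (forall s, cabs s <= r -> alpha s = 0 -> s = 0) -> 0 < d ->
  exists2 rho, 0 < rho & forall t, cabs t <= r -> pdisc rho (alpha t) -> cabs t < d.
Proof.
move=> aalpha inj d0; apply: contrapT => H.
have q0 n : 0 < (2^-1 : R) ^+ n by rewrite exprn_gt0 ?invr_gt0.
have [n|t Ht] := @choice nat C (fun n t => [/\ cabs t <= r, pdisc (2^-1 ^+ n) (alpha t) & d <= cabs t]).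
  apply: contrapT => Hn; apply: H; exists (2^-1 ^+ n) => // t tr ta.
  by rewrite ltNge; apply/negP => dt; apply: Hn; exists t.
have [|l Hl] := @complex_bolzano_weierstrass _ t r; first by move=> n; case: (Ht n).
have lr : cabs l <= r.
  apply/ler_addgt0Pr => e e0; have [n _ Hn] := Hl e e0 0%N; have [tr _ _] := Ht n.
  have := cabs_tri l (t n) 0; rewrite !subr0 cabs_distC; lra.
have dl : d <= cabs l.
  apply/ler_addgt0Pr => e e0; have [n _ Hn] := Hl e e0 0%N; have [_ _ dt] := Ht n.
  have := cabs_tri (t n) l 0; rewrite !subr0; lra.
suff l0 : l = 0 by move: dl; rewrite l0 cabs0; lra.
apply: inj => //; apply/matrixP => i j; rewrite ord1 mxE; apply: cabs_eq_lim => e e0.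
have e20 : 0 < e / 2 by rewrite divr_gt0.
have [s s0 Hs] := analytic_cont (aalpha l lr i) e20.
have [n0 Hn0] := half_lt 1 e20; rewrite mul1r in Hn0.
have s20 : 0 < s / 2 by rewrite divr_gt0.
have [n n0n Hn] := Hl _ s20 n0; have [tr ta _] := Ht n.
have := Hs (const_mx (t n - l)); rewrite !mxE subrKC subr0 => H1.
have {}H1 : cabs (alpha (t n) i 0 - alpha l i 0) <= e / 2.
  by apply: H1 => k; rewrite mxE; lra.
have H2 : cabs (alpha (t n) i 0) <= e / 2.
  rewrite (le_trans (ltW (ta i))) // (le_trans _ Hn0) // ler_wiXn2l // ?invr_ge0 // invf_le1 // ler1n //.
have := cabs_tri (alpha l i 0) (alpha (t n) i 0) 0; rewrite !subr0 cabs_distC; lra.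
Qed.

(** A coordinate of lowest order is [t ^ q * u t] with [u 0 != 0]. For an analytic root [k] of
    [k t ^ q = 1 / u t] this is the [q]-th power of [t / k t], which becomes the new parameter;
    [an1_inverse] expresses [t] in terms of it. *)
Lemma arc_param (r : C) (alpha : C -> 'cV[C]_2) : injective_arc (r : K) (alpha : K -> 'cV[K]_2) ->
  exists i0 i1 q b bq d B, arc_normal_form (alpha @` @closed_disk (R[i] : numFieldType) r) i0 i1 q b bq d B.
Proof.
move=> [/gt0_complex[{}r r0 ->] aalpha alpha0 inja].
have diskE s : closed_disk (r%:C%C : K) s = (cabs s <= r) :> Prop.
  by rewrite /closed_disk /= cabsE lecR.
have {}aalpha s : cabs s <= r -> analytic_map_at (fun t : 'cV[K]_1 => alpha (t 0 0)) (const_mx s).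
  by move=> sr; apply: aalpha; rewrite diskE.
have {}inja s s' : cabs s <= r -> cabs s' <= r -> alpha s = alpha s' -> s = s'.
  by move=> sr sr'; apply: inja; rewrite inE diskE.
have inj0 s : cabs s <= r -> alpha s = 0 -> s = 0.
  by move=> sr s0; apply: inja; rewrite ?alpha0 // cabs0 ltW.
have af i : an1 (fun t => alpha t i 0).
  apply/analytic_approx; have := aalpha 0 _ i; rewrite cabs0 => /(_ (ltW r0)).
  suff -> : (const_mx 0 : 'cV[C]_1) = 0 by [].
  by apply/matrixP => ? ?; rewrite !mxE.
have [i0 [i1 [i10 [q [u [v [d1 [d10 [au u0] av fE]]]]]]]] :
   exists i0 i1 : 'I_2, i1 != i0 /\ dominates (fun t => alpha t i0 0) (fun t => alpha t i1 0).
  case: (dominates_total (af 0) (af 1)) => [[d d0 H]|H|H]; last 2 first.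
  - by exists 0, 1.
  - by exists 1, 0.
  (* Both coordinates vanish near [0], so that the nonzero parameter [t] would have the same image
     as [0]. *)
  pose t : C := (Num.min (d / 2) r)%:C%C.
  have m0 : 0 < Num.min (d / 2) r by rewrite lt_min divr_gt0.
  have tE : cabs t = Num.min (d / 2) r by rewrite cabs_real gtr0_norm.
  have td : cabs t < d by rewrite tE (@le_lt_trans _ _ (d / 2)) ?ge_min ?lexx //; lra.
  have [a0 a1] := H t td.
  have t0 : t = 0.
    apply: inj0; first by rewrite tE ge_min lexx orbT.
    apply/matrixP => i j; rewrite ord1 mxE; case: i => -[|[|//]] ip.
      by rewrite (_ : Ordinal ip = 0) //; exact: val_inj.
    by rewrite (_ : Ordinal ip = 1) //; exact: val_inj.
  by move: m0; rewrite -tE t0 cabs0 ltxx.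
pose f i t := alpha t i 0.
have f0 i : f i 0 = 0 by rewrite /f alpha0 mxE.
(* For [q = 0], [u 0] would be the limit at [0] of the coordinate [i0], which is [0]. *)
have q0 : (0 < q)%N.
  rewrite lt0n; apply/eqP => qq; move: u0; rewrite -cabs_gt0 => u0.
  have u40 : 0 < cabs (u 0) / 4 by rewrite divr_gt0.
  have [s s0 Hs] := an1_cont0 au u40; have [s' s'0 Hs'] := an1_cont0 (af i0) u40.
  pose m := Num.min (Num.min s s') d1; have m0 : 0 < m by rewrite !lt_min s0 s'0.
  pose t : C := (m / 2)%:C%C.
  have tE : cabs t = m / 2 by rewrite cabs_real gtr0_norm ?divr_gt0.
  have [[ts ts'] td1] : (cabs t < s /\ cabs t < s') /\ cabs t < d1.
    have : m <= m by []. rewrite {2}/m !le_min => /andP[/andP[? ?] ?].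
    by rewrite tE; split; [split|]; lra.
  have t0 : t != 0 by rewrite -cabs_gt0 tE divr_gt0.
  have [E _] := fE t t0 td1; have := Hs t ts; have := Hs' t ts'.
  rewrite /= E qq expr0 mul1r (f0 i0 : alpha 0 i0 0 = 0) subr0.
  have := cabs_tri (u 0) (u t) 0; rewrite !subr0 (cabs_distC (u 0)); lra.
have {}fE t : cabs t < d1 -> f i0 t = t ^+ q * u t /\ f i1 t = t ^+ q * v t.
  by have [->|t0] := eqVneq t 0; rewrite ?f0 ?expr0n ?gtn_eqF ?mul0r //; exact: fE.
have auV : an1 (fun t => (u t)^-1) by exact: an1V.
have [|k [d2 [d20 ak kE]]] := an1_root q0 auV; first by rewrite invr_eq0.
have [e20 [d3 d30 Hu]] : 0 < cabs (u 0) / 2 /\ exists2 d3, 0 < d3 & forall t, cabs t < d3 -> u t != 0.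
  have e20 : 0 < cabs (u 0) / 2 by rewrite divr_gt0 // cabs_gt0.
  split=> //; have [s s0 Hs] := an1_cont0 au e20; exists s => // t /Hs H.
  rewrite -cabs_gt0; have := cabs_tri (u 0) (u t) 0; rewrite !subr0 (cabs_distC (u 0)); lra.
have [T [dT [eta [dT0 eta0 aT TE Tuniq]]]] := an1_inverse ak.
have T0 : T 0 = 0 by rewrite TE ?cabs0 // mul0r.
pose m := Num.min (Num.min d1 r) (Num.min d2 d3).
have m0 : 0 < m by rewrite !lt_min d10 r0 d20.
have [d4 d40 HT] : exists2 d4, 0 < d4 & forall t, cabs t < d4 -> cabs (T t) < m.
  have m20 : 0 < m / 2 by rewrite divr_gt0.
  have [s s0 Hs] := an1_cont0 aT m20; exists s => // t /Hs.
  by rewrite T0 subr0; lra.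
have mP x : cabs x < m -> [/\ cabs x < d1, cabs x <= r, cabs x < d2 & cabs x < d3].
  by rewrite !lt_min => /andP[/andP[? /ltW ?] /andP[? ?]].
clearbody m.
have kq x : cabs x < m -> k x ^+ q * u x = 1.
  by move=> /mP[_ _ x2 x3]; rewrite kE // mulVf // Hu.
have k0 x : cabs x < m -> k x != 0.
  by move=> /kq E; apply: contra_eq_neq E => ->; rewrite expr0n gtn_eqF // mul0r eq_sym oner_neq0.
pose b t := f i1 (T t).
have ab : an1 b by apply: (an1_comp (u := f i1)) (af i1) aT _; rewrite /cfun1 mxE.
(* Then [b t = t ^+ q * w t]: the slope is [w 0], and the error bound is the Lipschitz estimate of
   [w] at [0]. *)
pose w t := k (T t) ^+ q * v (T t).
have aw : an1 w.
  apply: an1M.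
    by apply: an1X; apply: (an1_comp ak aT); rewrite /cfun1 mxE.
  by apply: (an1_comp av aT); rewrite /cfun1 mxE.
have [d5 [B [d50 B0 Hw]]] := an1_lip0 aw.
pose d := Num.min (Num.min dT d4) d5.
have d0 : 0 < d by rewrite !lt_min dT0 d40.
have dP t : cabs t < d -> [/\ cabs t < dT, cabs (T t) < m & cabs t <= d5].
  rewrite lt_min => /andP[+ /ltW ?]; rewrite lt_min => /andP[? /HT ?]; by split.
clearbody d.
have f0T t : cabs t < d -> f i0 (T t) = t ^+ q.
  move=> /dP[tT tm _]; have [T1 _ _ _] := mP _ tm; have [-> _] := fE _ T1.
  by rewrite {1}TE // exprMn -mulrA kq ?mulr1.
have alphaT t : cabs t < d -> forall x : 'cV[C]_2, x i0 0 = t ^+ q -> x i1 0 = b t -> x = alpha (T t).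
  move=> td x x0 x1; apply/matrixP => i j; rewrite ord1.
  have : (i == i0) || (i == i1).
    by move: i10; case: (i) (i0) (i1) => -[|[|//]] ? [[|[|//]] ?] [[|[|//]] ?].
  by case/orP => /eqP->; rewrite ?x0 ?x1 // -f0T.
exists i0, i1, q, b, (w 0), d, B; split=> //.
- move=> t td; have [tT tm t5] := dP t td; have [T1 _ _ _] := mP _ tm.
  have -> : b t = t ^+ q * w t.
    by rewrite /b /w; have [_ ->] := fE _ T1; rewrite {1}TE // exprMn mulrA.
  rewrite mulrC -mulrBl cabsM cabsX exprSr mulrA mulrAC ler_wpM2r ?exprn_ge0 ?cabs_ge0 //.
  exact: Hw.
- move=> t z td t0 zq bz; have z1 : cabs z = 1 by exact: cabs_unity zq.
  have ztd : cabs (z * t) < d by rewrite cabsM z1 mul1r.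
  have [tT tm _] := dP t td; have [ztT ztm _] := dP _ ztd.
  have E : alpha (T (z * t)) = alpha (T t).
    apply: alphaT => //; first by rewrite -/(f i0 _) f0T // exprMn zq mul1r.
  have {}E : T (z * t) = T t.
    by apply: inja E; [case: (mP _ ztm) | case: (mP _ tm)].
  move: (TE _ ztT); rewrite E {1}TE // -mulrA => /eqP.
  have kT0 : t * k (T t) != 0 by rewrite mulf_neq0 // k0.
  by rewrite -{1}[t * _]mul1r (inj_eq (mulIf kT0)) => /eqP.
move=> d' d'0 d'd.
have k00 : k 0 != 0 by apply: k0; rewrite cabs0.
have k20 : 0 < cabs (k 0) / 2 by rewrite divr_gt0 // cabs_gt0.
have [s s0 Hs] := an1_cont0 ak k20.
(* The last bound turns [cabs t < m'] into [cabs (t / k t) < d'], since [cabs (k t)] is at least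
   [cabs (k 0) / 2]. *)
pose m' := Num.min (Num.min eta s) (Num.min m (d' * (cabs (k 0) / 2))).
have m'0 : 0 < m' by rewrite !lt_min eta0 s0 m0 mulr_gt0.
have [rho rho0 Hrho] := arc_small aalpha inj0 m'0.
exists rho => // x xrho; split; last first.
  move=> [t [td' x0 x1]]; have td : cabs t < d by exact: lt_le_trans td' d'd.
  exists (T t); last exact/esym/(alphaT t td x x0 x1).
  by rewrite diskE; have [_ tm _] := dP t td; case: (mP _ tm).
move=> [t]; rewrite diskE => tr xE; rewrite -xE in xrho *.
have := Hrho t tr xrho; rewrite !lt_min => /andP[/andP[teta ts] /andP[tm td]].
have kt : cabs (k 0) / 2 <= cabs (k t).
  by have := Hs t ts; have := cabs_tri (k 0) (k t) 0; rewrite !subr0 (cabs_distC (k 0)); lra.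
have kt0 : k t != 0 by exact: k0.
have taud : cabs (t / k t) < d'.
  rewrite cabsM cabsV ltr_pdivrMr ?cabs_gt0 // (lt_le_trans td) // ler_wpM2l // ltW //.
have tE : t = T (t / k t).
  apply: Tuniq; [|exact: ltW|by rewrite divfK].
  by have [] := dP _ (lt_le_trans taud d'd).
exists (t / k t); split=> //; last by rewrite /b -tE.
by rewrite -f0T ?(lt_le_trans taud) // -tE.
Qed.

End ArcNormalForm.

(** * Splitting a Weierstrass polynomial over an arc *)

Section Splitting.
Variable R : realType.
Local Notation C := (R[i]).

(** Divide by [t] as long as all the germs vanish at [0]; the member [t ^+ M] does not allow [M.+1]
    divisions. *)
Lemma common_order (I : Type) (F : I -> C -> C) i0 M : (forall i, an1 (F i)) ->
  (forall t, F i0 t = t ^+ M) ->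
  exists N U, [/\ forall i, an1 (U i), exists i, U i 0 != 0 & forall i t, F i t = t ^+ N * U i t].
Proof.
move=> aF F0; apply: contrapT => H.
have [U [aU FU]] : exists U, (forall i, an1 (U i)) /\ forall i t, F i t = t ^+ M.+1 * U i t.
  elim: M.+1 => [|n [U [aU FU]]]; first by exists F; split=> // i t; rewrite mul1r.
  have U0 i : U i 0 = 0.
    by apply: contrapT => /eqP Ui; apply: H; exists n, U; split=> //; exists i.
  have [i|V HV] := @choice I (C -> C) (fun i V => an1 V /\ forall t, U i t = t * V t).
    by have [V aV UV] := an1_divX (aU i) (U0 i); exists V.
  exists V; split=> [i|i t]; first by case: (HV i).
  by rewrite FU exprSr -mulrA; congr (_ * _); case: (HV i).
have aid : an1 (fun t => t * U i0 t) by apply: an1M => //; exact: an1_id.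
have h0 : 0 < (2^-1 : R) by rewrite invr_gt0.
have [r r0 Hr] := an1_cont0 aid h0; rewrite mul0r in Hr.
pose t : C := (r / 2)%:C%C; have tE : cabs t = r / 2 by rewrite cabs_real gtr0_norm ?divr_gt0.
have t0 : t != 0 by rewrite -cabs_gt0 tE divr_gt0.
have := Hr t; rewrite subr0 tE => /(_ _)/wrap[|]; first lra.
have -> : t * U i0 t = 1.
  by apply: (mulfI (expf_neq0 M t0)); rewrite mulr1 mulrA -exprSr -FU F0.
by rewrite cabs1; lra.
Qed.

Lemma cauchy_root_bound (p : {poly C}) n (A : R) v : 0 <= A -> p \is monic -> size p = n.+1 ->
  (forall i, (i < n)%N -> cabs p`_i <= A) -> p.[v] = 0 -> cabs v <= 1 + n%:R * A.
Proof.
move=> A0 pm sp pA pv.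
have nA : 0 <= n%:R * A by rewrite mulr_ge0.
have [v1|v1] := leP (cabs v) 1; first lra.
have v0 : 0 < cabs v by exact: lt_trans v1.
case: n => [|n] in sp pA nA *.
  have pE : p = (p`_0)%:P by apply: size1_polyC; rewrite sp.
  move: pm; rewrite monicE lead_coefE sp /= => /eqP p01.
  by move: pv; rewrite pE p01 hornerC => /eqP; rewrite oner_eq0.
have E : v ^+ n.+1 = - \sum_(i < n.+1) p`_i * v ^+ i.
  have p1 : p`_n.+1 = 1 by move: pm; rewrite monicE lead_coefE sp => /eqP.
  by move: (pv); rewrite horner_coef sp big_ord_recr /= p1 mul1r addrC => /eqP; rewrite addr_eq0 => /eqP.
have : cabs v ^+ n.+1 <= n.+1%:R * A * cabs v ^+ n.
  rewrite -cabsX E cabsN (le_trans (cabs_sum _ _ _)) //.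
  rewrite (@le_trans _ _ (\sum_(i < n.+1) A * cabs v ^+ n)) //; last first.
    by rewrite sumr_const card_ord -mulrA mulr_natl.
  apply: ler_sum => i _; rewrite cabsM cabsX.
  apply: ler_pM; [exact: cabs_ge0 | by rewrite exprn_ge0 ?cabs_ge0 | exact: pA |].
  by rewrite ler_weXn2l ?(ltW v1) // -ltnS.
by rewrite exprS ler_pM2r ?exprn_gt0 //; lra.
Qed.

Lemma poly_close (g : C -> {poly C}) n (r V e : R) : an_poly g ->
  0 < r -> (forall t, cabs t < r -> (size (g t) <= n)%N) -> 0 < V -> 0 < e ->
  exists2 d, 0 < d & forall t v, cabs t < d -> cabs v <= V -> cabs ((g t).[v] - (g 0).[v]) <= e.
Proof.
move=> ag r0 sg V0 e0.
have c0 : 0 < e / (n.+1%:R * (1 + V) ^+ n) by rewrite divr_gt0 // mulr_gt0 ?ltr0n // exprn_gt0 // addr_gt0.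
have [i s s' s'0 ss Hs t ts|i|d d0 Hd] := @fin_radius R 'I_n (fun i d =>
   forall t, cabs t < d -> cabs ((g t)`_i - (g 0)`_i) <= e / (n.+1%:R * (1 + V) ^+ n)).
- by apply: Hs; exact: lt_le_trans ts ss.
- exact: an1_cont0.
exists (Num.min d r); first by rewrite lt_min d0.
move=> t v; rewrite lt_min => /andP[td tr] vV.
have sg0 : (size (g 0%R) <= n)%N by rewrite sg // cabs0.
rewrite (horner_coef_wide _ (sg t tr)) (horner_coef_wide _ sg0) -sumrB (le_trans (cabs_sum _ _ _)) //.
rewrite (@le_trans _ _ (\sum_(i < n) e / n.+1%:R)) //; last first.
  rewrite sumr_const card_ord -[leLHS]mulr_natl mulrCA ler_piMr ?(ltW e0) //.
  by rewrite ler_pdivrMr ?ltr0n // mul1r ler_nat.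
apply: ler_sum => i _; rewrite -mulrBl cabsM cabsX.
rewrite (@le_trans _ _ (e / (n.+1%:R * (1 + V) ^+ n) * (1 + V) ^+ n)) //.
  rewrite ler_pM ?cabs_ge0 ?exprn_ge0 ?Hd ?cabs_ge0 //.
  rewrite (@le_trans _ _ ((1 + V) ^+ i)) //.
    by rewrite lerXn2r ?nnegrE ?cabs_ge0 ?addr_ge0 ?(ltW V0) // (le_trans vV) // lerDr.
  by rewrite ler_weXn2l ?lerDl ?(ltW V0) // ltnW.
rewrite le_eqVlt; apply/orP; left; apply/eqP; field.
by rewrite nat1r pnatr_eq0 /= expf_neq0 // gt_eqF // addr_gt0.
Qed.

Lemma poly_nonroot (p : {poly C}) : p != 0 -> exists c, p.[c] != 0.
Proof.
move=> p0; apply: contrapT => H.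
have rs : all (root p) [seq k%:R | k <- iota 0 (size p)].
  by apply/allP => c _; apply/negPn/negP => pc; apply: H; exists c.
have := max_poly_roots p0 rs; rewrite size_map size_iota ltnn => /(_ _)/wrap[|//].
by rewrite map_inj_uniq ?iota_uniq // => x y /eqP; rewrite eqr_nat => /eqP.
Qed.

Lemma an1_neq0 (f : C -> C) : an1 f -> f 0 != 0 ->
  exists2 d : R, 0 < d & forall t, cabs t < d -> f t != 0.
Proof.
move=> af f0; have e0 : 0 < cabs (f 0) / 2 by rewrite divr_gt0 // cabs_gt0.
have [d d0 Hd] := an1_cont0 af e0; exists d => // t /Hd H.
rewrite -cabs_gt0; have := cabs_tri (f 0) (f t) 0; rewrite !subr0 (cabs_distC (f 0)).
lra.
Qed.

Lemma coef_exp_linear (c : C) i : ((c *: 'X + 1) ^+ i)`_i = c ^+ i /\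
  (size ((c *: 'X + 1) ^+ i)%R <= i.+1)%N.
Proof.
have s1 : (size (c *: 'X + 1 : {poly C})%R <= 2)%N.
  by rewrite (leq_trans (size_polyD _ _)) // size_poly1 geq_max (leq_trans (size_scale_leq _ _)) ?size_polyX.
elim: i => [|i [IH1 IH2]]; first by rewrite !expr0 coef1 size_poly1.
split; last first.
  rewrite exprS (leq_trans (size_polyMleq _ _)) // -subn1 leq_subLR add1n.
  by rewrite (leq_trans (leq_add s1 IH2)).
rewrite exprSr mulrDr mulr1 coefD -scalerAr coefZ coefMX /= IH1.
by rewrite (nth_default _ IH2) addr0 -exprS.
Qed.

Definition an2v (k : C -> C -> C) := an (fun h : 'cV[C]_2 => k (h 0 0) (h 1 0)).

(** Two curves cover the roots, and neither contains a whole fiber. The fiber [t = 0] is left out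
    because the coordinate [v] used to separate the roots degenerates there. *)
Definition splits (p : C -> {poly C}) := exists (k1 k2 : C -> C -> C) (d : R),
  [/\ 0 < d, an2v k1 /\ an2v k2, k1 0 0 = 0 /\ k2 0 0 = 0,
    forall t z, t != 0 -> cabs t < d -> (p t).[z] = 0 <-> k1 t z = 0 \/ k2 t z = 0 &
    forall t, t != 0 -> cabs t < d ->
      (exists2 z, (p t).[z] = 0 & k1 t z != 0) /\ (exists2 z, (p t).[z] = 0 & k2 t z != 0)].

(* On the curve of the points [(t ^ q, z)] with [z] a root of [p t], the limit of
   [(t ^ q : z - c t ^ q)] is [(v0 : 1)].  The shift by [c] leaves room for a
   vertical direction ([v0 = 0]). *)
Definition single_tangent (p : C -> {poly C}) q := exists c v0 : C, forall e : R, 0 < e ->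
  exists2 d : R, 0 < d & forall t z, t != 0 -> cabs t < d -> (p t).[z] = 0 ->
    cabs (v0 * (z - c * t ^+ q) - t ^+ q) <= e * cabs (z - c * t ^+ q).

(* The constant [c] is chosen so that [z = c t ^ q] is the direction of no branch.
   In [v = t ^ q / (z - c t ^ q)] the equation then becomes monic with analytic
   coefficients: either its value at [t = 0] has a single root, or it factors
   there into coprime factors and Hensel's lemma applies. *)
Lemma splits_or_single (p : C -> {poly C}) q n (r : R) : 0 < r -> (0 < q)%N -> (0 < n)%N ->
  an_poly p -> (forall t, cabs t < r -> p t \is monic /\ size (p t) = n.+1) ->
  splits p \/ single_tangent p q.
Proof.
move=> r0 q0 n0 ap pm.
have p_n t : cabs t < r -> (p t)`_n = 1.
  by move=> /pm[+ sp]; rewrite monicE lead_coefE sp => /eqP.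
(* The coefficients of [p t] after the substitution of [t ^ q * X] for the variable; dividing out
   their common power of [t] gives [f t], with [f 0 != 0]. The top coefficient is replaced by [1]
   because [p t] is monic only for small [t]. *)
pose F (i : 'I_n.+1) t := (if i == ord_max then 1 else (p t)`_i) * t ^+ (q * i).
have aF i : an1 (F i).
  apply: an1M; last by apply: an1X; exact: an1_id.
  by case: (i == ord_max); [exact: an1_cst | exact: ap].
have [|N [U [aU [iU iU0] FU]]] := @common_order _ F ord_max (q * n) aF.
  by move=> t; rewrite /F eqxx mul1r.
pose f t : {poly C} := \sum_(i < n.+1) U i t *: 'X^i.
have aff : an_poly f.
  move=> j; rewrite /an1 /cfun1; under eq_fun => ? do rewrite coef_sum.
  apply: an_sum => i _; under eq_fun => ? do rewrite coefZ.
  by apply: anM; [exact: aU | exact: an_cst].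
have [c fc0] : exists c, (f 0).[c] != 0.
  have f0 : f 0 != 0.
    apply/eqP => /(congr1 (fun p : {poly C} => p`_iU)); rewrite coef_sum coef0 (bigD1 iU) //= big1.
      by rewrite coefZ coefXn eqxx mulr1 addr0 => E; rewrite E eqxx in iU0.
    move=> i ii; rewrite coefZ coefXn eq_sym.
    by rewrite (_ : (i : nat) == iU = false) ?mulr0 //; apply/negbTE.
  exact: poly_nonroot.
have fcE t : (f t).[c] = \sum_(i < n.+1) U i t * c ^+ i.
  by rewrite horner_sum; apply: eq_bigr => i _; rewrite hornerZ hornerXn.
have afc : an1 (fun t => (f t).[c]).
  rewrite /an1 /cfun1; under eq_fun => ? do rewrite fcE.
  by apply: an_sum => i _; apply: anM; [exact: aU | exact: an_cst].
have [d1 d10 fc] := an1_neq0 afc fc0.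
(* In terms of [v] the ratio of [z] to [t ^ q] is [c + 1 / v], so that [ft t] is [v ^ n] times the
   value of [f t] at [c + 1 / v]. Its coefficient of degree [n] is [(f t).[c]], a unit by the choice
   of [c]. *)
pose lin (i : nat) : {poly C} := (c *: 'X + 1) ^+ i * 'X^(n - i).
pose ft t : {poly C} := \sum_(i < n.+1) U i t *: lin i.
have linn (i : 'I_n.+1) : (lin i)`_n = c ^+ i.
  have [E _] := coef_exp_linear c i; have i_n : (i <= n)%N by rewrite -ltnS.
  by rewrite coefMXn ltnNge leq_subr /= subKn.
have slin (i : 'I_n.+1) : (size (lin i) <= n.+1)%N.
  have [_ E] := coef_exp_linear c i; have i_n : (i <= n)%N by rewrite -ltnS.
  rewrite (leq_trans (size_polyMleq _ _)) // size_polyXn addnS /=.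
  by rewrite (leq_trans (leq_add E (leqnn _))) // addSn subnKC.
pose fm t := (f t).[c]^-1 *: ft t.
have fmm t : cabs t < d1 -> fm t \is monic /\ size (fm t) = n.+1.
  move=> td; have fcn := fc t td.
  have sf : (size (fm t) <= n.+1)%N.
    rewrite (leq_trans (size_scale_leq _ _)) // (leq_trans (size_sum _ _ _)) //.
    by apply/bigmax_leqP => i _; rewrite (leq_trans (size_scale_leq _ _)).
  have fmn : (fm t)`_n = 1.
    rewrite coefZ coef_sum (eq_bigr (fun i : 'I_n.+1 => U i t * c ^+ i)) -?fcE ?mulVf //.
    by move=> i _; rewrite coefZ linn.
  have s1 : size (fm t) = n.+1.
    apply/eqP; rewrite eqn_leq sf ltnNge; apply/negP => /leq_sizeP/(_ n (leqnn _)).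
    by rewrite fmn => /eqP; rewrite oner_eq0.
  by rewrite monicE lead_coefE s1 fmn eqxx.
have afm : an_poly fm.
  move=> j; rewrite /an1 /cfun1; under eq_fun => ? do rewrite coefZ coef_sum.
  apply: anM; first exact: (an1V afc).
  apply: an_sum => i _; under eq_fun => ? do rewrite coefZ.
  by apply: anM; [exact: aU | exact: an_cst].
pose d := Num.min d1 r; have d0 : 0 < d by rewrite lt_min d10.
have dP t : cabs t < d -> cabs t < d1 /\ cabs t < r by rewrite lt_min => /andP[].
clearbody d.
have pF t i : cabs t < d -> (p t)`_(i : 'I_n.+1) * t ^+ (q * i) = t ^+ N * U i t.
  move=> /dP[_ tr]; rewrite -FU /F; case: eqP => // ->; by rewrite p_n.
have sp t : cabs t < d -> size (p t) = n.+1 by move=> /dP[_ /pm[]].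
have key t y : cabs t < d -> t != 0 -> y != 0 ->
    ((p t).[c * t ^+ q + y] == 0) = ((fm t).[t ^+ q / y] == 0).
  move=> td t0 y0; have s0 : t ^+ q != 0 by rewrite expf_neq0.
  set s := t ^+ q in s0 *; set v := s / y; have v0 : v != 0 by rewrite mulf_neq0 ?invr_eq0.
  have zv : (c * s + y) * v = s * (c * v + 1) by rewrite /v; field.
  have E : (p t).[c * s + y] * v ^+ n = t ^+ N * (ft t).[v].
    rewrite horner_coef sp // mulr_suml /ft horner_sum mulr_sumr; apply: eq_bigr => i _.
    have i_n : (i <= n)%N by rewrite -ltnS.
    rewrite hornerZ /lin hornerM horner_exp hornerD hornerZ hornerX hornerC hornerXn.
    have vn : v ^+ n = v ^+ i * v ^+ (n - i) by rewrite -exprD subnKC.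
    have zvi : (c * s + y) ^+ i * v ^+ i = t ^+ (q * i) * (c * v + 1) ^+ i.
      by rewrite -exprMn zv exprMn exprM.
    by rewrite [RHS]mulrA -pF // vn [LHS]mulrA -(mulrA _ _ (v ^+ i)) zvi !mulrA.
  have fcn : (f t).[c] != 0 by apply: fc; case: (dP t td).
  rewrite hornerZ [RHS]mulf_eq0 invr_eq0 (negbTE fcn) /=.
  have := congr1 (fun x => x == 0) E; rewrite !mulf_eq0 !expf_eq0 (negbTE v0) (negbTE t0) !andbF.
  by rewrite orbF.
have key0 t : cabs t < d -> t != 0 -> (p t).[c * t ^+ q] != 0.
  move=> td t0; rewrite horner_coef sp //.
  rewrite (eq_bigr (fun i : 'I_n.+1 => t ^+ N * (U i t * c ^+ i))); last first.
    by move=> i _; rewrite mulrA -pF // exprMn -exprM mulrA mulrAC.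
  rewrite -mulr_sumr -fcE mulf_neq0 ?expf_neq0 //.
  by apply: fc; case: (dP t td).
(* [v = 0] stands for [z] infinite, which is excluded because [p t] is monic. *)
have fm0 t : cabs t < d -> t != 0 -> (fm t).[0] != 0.
  move=> td t0; have fcn : (f t).[c] != 0 by apply: fc; case: (dP t td).
  rewrite hornerZ mulf_neq0 ?invr_eq0 // /ft horner_sum (bigD1 ord_max) //= big1 ?addr0; last first.
    move=> i ii; have {}ii : (i < n)%N.
      by rewrite ltn_neqAle -ltnS ltn_ord andbT; apply: contra ii => /eqP ii; apply/eqP/val_inj.
    by rewrite hornerZ hornerM hornerXn expr0n subn_eq0 leqNgt ii /= !mulr0.
  rewrite hornerZ hornerM hornerXn subnn expr0 mulr1 horner_exp hornerD hornerZ hornerX hornerC.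
  rewrite mulr0 add0r expr1n mulr1.
  have := pF t ord_max td; rewrite p_n ?mul1r; last by case: (dP t td).
  by apply: contra_eq_neq => ->; rewrite mulr0 expf_neq0.
have d00 : cabs (0 : C) < d by rewrite cabs0.
have [fm0m fm0s] := fmm 0 (dP 0 d00).1.
have [v1 v1r] : exists v, root (fm 0) v by apply/closed_rootP; rewrite fm0s; case: (n) n0.
have [m [h0]] := multiplicity_XsubC (fm 0) v1; rewrite monic_neq0 //= => h0v1 Dfm.
have m0 : (0 < m)%N.
  rewrite lt0n; apply/eqP => mm; move: h0v1 v1r.
  by rewrite Dfm mm expr0 mulr1 => /negbTE ->.
set g0 := ('X - v1%:P) ^+ m in Dfm.
have g0m : g0 \is monic by rewrite monic_exp ?monicXsubC.
have sg0 : size g0 = m.+1 by rewrite size_exp_XsubC.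
have h0m : h0 \is monic by move: fm0m; rewrite Dfm monicMr.
have [e' sh0] : exists e', size h0 = e'.+1.
  by exists (size h0).-1; rewrite prednK // size_poly_gt0 monic_neq0.
have me : n = (m + e')%N.
  have := fm0s; rewrite Dfm size_Mmonic ?monic_neq0 // sg0 sh0 addSn addnS /=.
  by rewrite addnC => -[].
have [V V0 [d2 d20 HV]] : exists2 V : R, 0 < V & exists2 d2 : R, 0 < d2 & forall t v, cabs t < d2 ->
    (fm t).[v] = 0 -> cabs v <= V.
  have [A A0 HA] := cabs_coef_bound (fm 0).
  have [i s s' s'0 ss Hs t ts|i|d2 d20 Hd2] := @fin_radius R 'I_n (fun i s =>
     forall t, cabs t < s -> cabs ((fm t)`_i - (fm 0)`_i) <= 1).
  - by apply: Hs; exact: lt_le_trans ts ss.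
  - exact: an1_cont0.
  exists (1 + n%:R * (1 + A)); first by rewrite ltr_pwDl // mulr_ge0 // addr_ge0 // ltW.
  exists (Num.min d2 d); first by rewrite lt_min d20.
  move=> t v; rewrite lt_min => /andP[td2 td] fv.
  have [mm ss] := fmm t (dP t td).1.
  apply: (cauchy_root_bound _ mm ss _ fv); first by rewrite addr_ge0 // ltW.
  move=> i i_n; rewrite -[_`_i](subrK (fm 0)`_i) (le_trans (cabsD _ _)) // lerD //.
  exact: (Hd2 (Ordinal i_n)).
(* If [fm 0] is a power of ['X - v1], then at a root [v] of [fm t] the quantity [(v - v1) ^ n = (fm
   0).[v]] is small by continuity, so that [v] tends to [v1]. *)
case: (posnP e') => [e0|e0].
  have h01 : h0 = 1.
    have pE : h0 = (h0`_0)%:P by apply: size1_polyC; rewrite sh0 e0.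
    by move: h0m; rewrite monicE lead_coefE sh0 e0 /= pE coefC eqxx => /eqP ->.
  right; exists c, v1 => e ee.
  have en : 0 < e ^+ n by rewrite exprn_gt0.
  have sfm t : cabs t < d -> (size (fm t) <= n.+1)%N by move=> /dP[/fmm[_ ->]].
  have [d3 d30 Hd3] := poly_close afm d0 sfm V0 en.
  exists (Num.min d (Num.min d2 d3)); first by rewrite !lt_min d0 d20.
  move=> t z t0; rewrite lt_min => /andP[td]; rewrite lt_min => /andP[td2 td3] pz.
  pose y := z - c * t ^+ q.
  have zE : z = c * t ^+ q + y by rewrite /y addrC subrK.
  have y0 : y != 0.
    by apply: contra_neq (key0 t td t0) => y0; rewrite -pz zE y0 addr0.
  have fv : (fm t).[t ^+ q / y] = 0 by apply/eqP; rewrite -key // -zE pz.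
  rewrite -/y; have -> : v1 * y - t ^+ q = (v1 - t ^+ q / y) * y by field.
  rewrite cabsM ler_wpM2r ?cabs_ge0 // cabs_distC.
  rewrite -(@ler_pXn2r _ n) ?nnegrE ?cabs_ge0 ?(ltW ee) // -cabsX.
  have -> : (t ^+ q / y - v1) ^+ n = (fm 0).[t ^+ q / y] - (fm t).[t ^+ q / y].
    by rewrite fv subr0 Dfm h01 mul1r horner_exp hornerXsubC me e0 addn0.
  by rewrite cabs_distC; apply: Hd3; rewrite ?(HV t).
left.
have cgh : coprimep g0 h0 by rewrite coprimep_sym coprimep_expr // coprimep_XsubC.
have fm_n t : cabs t < d -> fm t \is monic /\ size (fm t) = (m + e').+1.
  by rewrite -me => /dP[/fmm].
have [|g [h [d3 [[d30 [gE0 hE0]] ag ah ghm ghE]]]] := hensel d0 afm fm_n g0m h0m sg0 sh0 cgh.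
  by rewrite Dfm mulrC.
(* The homogenization of [G t] at [t ^ q] and [z - c t ^ q], which is analytic in [(t, z)] although
   [v] is not. *)
pose k (G : C -> {poly C}) e (t z : C) :=
  \sum_(j < e.+1) (G t)`_j * (t ^+ q) ^+ j * (z - c * t ^+ q) ^+ (e - j).
have kan G e : an_poly G -> an2v (k G e).
  move=> aG; have at0 : an (fun h : 'cV[C]_2 => h 0 0 ^+ q) by apply: anX; exact: an_coord.
  apply: an_sum => j _; apply: anM; last first.
    apply: anX; apply: anB; first exact: an_coord.
    by apply: anM => //; exact: an_cst.
  apply: anM; last exact: anX.
  by apply: (an1_comp (u := fun t => (G t)`_j)) => //; [exact: an_coord | rewrite mxE].
have k00 G e : (0 < e)%N -> k G e 0 0 = 0.
  case: e => // e _; rewrite /k big1 // => -[[|j] je] _ /=.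
    by rewrite expr0n gtn_eqF // mulr0 subr0 exprS mul0r mulr0.
  by rewrite expr0n gtn_eqF // exprS mul0r mulr0 mul0r.
have kP (G : C -> {poly C}) e t y : G t \is monic -> size (G t) = e.+1 -> t != 0 ->
    k G e t (c * t ^+ q + y) = 0 <-> y != 0 /\ (G t).[t ^+ q / y] = 0.
  move=> Gm Gs t0; have s0 : t ^+ q != 0 by rewrite expf_neq0.
  have Ge : (G t)`_e = 1 by move: Gm; rewrite monicE lead_coefE Gs => /eqP.
  have [->|y0] := eqVneq y 0.
    split=> [|[]//]; rewrite /k addr0 subrr big_ord_recr /= subnn expr0 mulr1 Ge mul1r big1.
      by rewrite add0r => /eqP; rewrite !expf_eq0 (negbTE t0) !andbF.
    move=> j _; rewrite -[(e - j)%N]prednK ?subn_gt0 // exprS mul0r mulr0 //.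
  have -> : k G e t (c * t ^+ q + y) = y ^+ e * (G t).[t ^+ q / y].
    rewrite horner_coef Gs mulr_sumr; apply: eq_bigr => j _.
    have je : (j <= e)%N by rewrite -ltnS.
    have -> : y ^+ e = y ^+ j * y ^+ (e - j) by rewrite -exprD subnKC.
    rewrite [c * _ + y]addrC addrK expr_div_n; field; exact: expf_neq0.
  split=> [/eqP|[_ ->]]; last by rewrite mulr0.
  by rewrite mulf_eq0 expf_eq0 (negbTE y0) andbF /= => /eqP.
(* The identity [u * g0 + v * h0 = 1] keeps [g t] and [h t] coprime for small [t]: at a common root,
   bounded by [V], its left-hand side would be at most [1 / 4 + 1 / 4]. *)
have [[u v] /= uv] := Bezout_eq1_coprimepP _ _ cgh.
have [Mu U0 HU] := polyfun_bounded (V + 1) (polyfun_horner u (polyfun_coord R (ord0 : 'I_1))).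
have [Mv W0 HW] := polyfun_bounded (V + 1) (polyfun_horner v (polyfun_coord R (ord0 : 'I_1))).
have gsize t : cabs t < d3 -> (size (g t) <= m.+1)%N by move=> /ghm[[_ ->]].
have hsize t : cabs t < d3 -> (size (h t) <= e'.+1)%N by move=> /ghm[_ [_ ->]].
have U40 : 0 < (4 * Mu)^-1 by rewrite invr_gt0 mulr_gt0.
have W40 : 0 < (4 * Mv)^-1 by rewrite invr_gt0 mulr_gt0.
have [d4 d40 Hd4] := poly_close ag d30 gsize V0 U40.
have [d5 d50 Hd5] := poly_close ah d30 hsize V0 W40.
pose d' := Num.min (Num.min d d2) (Num.min d3 (Num.min d4 d5)).
have d'0 : 0 < d' by rewrite !lt_min d0 d20 d30 d40.
have d'P t : cabs t < d' -> [/\ cabs t < d, cabs t < d2, cabs t < d3, cabs t < d4 & cabs t < d5].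
  rewrite lt_min => /andP[]; rewrite lt_min => /andP[? ?].
  by rewrite lt_min => /andP[?]; rewrite lt_min => /andP[? ?].
have nocommon t x : cabs t < d' -> (g t).[x] = 0 -> (h t).[x] = 0 -> False.
  move=> /d'P[td td2 td3 td4 td5] gx hx.
  have xV : cabs x <= V by apply: (HV t) => //; rewrite ghE // hornerM gx mul0r.
  have H1 := Hd4 t x td4 xV; have H2 := Hd5 t x td5 xV.
  rewrite gx gE0 sub0r cabsN in H1; rewrite hx hE0 sub0r cabsN in H2.
  have Ux : cabs u.[x] <= Mu.
    by have := HU (const_mx x); rewrite mxE; apply => i; rewrite mxE; lra.
  have Wx : cabs v.[x] <= Mv.
    by have := HW (const_mx x); rewrite mxE; apply => i; rewrite mxE; lra.
  have : cabs (u.[x] * g0.[x] + v.[x] * h0.[x]) <= 4^-1 + 4^-1.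
    rewrite (le_trans (cabsD _ _)) // !cabsM lerD //.
      have -> : 4^-1 = Mu * (4 * Mu)^-1 by field; rewrite gt_eqF.
      by rewrite ler_pM ?cabs_ge0.
    have -> : 4^-1 = Mv * (4 * Mv)^-1 by field; rewrite gt_eqF.
    by rewrite ler_pM ?cabs_ge0.
  by rewrite -!hornerM -hornerD uv hornerC cabs1; lra.
have zeros t z : t != 0 -> cabs t < d' -> (p t).[z] = 0 <-> k g m t z = 0 \/ k h e' t z = 0.
  move=> t0 /d'P[td td2 td3 td4 td5]; have [[gm gs] [hm hs]] := ghm t td3.
  pose y := z - c * t ^+ q; have zE : z = c * t ^+ q + y by rewrite /y addrC subrK.
  rewrite zE; have kg := kP g m t y gm gs t0; have kh := kP h e' t y hm hs t0.
  split=> [/eqP pz|H].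
    have y0 : y != 0 by apply/eqP => y0; move: pz; rewrite y0 addr0 (negbTE (key0 t td t0)).
    move: pz; rewrite key // ghE // hornerM mulf_eq0 => /orP[/eqP gz|/eqP hz].
      by left; apply/kg.
    by right; apply/kh.
  have [y0 fz] : y != 0 /\ (fm t).[t ^+ q / y] = 0.
    by case: H => [/kg|/kh] [y0 E]; split; rewrite // ghE // hornerM E ?mul0r ?mulr0.
  by apply/eqP; rewrite key // fz.
(* A root of the other factor is not a root of this one. *)
have witness (G H : C -> {poly C}) e e1 t : t != 0 -> cabs t < d' -> (0 < e1)%N ->
    (G t \is monic /\ size (G t) = e.+1) -> (H t \is monic /\ size (H t) = e1.+1) ->
    fm t = G t * H t -> (forall x, (G t).[x] = 0 -> (H t).[x] = 0 -> False) ->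
    exists2 z, (p t).[z] = 0 & k G e t z != 0.
  move=> t0 /d'P[td td2 td3 td4 td5] e10 [Gm Gs] [Hm Hs] fE nc.
  have [x /rootP Hx] : exists x, root (H t) x by apply/closed_rootP; rewrite Hs; case: (e1) e10.
  have fx : (fm t).[x] = 0 by rewrite fE hornerM Hx mulr0.
  have x0 : x != 0 by apply: contra_neq (fm0 t td t0) => x0; move: fx; rewrite x0.
  have s0 : t ^+ q != 0 by rewrite expf_neq0.
  have y0 : t ^+ q / x != 0 by rewrite mulf_neq0 ?invr_eq0.
  have xE : t ^+ q / (t ^+ q / x) = x by field; apply/andP.
  exists (c * t ^+ q + t ^+ q / x); first by apply/eqP; rewrite key // xE fx.
  by apply/eqP => /(kP _ _ _ _ Gm Gs t0) [_]; rewrite xE => /nc; apply.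
exists (k g m), (k h e'), d'; split=> //.
- by split; exact: kan.
- by split; exact: k00.
move=> t t0 td'; have [td td2 td3 td4 td5] := d'P t td'; have [gH hH] := ghm t td3.
split.
  apply: (witness g h m e') => //; first exact: ghE.
  by move=> x gx hx; exact: (nocommon t x).
apply: (witness h g e' m) => //; first by rewrite ghE // mulrC.
by move=> x hx gx; exact: (nocommon t x).
Qed.

End Splitting.

(** * Descent from the parameter of the arc to the ambient coordinates *)

Section Symmetrization.
Variable R : realType.
Local Notation C := (R[i]).

Lemma an_setfst N (k : 'cV[C]_N.+1 -> C) (w : C) : an k -> an (fun h => k (setfst h (w * h 0 0))).
Proof.
move=> ak; apply: (an_comp (g := fun h : 'cV[C]_N.+1 => setfst h (w * h 0 0)) ak) => [i|].
  under eq_fun => ? do rewrite mxE.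
  case: (i == 0); last exact: an_coord.
  by apply: anM; [exact: an_cst | exact: an_coord].
by apply/matrixP => i j; rewrite !mxE mulr0; case: ifP.
Qed.

Section Invariants.
Variables (N q : nat) (w : C) (k : 'cV[C]_N.+1 -> C).
Hypotheses (q0 : (0 < q)%N) (pw : q.-primitive_root w) (ak : an k).

Let kj (j : 'I_q) h := k (setfst h (w ^+ j * h 0 0)).

Let kjS j h : kj j (setfst h (w * h 0 0)) = kj (ordS j) h.
Proof.
rewrite /kj; congr k; apply/matrixP => i l; rewrite !mxE eqxx; case: eqP => // _.
by rewrite mulrA -exprSr /= (prim_expr_mod pw).
Qed.

(** Multiplying the first coordinate by [w] permutes the conjugates [kj] cyclically, so that their
    sum is invariant and descends. *)
Lemma an_trace : exists2 c, an c & forall h, \sum_(j < q) kj j h = c (setfst h (h 0 0 ^+ q)).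
Proof.
apply: (an_descend q0 pw) => [|h]; first by apply: an_sum => j _; exact: an_setfst.
rewrite [RHS](reindex_inj (bij_inj (@ordS_bij q))) /=.
by apply: eq_bigr => j _; rewrite kjS.
Qed.

Lemma an_norm : exists2 c, an c & forall h, \prod_(j < q) kj j h = c (setfst h (h 0 0 ^+ q)).
Proof.
apply: (an_descend q0 pw) => [|h]; first by apply: an_prod => j _; exact: an_setfst.
rewrite [RHS](reindex_inj (bij_inj (@ordS_bij q))) /=.
by apply: eq_bigr => j _; rewrite kjS.
Qed.

End Invariants.

Definition vec3 (x y z : C) : 'cV[C]_3 := \col_i [:: x; y; z]`_i.

Lemma setfst3 x x' y z : setfst (vec3 x y z) x' = vec3 x' y z.
Proof. by apply/matrixP => -[[|[|[|//]]] ip] j; rewrite !mxE. Qed.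

Lemma vec3_coord (h : 'cV[C]_3) : h = vec3 (h 0 0) (h 1 0) (h 2%:R 0).
Proof.
apply/matrixP => i j; rewrite ord1 mxE.
by case: i => -[|[|[|//]]] ip /=; congr (h _ _); exact: val_inj.
Qed.

Lemma an2v_02 (k : C -> C -> C) : an2v k -> an (fun h : 'cV[C]_3 => k (h 0 0) (h 2%:R 0)).
Proof.
move=> ak.
have := @an_comp _ _ _ _ (fun h : 'cV[C]_3 => \col_(i < 2) (if i == 0 then h 0 0 else h 2%:R 0)) ak.
rewrite (_ : _ \o _ = (fun h : 'cV[C]_3 => k (h 0 0) (h 2%:R 0))); last first.
  by apply/funext => h; rewrite /= !mxE.
apply; last by apply/matrixP => i j; rewrite !mxE; case: ifP.
by move=> i; under eq_fun => ? do rewrite mxE; case: (i == 0); exact: an_coord.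
Qed.

Variables (A : set 'cV[C]_2) (i0 i1 : 'I_2) (q : nat) (b : C -> C) (bq : C) (d B : R).
Hypothesis arcA : arc_normal_form A i0 i1 q b bq d B.

Let q0 : (0 < q)%N. Proof. by case: arcA => -[]. Qed.
Let d0 : 0 < d. Proof. by case: arcA => _ []. Qed.
Let ab : an1 b. Proof. by case: arcA => _ []. Qed.

Lemma arc_b0 : b 0 = 0.
Proof.
have [_ _ bB _ _] := arcA; have := bB 0; rewrite cabs0 => /(_ d0).
rewrite !expr0n /= gtn_eqF // !mulr0 subr0 => H; apply/eqP.
by rewrite -cabs_eq0 eq_le H cabs_ge0.
Qed.

Lemma an_arc_coord (h0 : C) : an (fun h : 'cV[C]_3 => b (h0 * h 0 0)).
Proof.
apply: an1_comp ab _ _; last by rewrite mxE mulr0.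
by apply: anM; [exact: an_cst | exact: an_coord].
Qed.

Lemma prod_close (I : Type) (r : seq I) (u : I -> C) (c : C) (Q s e : R) : 1 <= Q -> 0 <= s -> 0 <= e ->
  cabs c <= Q * s -> (forall j, cabs (u j) <= Q * s) -> (forall j, cabs (u j - c) <= e * s) ->
  cabs (\prod_(j <- r) u j - c ^+ size r) <= (size r)%:R * Q ^+ size r * e * s ^+ size r.
Proof.
move=> Q1 s0 e0 cQ uQ uc; have Q0 : 0 <= Q by exact: le_trans Q1.
elim: r => [|j r IH]; first by rewrite big_nil subrr cabs0 !mul0r.
rewrite big_cons /= !exprS.
have -> : u j * \prod_(j <- r) u j - c * c ^+ size r =
  u j * (\prod_(j <- r) u j - c ^+ size r) + (u j - c) * c ^+ size r by ring.
rewrite (le_trans (cabsD _ _)) // !cabsM cabsX.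
have cn : cabs c ^+ size r <= Q ^+ size r * s ^+ size r.
  by rewrite -exprMn lerXn2r ?nnegrE ?cabs_ge0 ?mulr_ge0.
have H1 := ler_pM (cabs_ge0 _) (cabs_ge0 _) (uQ j) IH.
have H2 := ler_pM (cabs_ge0 _) (exprn_ge0 _ (cabs_ge0 _)) (uc j) cn.
rewrite (le_trans (lerD H1 H2)) // -[(size r).+1%:R]natr1.
set k := (size r)%:R; set a := Q ^+ size r; set t := s ^+ size r.
have a0 : 0 <= a by exact: exprn_ge0.
have t0 : 0 <= t by exact: exprn_ge0.
have : 0 <= (Q - 1) * (a * t * e * s) by rewrite !mulr_ge0 // subr_ge0.
lra.
Qed.

(** The equation is the norm of [y - b t], that is the product of the [y - b (w ^+ j * t)]. All its
    factors are close to [y - bq * x], so that its leading form is the [q]-th power of the tangent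
    line; [l] is left free in order to absorb the nonlinear part of a change of coordinates. *)
Lemma arc_equation : exists g : 'cV[C]_3 -> C, [/\ an g,
  forall x y z, g (vec3 x y z) = 0 <-> exists t, t ^+ q = x /\ y = b t &
  forall e : R, 0 < e -> exists2 r, 0 < r & forall (s : R) x y z l, s <= r ->
    cabs x <= s -> cabs y <= s -> cabs (y - bq * x - l) <= r * s ->
    cabs (g (vec3 x y z) - l ^+ q) <= e * s ^+ q].
Proof.
have [w pw] := prim_root_complex R q0.
pose k (h : 'cV[C]_3) := h 1 0 - b (1 * h 0 0).
have ak : an k by apply: anB; [exact: an_coord | exact: an_arc_coord].
have [c ac cE] := an_norm q0 pw ak; exists c => //.
have gE t y z : c (vec3 (t ^+ q) y z) = \prod_(j < q) (y - b (w ^+ j * t)).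
  have := cE (vec3 t y z); rewrite !setfst3 mxE /= => <-.
  by apply: eq_bigr => j _; rewrite setfst3 /k !mxE /= mul1r.
have wjq j t : (w ^+ j * t) ^+ q = t ^+ q.
  by rewrite exprMn -exprM mulnC exprM (prim_expr_order pw) expr1n mul1r.
split=> // [x y z|e e0].
  split=> [|[t [<- ->]]]; last first.
    by rewrite gE (bigD1 (Ordinal q0)) //= expr0 mul1r subrr mul0r.
  have xE : (q.-root x) ^+ q = x by rewrite rootCK.
  have := gE (q.-root x) y z; rewrite xE => -> /eqP; rewrite prodf_seq_eq0 => /hasP[j _ /=].
  by rewrite subr_eq0 => /eqP ->; exists (w ^+ j * q.-root x); rewrite wjq.
have w1 : cabs w = 1 by apply: (cabs_unity q0); exact: prim_expr_order.
have [_ _ bB _ _] := arcA.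
pose Q := 2 + cabs bq; have Q1 : 1 <= Q by have := cabs_ge0 bq; rewrite /Q; lra.
have Q0 : 0 < Q by exact: lt_le_trans Q1.
have qQ0 : 0 < q%:R * Q ^+ q by rewrite mulr_gt0 ?ltr0n // exprn_gt0.
pose e2 := Num.min 1 (e / (q%:R * Q ^+ q)).
have e20 : 0 < e2 by rewrite lt_min ltr01 divr_gt0.
have e21 : e2 <= 1 by rewrite ge_min lexx.
have e2e : q%:R * Q ^+ q * e2 <= e by rewrite mulrC -ler_pdivlMr // ge_min lexx orbT.
pose e1 := e2 / 2; have e12 : 2 * e1 = e2 by rewrite /e1; field.
have e10 : 0 < e1 by rewrite divr_gt0.
clearbody e1 e2.
pose m := Num.min d (e1 / (1 + `|B|)); have m0 : 0 < m by rewrite lt_min d0 divr_gt0 // ltr_pwDl.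
(* The parameter is a [q]-th root of [x], so that the bound [m] on it becomes a [q]-th power. *)
exists (Num.min e1 ((m / 2) ^+ q)); first by rewrite lt_min e10 exprn_gt0 // divr_gt0.
move=> s x y z l + xs ys; rewrite le_min => /andP[_ sr] yl; pose t := q.-root x.
have s0 : 0 <= s by exact: le_trans (cabs_ge0 _) xs.
have xE : t ^+ q = x by rewrite rootCK.
have tm : cabs t < m.
  apply: rootC_lt => //; rewrite (le_lt_trans xs) // (le_lt_trans sr) //.
  by rewrite ltr_pXn2r ?nnegrE ?divr_ge0 ?(ltW m0) //; lra.
rewrite -xE gE.
have key j : cabs ((y - b (w ^+ j * t)) - (y - bq * t ^+ q)) <= e1 * s.
  have -> : (y - b (w ^+ j * t)) - (y - bq * t ^+ q) = - (b (w ^+ j * t) - bq * (w ^+ j * t) ^+ q).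
    by rewrite wjq; ring.
  have wt : cabs (w ^+ j * t) = cabs t by rewrite cabsM cabsX w1 expr1n mul1r.
  have td : cabs (w ^+ j * t) < d by rewrite wt; move: tm; rewrite lt_min => /andP[].
  rewrite cabsN; apply: le_trans (bB _ td) _; rewrite wt.
  have tB : `|B| * cabs t <= e1.
    have B1 : 0 < 1 + `|B| by rewrite ltr_pwDl.
    rewrite (@le_trans _ _ ((1 + `|B|) * cabs t)) ?ler_wpM2r ?cabs_ge0 ?lerDr //.
    rewrite mulrC -ler_pdivlMr // ltW // (lt_le_trans tm) // ge_min lexx orbT //.
  rewrite (@le_trans _ _ (`|B| * cabs t ^+ q.+1)) ?ler_wpM2r ?exprn_ge0 ?cabs_ge0 ?ler_norm //.
  rewrite exprSr -cabsX xE mulrCA mulrC.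
  by apply: ler_pM; rewrite ?mulr_ge0 ?cabs_ge0.
have {}yl : cabs (y - bq * x - l) <= e1 * s.
  by rewrite (le_trans yl) // ler_wpM2r // ge_min lexx.
rewrite xE in key.
have key2 j : cabs (y - b (w ^+ j * t) - l) <= 2 * e1 * s.
  rewrite (le_trans (cabs_tri _ (y - bq * x) _)) // -[2 * e1 * s]mulrA mulr_natl mulr2n.
  by rewrite lerD.
have cQ : cabs (y - bq * x) <= (1 + cabs bq) * s.
  by rewrite (le_trans (cabsB _ _)) // mulrDl mul1r lerD // cabsM ler_wpM2l ?cabs_ge0.
have es : 2 * e1 * s <= s by rewrite e12 ler_piMl.
have H1 : cabs l <= Q * s.
  rewrite -[l](subKr (y - bq * x)) (le_trans (cabsB _ _)) //.
  by have := cabs_ge0 bq; rewrite /Q; lra.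
have H2 j : cabs (y - b (w ^+ j * t)) <= Q * s.
  rewrite -[_ - b _](subrK (y - bq * x)) (le_trans (cabsD _ _)) //.
  by have := key j; rewrite /Q; lra.
have -> : \prod_(j < q) (y - b (w ^+ j * t)) = \prod_(j <- enum 'I_q) (y - b (w ^+ j * t)).
  by rewrite big_enum.
have e2ge : 0 <= 2 * e1 by rewrite e12 ltW.
have := prod_close (enum 'I_q) Q1 s0 e2ge H1 (fun j : 'I_q => H2 j) (fun j : 'I_q => key2 j).
rewrite size_enum_ord => /le_trans; apply.
by rewrite e12 ler_wpM2r ?exprn_ge0.
Qed.

(** [arc_interpolation] cannot recover the fiber over the origin, where all the branches of the arc
    coincide; the norm of [k] is a power of [k 0 z] there. *)
Lemma arc_norm (k : C -> C -> C) : an2v k -> exists2 g : 'cV[C]_3 -> C, an g &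
  (forall t y z, k t z = 0 -> g (vec3 (t ^+ q) y z) = 0) /\
  (forall y z, g (vec3 0 y z) = 0 -> k 0 z = 0).
Proof.
move=> ak; have [w pw] := prim_root_complex R q0.
pose k' (h : 'cV[C]_3) := k (h 0 0) (h 2%:R 0).
have ak' : an k' by exact: an2v_02.
have [c ac cE] := an_norm q0 pw ak'; exists c => //.
have gE t y z : c (vec3 (t ^+ q) y z) = \prod_(j < q) k (w ^+ j * t) z.
  have := cE (vec3 t y z); rewrite !setfst3 mxE /= => <-.
  by apply: eq_bigr => j _; rewrite setfst3 /k' !mxE.
split=> [t y z kt|y z].
  by rewrite gE (bigD1 (Ordinal q0)) //= expr0 mul1r kt mul0r.
have := gE 0 y z; rewrite expr0n gtn_eqF // => -> /eqP.
by rewrite prodf_seq_eq0 => /hasP[j _ /=]; rewrite mulr0 => /eqP.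
Qed.

(* Lagrange interpolation in [y] at the branches [b (w ^+ j * t)]. *)
Lemma arc_interpolation (k : C -> C -> C) : an2v k -> exists2 f : 'cV[C]_3 -> C, an f &
  (forall t z, t != 0 -> cabs t < d -> f (vec3 (t ^+ q) (b t) z) = 0 <-> k t z = 0) /\
  (k 0 0 = 0 -> f (vec3 0 0 0) = 0).
Proof.
move=> ak; have [w pw] := prim_root_complex R q0.
pose k' (h : 'cV[C]_3) := k (h 0 0) (h 2%:R 0) *
  \prod_(l < q | l != Ordinal q0) (h 1 0 - b (w ^+ l * h 0 0)).
have ak' : an k'.
  apply: anM; first exact: an2v_02.
  by apply: an_prod => l _; apply: anB; [exact: an_coord | exact: an_arc_coord].
have [c ac cE] := an_trace q0 pw ak'; exists c => //.
have gE t y z : c (vec3 (t ^+ q) y z) = \sum_(j < q) k (w ^+ j * t) z *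
    \prod_(l < q | l != Ordinal q0) (y - b (w ^+ l * (w ^+ j * t))).
  have := cE (vec3 t y z); rewrite !setfst3 mxE /= => <-.
  by apply: eq_bigr => j _; rewrite setfst3 /k' !mxE.
split=> [t z t0 td|k0]; last first.
  have := gE 0 0 0; rewrite expr0n gtn_eqF // => ->.
  by rewrite big1 // => j _; rewrite mulr0 k0 mul0r.
(* On the branch [y = b t] the summand [j] with [0 < j] vanishes through its factor [l = q - j],
   because [w ^+ (q - j) * w ^+ j = 1]. The product that remains for [j = 0] is nonzero by the
   injectivity of the parametrization. *)
rewrite gE (bigD1 (Ordinal q0)) //= expr0 mul1r [X in _ + X]big1 ?addr0; last first.
  move=> j j0; have jq : (0 < j)%N.
    by rewrite lt0n; apply: contra j0 => /eqP j0; apply/eqP/val_inj.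
  have qj : (q - j < q)%N by rewrite ltn_subrL jq.
  rewrite (bigD1 (Ordinal qj)) /=; last by rewrite -val_eqE /= -lt0n subn_gt0.
  by rewrite mulrA -exprD subnK ?(ltnW (ltn_ord j)) // (prim_expr_order pw) mul1r subrr mul0r mulr0.
have Dn0 : \prod_(l < q | l != Ordinal q0) (b t - b (w ^+ l * t)) != 0.
  rewrite prodf_seq_neq0; apply/allP => l _; apply/implyP => l0.
  rewrite subr_eq0 eq_sym; apply/eqP => E.
  have [_ _ _ inj _] := arcA.
  have zq : (w ^+ l) ^+ q = 1 by rewrite -exprM mulnC exprM (prim_expr_order pw) expr1n.
  have /eqP := inj t _ td t0 zq E; rewrite -(prim_order_dvd pw) => /dvdn_leq.
  have l00 : (0 < l)%N by rewrite lt0n; apply: contra l0 => /eqP l0; apply/eqP/val_inj.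
  by move=> /(_ l00); rewrite leqNgt ltn_ord.
split=> [/eqP|->]; last by rewrite mul0r.
by rewrite mulf_eq0 (negbTE Dn0) orbF => /eqP.
Qed.

End Symmetrization.

(** * Reducibility of a section with several tangent directions *)

Section SectionReducible.
Variable R : realType.
Local Notation C := (R[i]).
Local Notation K := (Num.NumField.sort (R[i] : numFieldType)).

Lemma pdisc_mulmx m n (M : 'M[C]_(m, n)) (rho : R) : 0 < rho ->
  exists2 rho', 0 < rho' & forall v : 'cV[C]_n, pdisc rho' v -> pdisc rho (M *m v).
Proof.
move=> rho0.
have [i s s' s'0 ss Hs v vs|i|s s0 Hs] := @fin_radius R 'I_m (fun i s =>
   forall v : 'cV[C]_n, pdisc s v -> cabs ((M *m v) i 0) < rho).
- by apply: Hs; exact: pdisc_le vs.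
- pose T := 1 + \sum_j cabs (M i j).
  have T0 : 0 < T by rewrite ltr_pwDl // sumr_ge0 // => j _; exact: cabs_ge0.
  exists (rho / T); first by rewrite divr_gt0.
  move=> v vs; rewrite mxE (le_lt_trans (cabs_sum _ _ _)) //.
  rewrite (@le_lt_trans _ _ (\sum_j cabs (M i j) * (rho / T))) //.
    by apply: ler_sum => j _; rewrite cabsM ler_wpM2l ?cabs_ge0 // ltW.
  by rewrite -mulr_suml mulrCA gtr_pMr // ltr_pdivrMr // mul1r /T ltrDr.
by exists s => // v vs i; exact: Hs.
Qed.

Lemma an_mulmx m n (M : 'M[C]_(m, n)) i : an (fun v : 'cV[C]_n => (M *m v) i 0).
Proof.
apply: an_polyfun; under eq_fun => ? do rewrite mxE.
by apply: polyfun_sum => j _; apply: polyfunM; [exact: polyfun_cst | exact: polyfun_coord].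
Qed.

(** On the bounded set that contains the roots, [(p t).[z]] is uniformly close to [z ^ n]. *)
Lemma weierstrass_roots_small (p : C -> {poly C}) n (r e : R) : 0 < r -> (0 < n)%N -> an_poly p ->
  (forall t, cabs t < r -> p t \is monic /\ size (p t) = n.+1) -> p 0 = 'X^n -> 0 < e ->
  exists2 d, 0 < d & forall t z, cabs t < d -> (p t).[z] = 0 -> cabs z < e.
Proof.
move=> r0 n0 ap pm p0 e0.
have [i s s' s'0 ss Hs t ts|i|d2 d20 Hd2] := @fin_radius R 'I_n (fun i s =>
   forall t, cabs t < s -> cabs ((p t)`_i - (p 0)`_i) <= 1).
- by apply: Hs; exact: lt_le_trans ts ss.
- exact: an1_cont0.
have V0 : 0 < 1 + n%:R * 1 :> R by rewrite mulr1 addrC natr1 ltr0n.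
have en : 0 < (e / 2) ^+ n by rewrite exprn_gt0 // divr_gt0.
have sp t : cabs t < r -> (size (p t) <= n.+1)%N by move=> /pm[_ ->].
have [d3 d30 Hd3] := poly_close ap r0 sp V0 en.
exists (Num.min r (Num.min d2 d3)); first by rewrite !lt_min r0 d20.
move=> t z; rewrite !lt_min => /and3P[tr td2 td3] pz.
have [mm ss] := pm t tr.
have zV : cabs z <= 1 + n%:R * 1.
  apply: (cauchy_root_bound ler01 mm ss _ pz) => i i_n.
  have := Hd2 (Ordinal i_n) t td2; rewrite p0 coefXn /= (ltn_eqF i_n) subr0 //.
have := Hd3 t z td3 zV; rewrite pz p0 hornerXn sub0r cabsN cabsX.
rewrite ler_pXn2r ?nnegrE ?cabs_ge0 ?divr_ge0 ?(ltW e0) //; lra.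
Qed.

Lemma analytic_germ_ex N (A : set 'cV[C]_N) (l : seq ('cV[C]_N -> C)) :
  (forall f, List.In f l -> an f) -> (forall v, A v <-> forall f, List.In f l -> f v = 0) ->
  @analytic_germ (R[i] : numFieldType) N A.
Proof.
move=> al Al; exists (size l), (fun i => nth (fun=> 0) l i); split.
  move=> i; apply/analytic_approx; apply: al.
  elim: l {Al} i => [[]//|f l IH] [[|i] il] /=; first by left.
  by right; exact: (IH (Ordinal (il : (i < size l)%N))).
apply/near0P; exists 1 => // v _; rewrite Al /=; split=> H.
  move=> i; apply: H; elim: l {Al al} i => [[]//|f l IH] [[|i] il] /=; first by left.
  by right; exact: (IH (Ordinal (il : (i < size l)%N))).
move=> f fl; have [i [il <-]] : exists i, (i < size l)%N /\ nth (fun=> 0) l i = f.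
  elim: l {Al al H} fl => //= g l IH [<-|/IH[i [il fi]]]; first by exists 0%N.
  by exists i.+1.
exact: (H (Ordinal il)).
Qed.

Variables (A : set 'cV[C]_2) (i0 i1 : 'I_2) (q : nat) (b : C -> C) (bq : C) (d B : R).
Hypothesis arcA : arc_normal_form A i0 i1 q b bq d B.

Definition arc_point (t : C) : 'cV[C]_2 := \col_i (if i == i0 then t ^+ q else b t).

Lemma arc_pointP (x : 'cV[C]_2) t : x = arc_point t <-> x i0 0 = t ^+ q /\ x i1 0 = b t.
Proof.
have [[i10 _] _ _ _ _] := arcA.
split=> [->|[x0 x1]]; first by rewrite !mxE eqxx (negbTE i10).
apply/matrixP => i j; rewrite ord1 mxE.
have : (i == i0) || (i == i1).
  by move: i10; case: (i) (i0) (i1) => -[|[|//]] ? [[|[|//]] ?] [[|[|//]] ?].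
by case/orP => /eqP->; rewrite ?eqxx ?(negbTE i10).
Qed.

Lemma an_arc_point (f : 'cV[C]_2 -> C) : an f -> an1 (fun t => f (arc_point t)).
Proof.
have [[_ q0] [_ ab] _ _ _] := arcA.
move=> af; apply: (an_comp (g := fun h : 'cV[C]_1 => arc_point (h 0 0)) af).
  move=> i; under eq_fun => ? do rewrite mxE.
  by case: (i == i0); [apply: anX; exact: an_coord | exact: ab].
apply/matrixP => i j; rewrite !mxE; case: ifP => _; first by rewrite expr0n gtn_eqF.
exact: arc_b0 arcA.
Qed.

Variables (L : 'M[C]_(2 + 1)) (P : 'cV[C]_2 -> {poly C}) (n : nat) (S : set 'cV[C]_(2 + 1)).
Hypotheses (Lu : L \in unitmx) (n0 : (0 < n)%N) (aP : forall i, an (fun x => (P x)`_i)).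
Hypothesis Pm : exists2 r, 0 < r & forall x, pdisc r x -> P x \is monic /\ size (P x) = n.+1.
Hypothesis P0 : P 0 = 'X^n.
Let xx (v : 'cV[C]_(2 + 1)) : 'cV[C]_2 := usubmx (L *m v).
Let zz (v : 'cV[C]_(2 + 1)) : C := dsubmx (L *m v) 0 0.
Hypothesis SP : exists2 r, 0 < r & forall v, pdisc r v -> S v <-> A (xx v) /\ (P (xx v)).[zz v] = 0.
Let p (t : C) := P (arc_point t).

Lemma arc_point0 : arc_point 0 = 0.
Proof.
have [[_ q0] _ _ _ _] := arcA.
apply/matrixP => i j; rewrite !mxE; case: ifP => _; first by rewrite expr0n gtn_eqF.
exact: arc_b0 arcA.
Qed.

Lemma arc_point_small (r : R) : 0 < r -> exists2 d', 0 < d' & forall t, cabs t < d' -> pdisc r (arc_point t).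
Proof.
move=> r0; have r20 : 0 < r / 2 by rewrite divr_gt0.
have [i s s' s'0 ss Hs t ts|i|s s0 Hs] := @fin_radius R 'I_2 (fun i s =>
   forall t, cabs t < s -> cabs (arc_point t i 0) < r).
- by apply: Hs; exact: lt_le_trans ts ss.
- have [s s0 Hs] := an1_cont0 (an_arc_point (@an_coord R 2 i)) r20.
  by exists s => // t /Hs; rewrite arc_point0 [X in _ - X]mxE subr0; lra.
by exists s => // t ts i; exact: Hs.
Qed.

(** Near the origin the section is given by [E]: [g] puts the point over the arc, the interpolation
    [f0] is the Weierstrass equation for [t != 0], and the norm [g0] takes over at [t = 0]. The
    interpolations [f1] and [f2] of the factors in [splits] cut out the two pieces. *)
Lemma section_reducible : @reducible_germ (R[i] : numFieldType) (2 + 1) S \/ single_tangent p q.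
Proof.
have [[i10 q0] [d0 ab] _ _ Aloc] := arcA.
have ap : an_poly p by move=> i; exact: (an_arc_point (aP i)).
have [r r0 pm] : exists2 r, 0 < r & forall t, cabs t < r -> p t \is monic /\ size (p t) = n.+1.
  have [r r0 Hr] := Pm; have [r' r'0 Hr'] := arc_point_small r0.
  by exists r' => // t /Hr'/Hr.
have p0 : p 0 = 'X^n by rewrite /p arc_point0.
case: (splits_or_single r0 q0 n0 ap pm) => [|st]; last by right.
move=> [k1 [k2 [ds [ds0 [ak1 ak2] [k10 k20] kE kw]]]]; left.
pose k0 t z := (p t).[z].
have ak0 : an2v k0.
  pose k0' (h : 'cV[C]_2) := \sum_(i < n.+1) (p (h 0 0))`_i * h 1 0 ^+ i.
  apply: (@an_near _ _ k0' _ r r0).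
    by move=> h /(_ 0) hr; rewrite /k0 horner_coef; have [_ ->] := pm _ hr.
  apply: an_sum => i _; apply: anM; last by apply: anX; exact: an_coord.
  by apply: (an1_comp (u := fun t => (p t)`_i)) => //; [exact: an_coord | rewrite mxE].
have [g [ag gE _]] := arc_equation arcA.
have [g0 ag0 [g01 g02]] := arc_norm arcA ak0.
have [f0 af0 [f01 f02]] := arc_interpolation arcA ak0.
have [f1 af1 [f11 f12]] := arc_interpolation arcA ak1.
have [f2 af2 [f21 f22]] := arc_interpolation arcA ak2.
pose X v := vec3 (xx v i0 0) (xx v i1 0) (zz v).
have xx0 i : xx 0 i 0 = 0 by rewrite /xx mulmx0 !mxE.
have zz0 : zz 0 = 0 by rewrite /zz mulmx0 !mxE.
have axx i : an (fun v => xx v i 0).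
  by rewrite /xx; under eq_fun => ? do rewrite mxE; exact: an_mulmx.
have azz : an zz by rewrite /zz; under eq_fun => ? do rewrite mxE; exact: an_mulmx.
have aX f : an f -> an (fun v => f (X v)).
  move=> af; apply: (an_comp (g := X) af); last first.
    by apply/matrixP => -[[|[|[|//]]] ip] j; rewrite [RHS]mxE mxE /= ?xx0 ?zz0.
  by move=> -[[|[|[|//]]] ip]; under eq_fun => ? do rewrite mxE /=.
have k00 : k0 0 0 = 0 by rewrite /k0 p0 hornerXn expr0n gtn_eqF.
pose d' := Num.min d ds; have d'0 : 0 < d' by rewrite lt_min d0.
have d'd : d' <= d by rewrite ge_min lexx.
have d'ds : d' <= ds by rewrite ge_min lexx orbT.
clearbody d'.
have [r1 r10 Hr1] := Aloc d' d'0 d'd; have [r2 r20 Hr2] := SP.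
pose r3 := Num.min r1 (d' ^+ q); have r30 : 0 < r3 by rewrite lt_min r10 exprn_gt0.
have [r4 r40 Hr4] := pdisc_mulmx L r30.
pose rho := Num.min r2 r4; have rho0 : 0 < rho by rewrite lt_min r20.
have rhoS v : pdisc rho v -> S v <-> A (xx v) /\ k0 0 0 = 0 /\ (P (xx v)).[zz v] = 0.
  move=> vr; rewrite Hr2 ?k00; last by apply: pdisc_le vr; rewrite ge_min lexx.
  by split=> [[? ?]|[? [_ ?]]].
have rhox v : pdisc rho v -> pdisc r3 (xx v).
  move=> vr i; rewrite mxE; apply: Hr4; apply: pdisc_le vr; by rewrite ge_min lexx orbT.
clearbody rho.
have small v t : pdisc rho v -> xx v i0 0 = t ^+ q -> cabs t < d'.
  move=> /rhox/(_ i0) + xE; rewrite xE lt_min cabsX => /andP[_].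
  by rewrite ltr_pXn2r ?nnegrE ?cabs_ge0 ?(ltW d'0).
have Sin v t : pdisc rho v -> xx v = arc_point t -> k0 t (zz v) = 0 -> S v.
  move=> vr xE kt; apply/rhoS => //; split; last by rewrite xE.
  have [x0 x1] := (arc_pointP _ _).1 xE.
  apply/Hr1; last by exists t; split=> //; exact: small x0.
  by apply: pdisc_le (rhox v vr); rewrite ge_min lexx.
have Sout v : pdisc rho v -> S v -> exists t, [/\ cabs t < d', xx v = arc_point t & k0 t (zz v) = 0].
  move=> vr /rhoS -/(_ vr) [Av [_ Pv]].
  have /Hr1[+ _] : pdisc r1 (xx v) by apply: pdisc_le (rhox v vr); rewrite ge_min lexx.
  move=> /(_ Av)[t [td x0 x1]]; have xE : xx v = arc_point t by apply/arc_pointP.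
  by exists t; split=> //; rewrite /k0 /p -xE.
have XE v t : xx v = arc_point t -> X v = vec3 (t ^+ q) (b t) (zz v).
  by move=> /arc_pointP[x0 x1]; rewrite /X x0 x1.
have z0 z : k0 0 z = 0 -> z = 0.
  by rewrite /k0 p0 hornerXn => /eqP; rewrite expf_eq0 n0 => /eqP.
pose E v := [/\ g (X v) = 0, g0 (X v) = 0 & f0 (X v) = 0].
have X0 v t : xx v = arc_point t -> t = 0 -> k0 t (zz v) = 0 -> X v = vec3 0 0 0.
  move=> xE t0 kt; rewrite (XE v t xE) t0 expr0n gtn_eqF // (arc_b0 arcA).
  by rewrite (z0 (zz v)) //; rewrite t0 in kt.
have SE v : pdisc rho v -> S v <-> E v.
  move=> vr; split=> [/(Sout v vr)[t [td xE kt]]|[gv g0v f0v]].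
    split.
    - by rewrite (XE v t xE); apply/gE; exists t.
    - by rewrite (XE v t xE) g01.
    have [t0|t0] := eqVneq t 0; first by rewrite (X0 v t) // f02.
    by rewrite (XE v t xE); apply/f01 => //; exact: lt_le_trans td d'd.
  have [t [x0 x1]] := (gE _ _ _).1 gv.
  have xE : xx v = arc_point t by apply/arc_pointP; rewrite x0 x1.
  apply: (Sin v t) => //.
  have td : cabs t < d' by apply: small vr _; rewrite x0.
  have [t0|t0] := eqVneq t 0.
    move: g0v; rewrite (XE v t xE) t0 expr0n gtn_eqF //; exact: g02.
  by move: f0v; rewrite (XE v t xE) => /f01; apply=> //; exact: lt_le_trans td d'd.
have germE f : an f -> @analytic_germ (R[i] : numFieldType) (2 + 1) [set v | E v /\ f (X v) = 0].
  move=> af; apply: (@analytic_germ_ex _ _ [:: (fun v => g (X v)); (fun v => g0 (X v));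
     (fun v => f0 (X v)); (fun v => f (X v))]).
    by move=> h [<-|[<-|[<-|[<-|[]]]]]; exact: aX.
  move=> v; split=> [[[? ? ?] ?] h [<-|[<-|[<-|[<-|[]]]]]|H] //.
  have H' h i : nth (fun=> 0) [:: (fun v => g (X v)); (fun v => g0 (X v));
     (fun v => f0 (X v)); (fun v => f (X v))] i = h -> (i < 4)%N -> h v = 0.
    by move=> <- i4; apply: H; case: i i4 => [|[|[|[|//]]]] _ /=; tauto.
  split; [split|].
  - exact: (H' (fun v => g (X v)) 0%N).
  - exact: (H' (fun v => g0 (X v)) 1%N).
  - exact: (H' (fun v => f0 (X v)) 2%N).
  - exact: (H' (fun v => f (X v)) 3%N).
(* Over a small [t != 0] some root of [p t] is not a zero of [k]. As the roots tend to [0] with [t],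
   this gives points of [S] outside the piece in every neighborhood of the origin. *)
have notsub (k : C -> C -> C) f :
    (forall t z, t != 0 -> cabs t < d -> f (vec3 (t ^+ q) (b t) z) = 0 <-> k t z = 0) ->
    (forall t, t != 0 -> cabs t < ds -> exists2 z, (p t).[z] = 0 & k t z != 0) ->
    ~ @germ_eq (R[i] : numFieldType) (2 + 1) S [set v | E v /\ f (X v) = 0].
  move=> fk kz /near0P[r5 r50 Hr5].
  pose r6 := Num.min rho r5; have r60 : 0 < r6 by rewrite lt_min rho0.
  have [r7 r70 Hr7] := pdisc_mulmx (invmx L) r60.
  have [d5 d50 Hd5] := weierstrass_roots_small r0 n0 ap pm p0 r70.
  have [d6 d60 Hd6] := arc_point_small r70.
  pose m := Num.min (Num.min d' d5) d6; have m0 : 0 < m by rewrite !lt_min d'0 d50.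
  pose t : C := (m / 2)%:C%C; have tE : cabs t = m / 2 by rewrite cabs_real gtr0_norm ?divr_gt0.
  have tm : cabs t < m by rewrite tE; lra.
  have t0 : t != 0 by rewrite -cabs_gt0 tE divr_gt0.
  move: tm; rewrite lt_min => /andP[]; rewrite lt_min => /andP[td' td5] td6.
  have [z pz kz0] := kz t t0 (lt_le_trans td' d'ds).
  pose v := invmx L *m col_mx (arc_point t) (const_mx z : 'cV_1).
  have Lv : L *m v = col_mx (arc_point t) (const_mx z) by rewrite /v mulKVmx.
  have xv : xx v = arc_point t by rewrite /xx Lv col_mxKu.
  have zv : zz v = z by rewrite /zz Lv col_mxKd mxE.
  have vr6 : pdisc r6 v.
    apply: Hr7 => i; rewrite mxE; case: splitP => j _; first exact: Hd6.
    by rewrite mxE; exact: (Hd5 t).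
  have vrho : pdisc rho v by apply: pdisc_le vr6; rewrite ge_min lexx.
  have Sv : S v by apply: (Sin v t) => //; rewrite zv.
  have [_] : E v /\ f (X v) = 0 by apply/Hr5 => //; apply: pdisc_le vr6; rewrite ge_min lexx orbT.
  rewrite (XE v t xv) zv => /fk -/(_ t0 (lt_le_trans td' d'd)) kt.
  by move: kz0; rewrite kt eqxx.
exists [set v | E v /\ f1 (X v) = 0], [set v | E v /\ f2 (X v) = 0]; split.
- exact: germE.
- exact: germE.
- apply/near0P; exists rho => // v vr; split=> [Sv|[[Ev _]|[Ev _]]]; try exact/SE.
  have Ev : E v by exact/SE.
  have [t [td xE kt]] := Sout v vr Sv.
  have [t0|t0] := eqVneq t 0; first by left; split=> //; rewrite (X0 v t) // f12.
  have [tds td''] := (lt_le_trans td d'ds, lt_le_trans td d'd).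
  have /(kE t _ t0 tds)[k1z|k2z] := kt.
    by left; split=> //; rewrite (XE v t xE); apply/f11.
  by right; split=> //; rewrite (XE v t xE); apply/f21.
- by apply: notsub f11 _ => t t0 /(kw t t0)[].
- by apply: notsub f21 _ => t t0 /(kw t t0)[].
Qed.

End SectionReducible.

(** * Tangent directions of a section *)

Section CurveZeros.
Variable R : realType.
Local Notation C := (R[i]).

Definition poly_curve N (Q : 'I_N -> {poly C}) (x : C) : 'cV[C]_N := \col_i (Q i).[x].

Lemma polyfun_curve N (p : 'cV[C]_N -> C) (Q : 'I_N -> {poly C}) : polyfun p ->
  exists P : {poly C}, forall x, p (poly_curve Q x) = P.[x].
Proof.
elim=> [c|i|f g _ [F Hf] _ [G Hg]|f g _ [F Hf] _ [G Hg]].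
- by exists c%:P => x; rewrite hornerC.
- by exists (Q i) => x; rewrite mxE.
- by exists (F + G) => x; rewrite hornerD Hf Hg.
- by exists (F * G) => x; rewrite hornerM Hf Hg.
Qed.

Lemma poly_circle_bound (h : {poly C}) (rho : R) : h != 0 -> 0 < rho ->
  exists r m : R, [/\ 0 < r, r <= rho, 0 < m & forall x, cabs x = r -> m <= cabs h.[x]].
Proof.
move=> h0 rho0; have [s Dh] := closed_field_poly_normal h.
have [r0 [r00 r0rho Hr]] : exists r0 : R, [/\ 0 < r0, r0 <= rho & forall r, 0 < r -> r <= r0 ->
   exists2 m : R, 0 < m & forall x, cabs x = r -> m <= \prod_(z <- s) cabs (x - z)].
  elim: s {Dh} => [|z s [r0 [r00 r0rho IH]]].
    by exists rho; split=> // r _ _; exists 1 => // x _; rewrite big_nil.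
  have [->|z0] := eqVneq z 0.
    exists r0; split=> // r r_gt0 rr; have [m m0 Hm] := IH r r_gt0 rr.
    exists (r * m); first exact: mulr_gt0.
    move=> x xr; rewrite big_cons subr0 xr ler_wpM2l ?(ltW r_gt0) //; exact: Hm.
  have z2 : 0 < cabs z / 2 by rewrite divr_gt0 // cabs_gt0.
  exists (Num.min r0 (cabs z / 2)); split; rewrite ?lt_min ?r00 ?ge_min ?r0rho //.
  move=> r r_gt0; rewrite le_min => /andP[rr rz]; have [m m0 Hm] := IH r r_gt0 rr.
  exists (cabs z / 2 * m); first exact: mulr_gt0.
  move=> x xr; rewrite big_cons; apply: ler_pM; rewrite ?(ltW z2) ?(ltW m0) //; last exact: Hm.
  by have := cabs_subr z x; rewrite cabs_distC xr; lra.
have [m m0 Hm] := Hr r0 r00 (lexx _).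
exists r0, (cabs (lead_coef h) * m); split=> //.
  by rewrite mulr_gt0 // cabs_gt0 lead_coef_eq0.
move=> x /Hm H; rewrite {2}Dh hornerZ cabsM ler_wpM2l ?cabs_ge0 // horner_prod cabs_prod.
by under eq_bigr do rewrite hornerXsubC.
Qed.

Lemma poly_curve_bounded N (Q : 'I_N -> {poly C}) (r : R) :
  exists2 K : R, 1 <= K & forall x i, cabs x <= r -> cabs (poly_curve Q x i 0) <= K.
Proof.
have [i|K HK] := @choice 'I_N R (fun i K => 0 < K /\ forall x, cabs x <= r -> cabs (Q i).[x] <= K).
  have [K K0 HK] := polyfun_bounded (r + 1) (polyfun_horner (Q i) (polyfun_coord R (ord0 : 'I_1))).
  exists K; split=> // x xr; have := HK (const_mx x); rewrite mxE; apply=> k.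
  by rewrite mxE; lra.
exists (1 + \sum_i K i); first by rewrite lerDl sumr_ge0 // => i _; rewrite ltW //; case: (HK i).
move=> x i xr; rewrite mxE; have [Ki /(_ x xr)/le_trans] := HK i; apply.
rewrite (bigD1 i) //= addrCA lerDl addr_ge0 // sumr_ge0 // => j _; rewrite ltW //; by case: (HK j).
Qed.

(** As [mu] tends to [0], [G (mu *: poly_curve Q x) / mu ^ q] tends, uniformly in [x], to the [q]-th
    power of a nonzero polynomial vanishing at [x = 0]; Hurwitz' theorem applies on a circle that
    avoids its zeros. *)
Lemma curve_zeros N (G : 'cV[C]_N -> C) (ell : 'rV[C]_N) q (Q : 'I_N -> {poly C}) (rho d : R) :
  (0 < q)%N -> an G ->
  (forall e : R, 0 < e -> exists2 r, 0 < r & forall (s : R) (h : 'cV[C]_N), s <= r ->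
     (forall i, cabs (h i 0) <= s) -> cabs (G h - (ell *m h) 0 0 ^+ q) <= e * s ^+ q) ->
  (ell *m poly_curve Q 0) 0 0 = 0 -> (exists x, (ell *m poly_curve Q x) 0 0 != 0) ->
  0 < rho -> 0 < d ->
  exists mu x, [/\ mu != 0, cabs mu < d, cabs x <= rho & G (mu *: poly_curve Q x) = 0].
Proof.
move=> q0 [r r0 Gr] GE ell0 [x1 ellx1] rho0 d0.
pose h : {poly C} := \sum_i ell 0 i *: Q i.
have hE x : (ell *m poly_curve Q x) 0 0 = h.[x].
  by rewrite mxE horner_sum; apply: eq_bigr => i _; rewrite hornerZ mxE.
have h0 : h != 0 by apply: contra_neq ellx1 => h0; rewrite hE h0 horner0.
have [s [m [s0 srho m0 Hm]]] := poly_circle_bound h0 rho0.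
have [K K1 HK] := poly_curve_bounded Q s; have K0 : 0 < K by exact: lt_le_trans K1.
have mq0 : 0 < m ^+ q by exact: exprn_gt0.
(* With this tolerance [f] stays within [m ^+ q / 4] of [h ^+ q], which is [0] at the center and at
   least [m ^+ q] in modulus on the circle. *)
pose e := m ^+ q / 4 / K ^+ q.
have e0 : 0 < e by rewrite !divr_gt0 ?exprn_gt0.
have [r' r'0 HG] := GE e e0.
pose n := Num.min (Num.min d (r / K)) (r' / K).
have n0 : 0 < n by rewrite !lt_min d0 !divr_gt0.
pose mu : C := (n / 2)%:C%C; have muE : cabs mu = n / 2 by rewrite cabs_real gtr0_norm ?divr_gt0.
have mu0 : 0 < cabs mu by rewrite muE divr_gt0.
have mun : cabs mu < n by rewrite muE; lra.
move: (mun); rewrite lt_min => /andP[]; rewrite lt_min => /andP[mud mur] mur'.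
have mu_n0 : mu != 0 by rewrite -cabs_gt0.
have mq : mu ^+ q != 0 by exact: expf_neq0.
have muq : 0 < cabs mu ^+ q by exact: exprn_gt0.
pose c x := mu *: poly_curve Q x.
have cK x : cabs x <= s -> forall i, cabs (c x i 0) <= cabs mu * K.
  by move=> xs i; rewrite mxE cabsM ler_wpM2l ?cabs_ge0 // HK.
have cr x : cabs x <= s -> pdisc r (c x).
  by move=> xs i; rewrite (le_lt_trans (cK x xs i)) // -ltr_pdivlMr.
pose f x := G (c x) / mu ^+ q.
have fh x : cabs x <= s -> cabs (f x - h.[x] ^+ q) <= m ^+ q / 4.
  move=> xs; have := HG (cabs mu * K) (c x) _ (cK x xs); rewrite -ler_pdivlMr // => /(_ (ltW mur')).
  have -> : (ell *m c x) 0 0 = mu * h.[x] by rewrite -scalemxAr mxE hE.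
  have -> : G (c x) - (mu * h.[x]) ^+ q = mu ^+ q * (f x - h.[x] ^+ q).
    by rewrite exprMn mulrBr /f mulrCA divff // mulr1.
  have -> : e * (cabs mu * K) ^+ q = cabs mu ^+ q * (m ^+ q / 4).
    by rewrite exprMn /e; field; rewrite expf_neq0 // gt_eqF.
  by rewrite cabsM cabsX ler_pM2l.
have m2 : 0 < m ^+ q / 2 by rewrite divr_gt0.
have [|||x xs fx] := @hurwitz _ f s (m ^+ q / 2) s0 m2 _ _ _.
- move=> e' e'0; have e'mu : 0 < e' * cabs mu ^+ q by rewrite mulr_gt0.
  have [p pp Hp] := Gr _ e'mu; have [P HP] := polyfun_curve (fun i => mu *: Q i) pp.
  exists ((mu ^+ q)^-1 *: P) => x xs; rewrite hornerZ -HP.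
  have -> : poly_curve (fun i => mu *: Q i) x = c x.
    by apply/matrixP => i j; rewrite !mxE hornerZ.
  rewrite /f mulrC -mulrBr cabsM cabsV cabsX ler_pdivrMl // mulrC; exact: Hp (cr x xs).
- move=> x xs; have := fh x; rewrite xs lexx => /(_ isT) H.
  have := cabs_subr (h.[x] ^+ q) (f x); rewrite cabs_distC cabsX.
  have : m ^+ q <= cabs h.[x] ^+ q by rewrite lerXn2r ?nnegrE ?(ltW m0) ?cabs_ge0 ?Hm.
  lra.
- have := fh 0; rewrite cabs0 ltW // -hE ell0 expr0n gtn_eqF // subr0 => /(_ isT).
  by lra.
exists mu, x; split=> //; first exact: le_trans xs srho.
by move: fx; rewrite /f => /eqP; rewrite mulf_eq0 invr_eq0 (negbTE mq) orbF => /eqP.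
Qed.

Lemma polyfun_linear_part N (p : 'cV[C]_N -> C) : polyfun p ->
  exists (l : 'rV[C]_N) (K : R), 0 < K /\ forall (s : R) (h : 'cV[C]_N), s <= 1 ->
    (forall i, cabs (h i 0) <= s) -> cabs (p h - p 0 - (l *m h) 0 0) <= K * s ^+ 2.
Proof.
elim=> [c|i|f g _ [l [K [K0 Hl]]] _ [l' [K' [K'0 Hl']]]|f g pf [l [K [K0 Hl]]] pg [l' [K' [K'0 Hl']]]].
- exists 0, 1; split=> // s h s1 hs; rewrite subrr sub0r mul0mx mxE oppr0 cabs0 mul1r.
  exact: sqr_ge0.
- exists (delta_mx 0 i), 1; split=> // s h s1 hs.
  rewrite -rowE !mxE subr0 subrr cabs0 mul1r; exact: sqr_ge0.
- exists (l + l'), (K + K'); split; first exact: addr_gt0.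
  move=> s h s1 hs.
  have -> : ((l + l') *m h) 0 0 = (l *m h) 0 0 + (l' *m h) 0 0 by rewrite mulmxDl mxE.
  have -> : f h + g h - (f 0 + g 0) - ((l *m h) 0 0 + (l' *m h) 0 0) =
    (f h - f 0 - (l *m h) 0 0) + (g h - g 0 - (l' *m h) 0 0) by ring.
  by rewrite (le_trans (cabsD _ _)) // mulrDl lerD ?Hl ?Hl'.
have [M M0 HM] := polyfun_bounded 2 pg.
pose lam (l : 'rV[C]_N) := \sum_i cabs (l 0 i).
have lam0 l1 : 0 <= lam l1 by apply: sumr_ge0 => i _; exact: cabs_ge0.
have lamE (l1 : 'rV[C]_N) (s : R) (h : 'cV[C]_N) : (forall i, cabs (h i 0) <= s) ->
    cabs ((l1 *m h) 0 0) <= lam l1 * s.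
  move=> hs; rewrite mxE (le_trans (cabs_sum _ _ _)) // mulr_suml.
  by apply: ler_sum => i _; rewrite cabsM ler_wpM2l ?cabs_ge0.
have c0 := cabs_ge0 (f 0); have Ml := lam0 l; have Ml' := lam0 l'.
exists (g 0 *: l + f 0 *: l'), (K * M + (cabs (f 0) + lam l) * K' + lam l * lam l'); split.
  have H1 : 0 <= (cabs (f 0) + lam l) * K' by rewrite mulr_ge0 ?addr_ge0 // ltW.
  have H2 : 0 <= lam l * lam l' by rewrite mulr_ge0.
  have H3 : 0 < K * M by rewrite mulr_gt0.
  by lra.
move=> s h s1 hs.
(* For [N = 0] the bounds on the coordinates of [h] do not make [s] nonnegative. *)
have [i0|/existsPn Hn] := boolP [exists i : 'I_N, true]; last first.
  have -> : h = 0 by apply/matrixP => i; have := Hn i.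
  rewrite subrr sub0r mulmx0 mxE oppr0 cabs0 mulr_ge0 ?sqr_ge0 //.
  by rewrite !addr_ge0 ?mulr_ge0 ?addr_ge0 // ltW.
have {i0} s0 : 0 <= s by case/existsP: i0 => i _; exact: le_trans (cabs_ge0 _) (hs i).
have -> : ((g 0 *: l + f 0 *: l') *m h) 0 0 = g 0 * (l *m h) 0 0 + f 0 * (l' *m h) 0 0.
  by rewrite mulmxDl -!scalemxAl [LHS]mxE [X in X + _]mxE [X in _ + X]mxE.
have Hf := Hl s h s1 hs; have Hg := Hl' s h s1 hs.
have lh := lamE l s h hs; have lh' := lamE l' s h hs.
set x := (l *m h) 0 0 in Hf lh *; set y := (l' *m h) 0 0 in Hg lh' *.
have -> : f h * g h - f 0 * g 0 - (g 0 * x + f 0 * y) =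
  (f h - f 0 - x) * g h + (f 0 + x) * (g h - g 0 - y) + x * y by ring.
have gM : cabs (g h) <= M by apply: HM => i; rewrite (le_lt_trans (hs i)) //; lra.
have fx : cabs (f 0 + x) <= cabs (f 0) + lam l.
  by rewrite (le_trans (cabsD _ _)) // lerD2l (le_trans lh) // ler_piMr.
rewrite (le_trans (cabsD _ _)) // [leRHS]mulrDl; apply: lerD.
  rewrite (le_trans (cabsD _ _)) // [leRHS]mulrDl !cabsM; apply: lerD.
    by rewrite mulrAC; apply: ler_pM; rewrite ?cabs_ge0.
  by rewrite -mulrA; apply: ler_pM; rewrite ?cabs_ge0.
by rewrite cabsM expr2 mulrACA; apply: ler_pM; rewrite ?cabs_ge0.
Qed.

Lemma analytic_derivative N M (F : 'cV[C]_N -> 'cV[C]_M) :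
  (forall i, an (fun h => F h i 0)) -> F 0 = 0 ->
  exists (D : 'M[C]_(M, N)) (K r : R), [/\ 0 < K, 0 < r & forall (s : R) (h : 'cV[C]_N), s <= r ->
    (forall i, cabs (h i 0) <= s) -> forall i, cabs (F h i 0 - (D *m h) i 0) <= K * s ^+ 2].
Proof.
move=> aF F0.
have [i|l Hl] := @choice 'I_M ('rV[C]_N) (fun i l => exists2 K : R, 0 < K & exists2 r : R, 0 < r &
    forall (s : R) (h : 'cV[C]_N), s <= r -> (forall j, cabs (h j 0) <= s) ->
      cabs (F h i 0 - (l *m h) 0 0) <= K * s ^+ 2).
  have /analytic_approx/analytic_expansion[w [r [K [r0 K0 pw wZ H]]]] := aF i.
  have [l [K' [K'0 Hl]]] := polyfun_linear_part (pw 1%N).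
  have w1 : w 1%N 0 = 0 by have := wZ 1%N 0 0; rewrite scale0r expr1 mul0r.
  have w0 h : w 0%N h = 0.
    have -> : w 0%N h = w 0%N 0.
      by have := wZ 0%N 0 h; rewrite scale0r expr0 mul1r.
    have := H 1%N 0 0; rewrite big_ord1 F0 mxE sub0r cabsN mul0r expr1 mulr0 lexx ler01 => H0.
    apply/eqP; rewrite -cabs_eq0 eq_le cabs_ge0 andbT; apply: H0 => // j.
    by rewrite mxE cabs0.
  exists l, (K / r ^+ 2 + K'); first by rewrite addr_gt0 // divr_gt0 // exprn_gt0.
  exists (Num.min 1 r); first by rewrite lt_min ltr01.
  move=> s h; rewrite le_min => /andP[s1 sr] hs.
  have H1 := Hl s h s1 hs; rewrite w1 subr0 in H1.
  have [s0|s_lt0] := leP 0 s.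
    have H2 : cabs (F h i 0 - w 1%N h) <= K / r ^+ 2 * s ^+ 2.
      have := H 2%N (s / r) h; rewrite big_ord_recl big_ord1 /= w0 add0r => H2.
      have -> : K / r ^+ 2 * s ^+ 2 = K * (s / r) ^+ 2 by field; rewrite gt_eqF.
      apply: H2 => [|j]; last by rewrite divfK ?gt_eqF.
      by apply/andP; split; [rewrite divr_ge0 // ltW | rewrite ler_pdivrMr ?mul1r].
    rewrite -[F h i 0](subrK (w 1%N h)) -addrA (le_trans (cabsD _ _)) // mulrDl lerD //.
  have N0 (j : 'I_N) : False by have := le_lt_trans (hs j) s_lt0; rewrite ltNge cabs_ge0.
  have h0 : h = 0 by apply/matrixP => j; case: (N0 j).
  rewrite h0 F0 mulmx0 !mxE subrr cabs0 mulr_ge0 ?sqr_ge0 // addr_ge0 ?divr_ge0 ?exprn_ge0 ?ltW //.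
have [i|K HK] := @choice 'I_M R (fun i K => 0 < K /\ exists2 r : R, 0 < r &
    forall (s : R) (h : 'cV[C]_N), s <= r -> (forall j, cabs (h j 0) <= s) ->
      cabs (F h i 0 - (l i *m h) 0 0) <= K * s ^+ 2).
  by have [K K0 H] := Hl i; exists K.
have [i r r' r'0 rr Hr s h sr|i|r r0 Hr] := @fin_radius R 'I_M (fun i r =>
    forall (s : R) (h : 'cV[C]_N), s <= r -> (forall j, cabs (h j 0) <= s) ->
      cabs (F h i 0 - (l i *m h) 0 0) <= K i * s ^+ 2).
- by apply: Hr; exact: le_trans sr rr.
- by have [_ [r r0 Hr]] := HK i; exists r.
exists (\matrix_(i, j) l i 0 j), (1 + \sum_i K i), r; split=> //.
  by rewrite ltr_pwDl // sumr_ge0 // => i _; rewrite ltW //; case: (HK i).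
move=> s h sr hs i.
have -> : ((\matrix_(i, j) l i 0 j) *m h) i 0 = (l i *m h) 0 0.
  by rewrite !mxE; apply: eq_bigr => j _; rewrite mxE.
rewrite (le_trans (Hr i s h sr hs)) // ler_wpM2r ?sqr_ge0 // (bigD1 i) //= addrCA lerDl.
by rewrite addr_ge0 // sumr_ge0 // => j _; rewrite ltW //; case: (HK j).
Qed.

(** The chain rule for [G \o F = id] at the origin, tested on small multiples of the basis vectors,
    gives [E *m D = 1]. *)
Lemma derivative_unit N (F G : 'cV[C]_N -> 'cV[C]_N) (D E : 'M[C]_N) (K r K' r' r'' : R) :
  0 < K -> 0 < r -> 0 < K' -> 0 < r' -> 0 < r'' ->
  (forall (s : R) (h : 'cV[C]_N), s <= r -> (forall i, cabs (h i 0) <= s) ->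
     forall i, cabs (F h i 0 - (D *m h) i 0) <= K * s ^+ 2) ->
  (forall (s : R) (h : 'cV[C]_N), s <= r' -> (forall i, cabs (h i 0) <= s) ->
     forall i, cabs (G h i 0 - (E *m h) i 0) <= K' * s ^+ 2) ->
  (forall h, pdisc r'' h -> G (F h) = h) -> D \in unitmx.
Proof.
move=> K0 r0 K'0 r'0 r''0 HF HG GF.
suff ED : E *m D = 1%:M by have [] := mulmx1_unit ED.
pose T := \sum_i \sum_j (cabs (D i j) + cabs (E i j)).
have T0 : 0 <= T by apply: sumr_ge0 => i _; apply: sumr_ge0 => j _; rewrite addr_ge0 ?cabs_ge0.
have TD (X : 'M[C]_N) (s : R) (h : 'cV[C]_N) : (forall i j, cabs (X i j) <= cabs (D i j) + cabs (E i j)) -> 0 <= s ->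
    (forall i, cabs (h i 0) <= s) -> forall i, cabs ((X *m h) i 0) <= T * s.
  move=> XT s0 hs i; rewrite mxE (le_trans (cabs_sum _ _ _)) //.
  rewrite (@le_trans _ _ (\sum_j (cabs (D i j) + cabs (E i j)) * s)) //.
    by apply: ler_sum => j _; rewrite cabsM ler_pM ?cabs_ge0.
  rewrite -mulr_suml ler_wpM2r // /T [leRHS](bigD1 i) //= lerDl.
  by apply: sumr_ge0 => k _; apply: sumr_ge0 => j _; rewrite addr_ge0 ?cabs_ge0.
apply/matrixP => i j; apply: cabs_eq_lim => e e0.
pose a := T + K; have a0 : 0 < a by rewrite ltr_wpDl.
pose c := K' * a ^+ 2 + T * K; have c0 : 0 < c by rewrite ltr_wpDr ?mulr_gt0 ?exprn_gt0 // mulr_ge0 // ltW.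
pose s := Num.min (Num.min (Num.min 1 r) (r'' / 2)) (Num.min (r' / a) (e / c)).
have s0 : 0 < s by rewrite !lt_min ltr01 r0 !divr_gt0.
have : s <= s by []. rewrite {2}/s !le_min => /andP[/andP[/andP[s1 sr] sr''] /andP[sr' se]].
clearbody s.
pose h : 'cV[C]_N := s%:C%C *: delta_mx j 0.
have hs k : cabs (h k 0) <= s.
  rewrite !mxE cabsM cabs_real gtr0_norm // ler_piMr ?(ltW s0) //.
  by case: eqP => _ /=; rewrite ?cabs1 ?cabs0.
have Fs k : cabs (F h k 0 - (D *m h) k 0) <= K * s ^+ 2 by exact: HF.
have Fa k : cabs (F h k 0) <= a * s.
  rewrite -[F h k 0](subrK ((D *m h) k 0)) (le_trans (cabsD _ _)) // mulrDl addrC lerD //.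
    by apply: TD; rewrite ?(ltW s0) // => ? ?; rewrite lerDl cabs_ge0.
  by rewrite (le_trans (Fs k)) // expr2 mulrA ler_piMr // mulr_ge0 // ltW.
have as' : a * s <= r' by rewrite mulrC -ler_pdivlMr.
have Gs := HG _ _ as' Fa i.
rewrite GF in Gs; last by move=> k; rewrite (le_lt_trans (hs k)) //; lra.
have H1 : cabs ((E *m (F h - D *m h)) i 0) <= T * (K * s ^+ 2).
  apply: TD; first by move=> ? ?; rewrite lerDr cabs_ge0.
    by rewrite mulr_ge0 ?sqr_ge0 // ltW.
  by move=> k; rewrite [(F h - D *m h) k 0]mxE [(- (D *m h)) k 0]mxE.
have E1 : ((E *m D - 1%:M) *m h) i 0 = s%:C%C * (E *m D - 1%:M) i j.
  by rewrite /h -scalemxAr mxE -colE mxE.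
have : cabs (s%:C%C * ((E *m D) i j - (1%:M : 'M[C]_N) i j)) <= s * e.
  have -> : (E *m D) i j - (1%:M : 'M[C]_N) i j = (E *m D - 1%:M) i j by rewrite !mxE.
  rewrite -E1 mulmxBl mul1mx -mulmxA.
  have -> : (E *m (D *m h) - h) i 0 = - ((h i 0 - (E *m F h) i 0) + (E *m (F h - D *m h)) i 0).
    by rewrite mulmxBr !mxE; ring.
  rewrite cabsN (le_trans (cabsD _ _)) // (le_trans (lerD Gs H1)) //.
  have -> : K' * (a * s) ^+ 2 + T * (K * s ^+ 2) = s * (s * c) by rewrite /c; ring.
  by rewrite ler_pM2l // -ler_pdivlMr.
by rewrite cabsM cabs_real gtr0_norm // ler_pM2l.
Qed.

End CurveZeros.

Section TangentDirection.
Variable R : realType.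
Local Notation C := (R[i]).

Lemma an_poly_fun (p : {poly C}) : an1 (fun x => p.[x]).
Proof. by apply: an_polyfun; apply: polyfun_horner; exact: polyfun_coord. Qed.

Lemma mulmx_bound m n (M : 'M[C]_(m, n)) : exists2 T : R, 0 < T &
  forall (s : R) (h : 'cV[C]_n), 0 <= s -> (forall i, cabs (h i 0) <= s) ->
    forall i, cabs ((M *m h) i 0) <= T * s.
Proof.
exists (1 + \sum_i \sum_j cabs (M i j)).
  by rewrite ltr_pwDl // sumr_ge0 // => i _; apply: sumr_ge0 => j _; exact: cabs_ge0.
move=> s h s0 hs i; rewrite mxE (le_trans (cabs_sum _ _ _)) //.
rewrite (@le_trans _ _ (\sum_j cabs (M i j) * s)) //.
  by apply: ler_sum => j _; rewrite cabsM ler_wpM2l ?cabs_ge0.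
rewrite -mulr_suml ler_wpM2r // (bigD1 i) //= addrCA lerDl addr_ge0 //.
by apply: sumr_ge0 => k _; apply: sumr_ge0 => j _; exact: cabs_ge0.
Qed.

Variables (A : set 'cV[C]_2) (i0 i1 : 'I_2) (q : nat) (b : C -> C) (bq : C) (d B : R).
Hypothesis arcA : arc_normal_form A i0 i1 q b bq d B.

Let j0 : 'I_(2 + 1) := lshift 1 i0.
Let j1 : 'I_(2 + 1) := lshift 1 i1.
Let j2 : 'I_(2 + 1) := rshift 2 ord0.

(** The linear form that is small on a curve satisfying [single_tangent]. Together with
    [plane_form], whose kernel is the plane over the tangent line of the arc, it determines the only
    possible tangent direction. *)
Definition tangent_form (c v0 : C) (u : 'cV[C]_(2 + 1)) : C :=
  v0 * (u j2 0 - c * u j0 0) - u j0 0.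

Definition plane_form (u : 'cV[C]_(2 + 1)) : C := u j1 0 - bq * u j0 0.

Lemma tangent_formD c v0 u u' :
  tangent_form c v0 (u + u') = tangent_form c v0 u + tangent_form c v0 u'.
Proof. rewrite /tangent_form !mxE; ring. Qed.

Lemma tangent_formZ c v0 k u : tangent_form c v0 (k *: u) = k * tangent_form c v0 u.
Proof. rewrite /tangent_form !mxE; ring. Qed.

Lemma tangent_form_le c v0 (u : 'cV[C]_(2 + 1)) (s : R) : (forall i, cabs (u i 0) <= s) ->
  cabs (tangent_form c v0 u) <= (cabs v0 * (1 + cabs c) + 1) * s.
Proof.
move=> us; rewrite (le_trans (cabsB _ _)) // mulrDl mul1r lerD // cabsM -mulrA ler_wpM2l ?cabs_ge0 //.
by rewrite (le_trans (cabsB _ _)) // cabsM mulrDl mul1r lerD // ler_wpM2l ?cabs_ge0.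
Qed.

Variables (F : 'cV[C]_(2 + 1) -> 'cV[C]_(2 + 1)) (M : 'M[C]_(2 + 1)) (K r : R).
Hypotheses (aF : forall i, an (fun h => F h i 0)) (F0 : F 0 = 0) (K0 : 0 < K) (r0 : 0 < r).
Hypothesis FM : forall (s : R) (h : 'cV[C]_(2 + 1)), s <= r -> (forall i, cabs (h i 0) <= s) ->
  forall i, cabs (F h i 0 - (M *m h) i 0) <= K * s ^+ 2.
Variables (P : 'cV[C]_2 -> {poly C}) (n : nat).
Hypotheses (n0 : (0 < n)%N) (P0 : P 0 = 'X^n).
Variables (V : set 'cV[C]_(2 + 1)) (rho : R).
Hypotheses (rho0 : 0 < rho).
Hypothesis VP : forall h, pdisc rho h -> V h -> (P (usubmx (F h))).[dsubmx (F h) 0 0] = 0.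
Hypothesis F_inj0 : forall h, pdisc rho h -> V h -> F h = 0 -> h = 0.
Variable Q : 'I_(2 + 1) -> {poly C}.
Hypothesis VQ : forall mu x, V (mu *: poly_curve Q x).
Hypotheses (Q0 : poly_curve Q 0 != 0) (plane0 : plane_form (M *m poly_curve Q 0) = 0).
Hypothesis plane_x : exists x, plane_form (M *m poly_curve Q x) != 0.

(* The section contains points close to the direction of [M *m poly_curve Q 0],
   which must therefore be its only tangent direction. *)
Lemma tangent_direction c v0 :
  (forall e : R, 0 < e -> exists2 d : R, 0 < d & forall t z, t != 0 -> cabs t < d ->
     (P (arc_point i0 q b t)).[z] = 0 ->
     cabs (v0 * (z - c * t ^+ q) - t ^+ q) <= e * cabs (z - c * t ^+ q)) ->
  tangent_form c v0 (M *m poly_curve Q 0) = 0.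
Proof.
move=> single; have [[i10 q0] [d0 ab] _ _ _] := arcA.
have [g [ag gE gest]] := arc_equation arcA.
have [T T0 MT] := mulmx_bound M.
pose a := T + K; have a0 : 0 < a by rewrite addr_gt0.
have Fa (s : R) (h : 'cV[C]_(2 + 1)) : 0 <= s -> s <= r -> s <= 1 -> (forall i, cabs (h i 0) <= s) ->
    forall i, cabs (F h i 0) <= a * s.
  move=> s0 sr s1 hs i; rewrite -[F h i 0](subrK ((M *m h) i 0)) (le_trans (cabsD _ _)) //.
  rewrite mulrDl addrC lerD ?MT // (le_trans (FM sr hs i)) //.
  by rewrite expr2 mulrA ler_piMr // mulr_ge0 // ltW.
pose X (u : 'cV[C]_(2 + 1)) : 'cV[C]_3 := vec3 (u j0 0) (u j1 0) (u j2 0).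
pose G h := g (X (F h)).
have aG : an G.
  apply: (an_comp (g := fun h => X (F h)) ag).
    by move=> -[[|[|[|//]]] ip]; under eq_fun => ? do rewrite mxE /=.
  by rewrite F0; apply/matrixP => -[[|[|[|//]]] ip] j; rewrite !mxE.
pose ell : 'rV[C]_(2 + 1) := row j1 M - bq *: row j0 M.
have ellE h : (ell *m h) 0 0 = plane_form (M *m h).
  by rewrite /ell mulmxBl -scalemxAl -!row_mul /plane_form; do ?[rewrite [LHS]mxE]; rewrite !mxE.
have Gest (e : R) : 0 < e -> exists2 r, 0 < r & forall (s : R) (h : 'cV[C]_(2 + 1)), s <= r ->
    (forall i, cabs (h i 0) <= s) -> cabs (G h - (ell *m h) 0 0 ^+ q) <= e * s ^+ q.
  move=> e0; have ea0 : 0 < e / a ^+ q by rewrite divr_gt0 // exprn_gt0.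
  have [r1 r10 H1] := gest _ ea0.
  pose k := (1 + cabs bq) * K; have k0 : 0 < k by rewrite mulr_gt0 // ltr_pwDl ?cabs_ge0.
  exists (Num.min (Num.min 1 r) (Num.min (r1 / a) (r1 * a / k))).
    by rewrite !lt_min ltr01 r0 !divr_gt0 // mulr_gt0.
  move=> s h; rewrite !le_min => /andP[/andP[s1 sr] /andP[sr1 sk]] hs.
  have s0 : 0 <= s by exact: le_trans (cabs_ge0 _) (hs j0).
  have -> : e * s ^+ q = e / a ^+ q * (a * s) ^+ q.
    by rewrite exprMn; field; rewrite expf_neq0 // gt_eqF.
  apply: H1; rewrite ?Fa //; first by rewrite mulrC -ler_pdivlMr.
  rewrite ellE /plane_form.
  have -> : F h j1 0 - bq * F h j0 0 - ((M *m h) j1 0 - bq * (M *m h) j0 0) =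
    (F h j1 0 - (M *m h) j1 0) - bq * (F h j0 0 - (M *m h) j0 0) by ring.
  rewrite (le_trans (cabsB _ _)) // cabsM.
  rewrite (@le_trans _ _ (k * s ^+ 2)) //.
    rewrite /k -mulrA mulrDl mul1r lerD ?FM // ler_wpM2l ?cabs_ge0 ?FM //.
  rewrite expr2 !mulrA ler_wpM2r // mulrC -ler_pdivlMr //.
pose N2 := cabs v0 * (1 + cabs c) + 1.
have N20 : 0 < N2 by rewrite ltr_pwDr // mulr_ge0 ?addr_ge0 ?cabs_ge0.
have [K1 K11 HK1] := poly_curve_bounded Q 1; have K10 : 0 < K1 by exact: lt_le_trans K11.
pose mQ : {poly C} := v0 *: (\sum_j M j2 j *: Q j - c *: \sum_j M j0 j *: Q j) - \sum_j M j0 j *: Q j.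
have mQE x : tangent_form c v0 (M *m poly_curve Q x) = mQ.[x].
  have E i : (M *m poly_curve Q x) i 0 = (\sum_j M i j *: Q j).[x].
    by rewrite mxE horner_sum; apply: eq_bigr => j _; rewrite hornerZ mxE.
  by rewrite /tangent_form !E /mQ !(hornerD, hornerN, hornerZ).
have [k Qk] : exists k, (Q k).[0] != 0.
  apply: contrapT => H; move/eqP: Q0; apply; apply/matrixP => i j; rewrite !mxE.
  by apply: contrapT => /eqP Qi; apply: H; exists i.
have [r2 r20 Hr2] := an1_neq0 (an_poly_fun (Q k)) Qk.
apply: cabs_eq_lim => e e0; rewrite subr0.
have e30 : 0 < e / 3 by rewrite divr_gt0.
have [r3 r30 Hr3] := an1_cont0 (an_poly_fun mQ) e30.
pose e1 := e / 3 / ((1 + cabs c) * a * K1).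
have c10 : 0 < 1 + cabs c by rewrite ltr_pwDl ?cabs_ge0.
have e10 : 0 < e1 by rewrite !divr_gt0 ?mulr_gt0.
have [d2 d20 Hd2] := single e1 e10.
pose rx := Num.min (Num.min 1 (r2 / 2)) (r3 / 2).
have rx0 : 0 < rx by rewrite !lt_min ltr01 !divr_gt0.
pose dm := Num.min (Num.min (Num.min 1 (r / K1)) (Num.min (1 / K1) (rho / K1)))
   (Num.min (d2 ^+ q / (a * K1)) (e / 3 / (N2 * K * K1 ^+ 2))).
have dm0 : 0 < dm by rewrite !lt_min ltr01 !divr_gt0 // ?exprn_gt0 // ?mulr_gt0 // exprn_gt0.
have ell0 : (ell *m poly_curve Q 0) 0 0 = 0 by rewrite ellE.
have ellx : exists x, (ell *m poly_curve Q x) 0 0 != 0 by have [x] := plane_x; exists x; rewrite ellE.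
(* [x] and [mu] are small independently: [x] controls the deviation from the direction of
   [poly_curve Q 0], and [mu] both the parameter [t] and the nonlinear part of [F]. *)
have [mu [x [mu0 + + Gz]]] := curve_zeros q0 aG Gest ell0 ellx rx0 dm0.
rewrite !lt_min => /andP[/andP[/andP[mu1 mur] /andP[mu1' murho]] /andP[mud mue]].
rewrite !le_min => /andP[/andP[x1 xr2] xr3].
pose h := mu *: poly_curve Q x; pose s := cabs mu * K1.
have hs i : cabs (h i 0) <= s by rewrite mxE cabsM ler_wpM2l ?cabs_ge0 ?HK1.
have mu_gt0 : 0 < cabs mu by rewrite cabs_gt0.
have s0 : 0 < s by rewrite mulr_gt0.
have sr : s <= r by rewrite -ler_pdivlMr // ltW.
have s1 : s <= 1 by rewrite -ler_pdivlMr // ltW.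
have hrho : pdisc rho h by move=> i; rewrite (le_lt_trans (hs i)) // -ltr_pdivlMr.
have Vh : V h by exact: VQ.
have [t [tq bt]] := (gE _ _ _).1 Gz.
have xE : usubmx (F h) = arc_point i0 q b t by apply/(arc_pointP arcA); rewrite !mxE.
have zE : dsubmx (F h) 0 0 = F h j2 0 by rewrite mxE.
have Pz := VP hrho Vh; rewrite xE zE in Pz.
(* At [t = 0] the point [F h] would be the origin, hence [h = 0], but the coordinate [k] of
   [poly_curve Q x] is nonzero for small [x]. *)
have t0 : t != 0.
  apply/eqP => t0; have h0 : h = 0.
    apply: F_inj0 => //; apply/matrixP => i j; rewrite ord1 [RHS]mxE.
    rewrite -[F h]vsubmxK mxE; case: splitP => k' _; last rewrite (ord1 k') zE; rewrite ?xE ?t0.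
      by rewrite (arc_point0 arcA) mxE.
    move: Pz; rewrite t0 (arc_point0 arcA) P0 hornerXn => /eqP.
    by rewrite expf_eq0 n0 /= => /eqP.
  have : (Q k).[x] != 0 by apply: Hr2; lra.
  have : h k 0 = 0 by rewrite h0 mxE.
  by rewrite !mxE => /eqP; rewrite mulf_eq0 (negbTE mu0) /= => ->.
have FaS := Fa s h (ltW s0) sr s1 hs.
have td2 : cabs t < d2.
  rewrite -(@ltr_pXn2r _ q) ?nnegrE ?cabs_ge0 ?(ltW d20) // -cabsX tq.
  by rewrite (le_lt_trans (FaS _)) // /s mulrCA -ltr_pdivlMr ?mulr_gt0.
have H1 : cabs (tangent_form c v0 (F h)) <= e1 * ((1 + cabs c) * (a * s)).
  rewrite /tangent_form -tq (le_trans (Hd2 t _ t0 td2 Pz)) // ler_wpM2l ?(ltW e10) //.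
  by rewrite (le_trans (cabsB _ _)) // mulrDl mul1r lerD // cabsM ler_wpM2l ?cabs_ge0 // tq.
have H2 : cabs (tangent_form c v0 (M *m h - F h)) <= N2 * (K * s ^+ 2).
  by apply: tangent_form_le => i; rewrite !mxE cabs_distC; have := FM sr hs i; rewrite mxE.
have H3 : cabs mu * cabs mQ.[x] <= cabs mu * (e / 3 + e / 3).
  rewrite -cabsM -mQE -tangent_formZ scalemxAr -/h -[M *m h](subrK (F h)) tangent_formD.
  rewrite (le_trans (cabsD _ _)) // addrC mulrDr; apply: lerD.
    rewrite (le_trans H1) // /e1 /s le_eqVlt; apply/orP; left; apply/eqP; field.
    by rewrite !gt_eqF.
  rewrite (le_trans H2) // /s.
  have -> : N2 * (K * (cabs mu * K1) ^+ 2) = cabs mu * (cabs mu * (N2 * K * K1 ^+ 2)) by ring.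
  by rewrite ler_wpM2l ?cabs_ge0 // -ler_pdivlMr ?ltW // !mulr_gt0 // exprn_gt0.
rewrite ler_pM2l // in H3.
have := Hr3 x; rewrite mQE cabs_distC => /(_ _)/wrap[|]; first lra.
have := cabs_tri mQ.[0] mQ.[x] 0; rewrite !subr0; lra.
Qed.

End TangentDirection.

(** * The cone over the tricuspidal quartic *)

Section SteinerGeometry.
Variable C : numClosedFieldType.
Implicit Types a b d s t x y z : C.

(** The image of the conic [x ^ 2 + y ^ 2 + z ^ 2 = 2 (x y + y z + z x)] under
    [(x : y : z) |-> (1 / x : 1 / y : 1 / z)]. The conic consists of the points
    [(s ^ 2 : t ^ 2 : u ^ 2)] with [s + t + u = 0] and is tangent to the coordinate lines; the
    points of tangency become cusps at the coordinate points. *)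
Definition steiner_form x y z : C :=
  x ^+ 2 * y ^+ 2 + y ^+ 2 * z ^+ 2 + z ^+ 2 * x ^+ 2 - 2 * x * y * z * (x + y + z).

(* Cleared of denominators, [(1 / s ^ 2 : 1 / t ^ 2 : 1 / u ^ 2)] with
   [s + t + u = 0]. *)
Definition steiner_x s t : C := t ^+ 2 * (s + t) ^+ 2.
Definition steiner_y s t : C := s ^+ 2 * (s + t) ^+ 2.
Definition steiner_z s t : C := s ^+ 2 * t ^+ 2.

Lemma steiner_form_param s t :
  steiner_form (steiner_x s t) (steiner_y s t) (steiner_z s t) = 0.
Proof. rewrite /steiner_form /steiner_x /steiner_y /steiner_z; ring. Qed.

(** Off the coordinate planes, with [a ^ 2 = y z] and [b ^ 2 = x z], the equation reads
    [(x y - y z - x z) ^ 2 = 4 a ^ 2 b ^ 2]. Up to the sign of [b] it thus says that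
    [(a + b) ^ 2 = x y], and the parameters are [a] and [b] divided by a fourth root of [x y z]. *)
Lemma steiner_param_onto x y z : steiner_form x y z = 0 ->
  exists s t, [/\ x = steiner_x s t, y = steiner_y s t & z = steiner_z s t].
Proof.
rewrite /steiner_form /steiner_x /steiner_y /steiner_z => F0.
have root4 a : exists s, s ^+ 4 = a by exists (4.-root a); rewrite rootCK.
have [x0|x0] := eqVneq x 0.
  have /eqP : y ^+ 2 * z ^+ 2 = 0 by rewrite -F0 x0; ring.
  rewrite mulf_eq0 !expf_eq0 /= => /orP[] /eqP e0.
    have [s sz] := root4 z; exists s, (- s); rewrite x0 e0 -sz; split; ring.
  have [s sy] := root4 y; exists s, 0; rewrite x0 e0 -sy; split; ring.
have [y0|y0] := eqVneq y 0.
  have /eqP : x ^+ 2 * z ^+ 2 = 0 by rewrite -F0 y0; ring.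
  rewrite mulf_eq0 !expf_eq0 /= (negbTE x0) /= => /eqP z0.
  have [t tx] := root4 x; exists 0, t; rewrite y0 z0 -tx; split; ring.
have [z0|z0] := eqVneq z 0.
  have /eqP : x ^+ 2 * y ^+ 2 = 0 by rewrite -F0 z0; ring.
  by rewrite mulf_eq0 !expf_eq0 /= (negbTE x0) (negbTE y0).
have [a ayz] : exists a, a ^+ 2 = y * z by exists (sqrtC (y * z)); rewrite sqrtCK.
have [b [bxz abxy]] : exists b, b ^+ 2 = x * z /\ (a + b) ^+ 2 = x * y.
  pose b := sqrtC (x * z); have bE : b ^+ 2 = x * z by rewrite sqrtCK.
  have : (x * y - y * z - x * z - 2 * a * b) * (x * y - y * z - x * z + 2 * a * b) = 0.
    transitivity ((x * y - y * z - x * z) ^+ 2 - 4 * a ^+ 2 * b ^+ 2); first by ring.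
    rewrite ayz bE -F0; ring.
  move=> /eqP; rewrite mulf_eq0 => /orP[] /eqP E; [exists b | exists (- b)].
    split=> //; transitivity (a ^+ 2 + b ^+ 2 + 2 * a * b); first by ring.
    by apply/eqP; rewrite -subr_eq0 ayz bE; apply/eqP; rewrite -[RHS]oppr0 -E; ring.
  rewrite sqrrN; split=> //; transitivity (a ^+ 2 + b ^+ 2 - 2 * a * b); first by ring.
  by apply/eqP; rewrite -subr_eq0 ayz bE; apply/eqP; rewrite -[RHS]oppr0 -E; ring.
have [k kE] := root4 (x * y * z).
have k0 : k ^+ 4 != 0 by rewrite kE !mulf_neq0.
have k1 : k != 0 by apply: contraNneq k0 => ->; rewrite expr0n.
exists (a / k), (b / k).
have H u v : (u / k) ^+ 2 * (v / k) ^+ 2 = u ^+ 2 * v ^+ 2 / k ^+ 4 by field.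
rewrite -mulrDl !H ayz bxz abxy kE; split; field; rewrite ?x0 ?y0 ?z0 //.
Qed.

Definition steiner_linear a b d s t : C :=
  a * steiner_x s t + b * steiner_y s t + d * steiner_z s t.

Lemma steiner_linear_neq0 a b d : [|| a != 0, b != 0 | d != 0] ->
  exists s t, steiner_linear a b d s t != 0.
Proof.
rewrite /steiner_linear /steiner_x /steiner_y /steiner_z.
case/or3P => H; [exists 0, 1 | exists 1, 0 | exists 1, (- 1)];
  apply: contra_neq H => <-; ring.
Qed.

Lemma sqrt_neq a w : w != 0 -> exists s, s ^+ 2 = a /\ s != w.
Proof.
move=> w0; have aE := sqrtCK a.
have [E|] := eqVneq (sqrtC a) w; last by exists (sqrtC a).
exists (- w); rewrite sqrrN -E aE E; split=> //.
apply: contra_neq w0 => /eqP; rewrite eq_sym -addr_eq0 -mulr2n mulrn_eq0 /= => /eqP //.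
Qed.

(** With a single root [s1] the quartic in [s] would be [b * (s - s1) ^+ 4]. Its values at [0] and
    [-1] determine [a] and [d], and those at [1] and [-2] then give two incompatible equations for
    [s1]. *)
Lemma steiner_quartic a b d : a != 0 -> b != 0 -> d != 0 ->
  exists s1 s2, [/\ s1 != s2, steiner_linear a b d s1 1 = 0 & steiner_linear a b d s2 1 = 0].
Proof.
move=> a0 b0 d0.
pose p : {poly C} := \poly_(i < 5) [:: a; 2 * a; a + b + d; 2 * b; b]`_i.
have sp : size p = 5%N by apply: size_poly_eq.
have pE s : p.[s] = steiner_linear a b d s 1.
  rewrite horner_poly !big_ord_recl big_ord0 /=.
  rewrite /steiner_linear /steiner_x /steiner_y /steiner_z; ring.
have lp : lead_coef p = b by rewrite lead_coefE sp coef_poly.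
have [r Dp] := closed_field_poly_normal p; rewrite lp in Dp.
have sr : size r = 4%N.
  by have := sp; rewrite Dp size_scale // size_prod_XsubC => -[].
have rP s : s \in r -> steiner_linear a b d s 1 = 0.
  move=> rs; rewrite -pE Dp hornerZ horner_prod (big_rem s) //= hornerXsubC subrr mul0r mulr0 //.
case: r sr Dp rP => // s1 r [sr] Dp rP.
have [/allP all1|/allPn[s2 rs2 s21]] := boolP (all (pred1 s1) r); last first.
  exists s1, s2; split; rewrite 1?eq_sym ?rP ?inE ?eqxx // rs2 orbT //.
have rE : r = nseq 3 s1 by move/allP/all_pred1P: all1; rewrite sr.
have E s : steiner_linear a b d s 1 = b * (s - s1) ^+ 4.
  by rewrite -pE Dp rE hornerZ horner_prod !big_cons big_nil !hornerXsubC; ring.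
rewrite /steiner_linear /steiner_x /steiner_y /steiner_z in E.
have bE k : b * k = 0 -> k = 0 by move/eqP; rewrite mulf_eq0 (negbTE b0) /= => /eqP.
have {}E s : a * (1 ^+ 2 * (s + 1) ^+ 2) + b * (s ^+ 2 * (s + 1) ^+ 2) + d * (s ^+ 2 * 1 ^+ 2) -
    b * (s - s1) ^+ 4 = 0 by rewrite E subrr.
have aE : a = b * s1 ^+ 4 by apply: subr0_eq; rewrite -(E 0); ring.
have dE : d = b * (s1 + 1) ^+ 4 by apply: subr0_eq; rewrite -(E (-1)); ring.
have F1 : s1 ^+ 4 + 2 * s1 ^+ 3 + 2 * s1 + 1 = 0.
  have : b * (4 * (s1 ^+ 4 + 2 * s1 ^+ 3 + 2 * s1 + 1)) = 0.
    by rewrite -(E 1) aE dE; ring.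
  by move/bE/eqP; rewrite mulf_eq0 pnatr_eq0 /= => /eqP.
have F2 : s1 ^+ 4 + 2 * s1 ^+ 3 - 4 * s1 - 2 = 0.
  have : b * (4 * (s1 ^+ 4 + 2 * s1 ^+ 3 - 4 * s1 - 2)) = 0.
    by rewrite -(E (-2)) aE dE; ring.
  by move/bE/eqP; rewrite mulf_eq0 pnatr_eq0 /= => /eqP.
have F3 : 2 * s1 + 1 = 0.
  have : 3 * (2 * s1 + 1) = 0 by rewrite -[RHS](subrr 0) -{1}F1 -F2; ring.
  by move/eqP; rewrite mulf_eq0 pnatr_eq0 /= => /eqP.
(* The polynomial of [F1] takes the value [-3 / 16] at [-1 / 2], the root of [F3]; the cofactor
   below is the quotient of the division. *)
have : (3 : C) = 0.
  transitivity ((2 * s1 + 1) * (8 * s1 ^+ 3 + 12 * s1 ^+ 2 - 6 * s1 + 19) - 16 * (s1 ^+ 4 + 2 * s1 ^+ 3 + 2 * s1 + 1)).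
    ring.
  by rewrite F1 F3; ring.
by move/eqP; rewrite pnatr_eq0.
Qed.

(** The last clause says that the two points are nonzero and not proportional. A vanishing
    coefficient means that the line passes through a cusp, which is then taken as one of the points;
    otherwise both come from distinct roots of the quartic, the parametrization being injective. *)
Lemma steiner_two_points a b d : [|| a != 0, b != 0 | d != 0] ->
  exists s1 t1 s2 t2, [/\ steiner_linear a b d s1 t1 = 0, steiner_linear a b d s2 t2 = 0 &
    forall k1 k2, k1 * steiner_x s1 t1 = k2 * steiner_x s2 t2 ->
      k1 * steiner_y s1 t1 = k2 * steiner_y s2 t2 ->
      k1 * steiner_z s1 t1 = k2 * steiner_z s2 t2 -> k1 = 0 /\ k2 = 0].
Proof.
rewrite /steiner_linear => abd.
have [a0|a0] := eqVneq a 0.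
  have [b0|b0] := eqVneq b 0.
    exists 0, 1, 1, 0; rewrite a0 b0 /steiner_x /steiner_y /steiner_z.
    split; [ring | ring | move=> k1 k2 E1 E2 _; split].
      by transitivity (k1 * (1 ^+ 2 * (0 + 1) ^+ 2)); [ring | rewrite E1; ring].
    by transitivity (k2 * (1 ^+ 2 * (1 + 0) ^+ 2)); [ring | rewrite -E2; ring].
  have [w [wE w1]] := sqrt_neq (- d / b) (oner_neq0 C).
  exists 0, 1, (w - 1), 1; rewrite a0 /steiner_x /steiner_y /steiner_z.
  have w10 : (w - 1) ^+ 2 != 0 by rewrite expf_neq0 // subr_eq0.
  split; [ring | rewrite subrK wE; field => // | move=> k1 k2 E1 E2 E3].
  have k20 : k2 = 0.
    by apply/eqP; have /esym/eqP := E3; rewrite expr1n mulr1 expr0n mul0r mulr0 mulf_eq0 (negbTE w10) orbF.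
  by split=> //; transitivity (k1 * (1 ^+ 2 * (0 + 1) ^+ 2)); [ring | rewrite E1 k20; ring].
have [b0|b0] := eqVneq b 0.
  have [w [wE w1]] := sqrt_neq (- d / a) (oner_neq0 C).
  exists 1, 0, 1, (w - 1); rewrite b0 /steiner_x /steiner_y /steiner_z.
  have w10 : (w - 1) ^+ 2 != 0 by rewrite expf_neq0 // subr_eq0.
  split; [ring | rewrite [1 + _]addrC subrK wE; field => // | move=> k1 k2 E1 E2 E3].
  have k20 : k2 = 0.
    by apply/eqP; have /esym/eqP := E3; rewrite expr1n mul1r expr0n mul1r mulr0 mulf_eq0 (negbTE w10) orbF.
  by split=> //; transitivity (k1 * (1 ^+ 2 * (1 + 0) ^+ 2)); [ring | rewrite E2 k20; ring].
have [d0|d0] := eqVneq d 0.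
  have N10 : (-1 : C) != 0 by rewrite oppr_eq0 oner_neq0.
  have [w [wE w1]] := sqrt_neq (- a / b) N10.
  exists 1, (-1), w, 1; rewrite d0 /steiner_x /steiner_y /steiner_z.
  have w10 : (w + 1) ^+ 2 != 0 by rewrite expf_neq0 // addr_eq0.
  split; [ring | rewrite wE; field => // | move=> k1 k2 E1 E2 E3].
  have k20 : k2 = 0.
    by apply/eqP; have /esym/eqP := E1; rewrite subrr expr1n mul1r [0 ^+ 2]expr0n !mulr0 mulf_eq0 (negbTE w10) orbF.
  by split=> //; transitivity (k1 * (1 ^+ 2 * (-1) ^+ 2)); [ring | rewrite E3 k20; ring].
have [s1 [s2 [s12 E1 E2]]] := steiner_quartic a0 b0 d0.
exists s1, 1, s2, 1; split=> // k1 k2.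
have sn s : steiner_linear a b d s 1 = 0 -> s != 0 /\ s + 1 != 0.
  rewrite /steiner_linear /steiner_x /steiner_y /steiner_z => E.
  split; [apply: contra_neq a0 => s0 | apply: contra_neq d0 => s0]; rewrite -E.
    by rewrite s0; ring.
  by have -> : s = -1 by [apply/eqP; rewrite -addr_eq0 s0]; ring.
have [s10 s1n] := sn _ E1; have [s20 s2n] := sn _ E2.
rewrite /steiner_x /steiner_y /steiner_z !(expr1n, mul1r, mulr1) => H1 H2 H3.
have k1E : k1 = 0.
  apply: contra_neq_eq s12 => k10; apply/eqP.
  have /eqP : k1 * (s1 + 1) ^+ 2 * (s1 ^+ 2 - s2 ^+ 2) = 0.
    transitivity (k1 * (s1 ^+ 2 * (s1 + 1) ^+ 2) - k1 * (s1 + 1) ^+ 2 * s2 ^+ 2); first by ring.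
    rewrite H2 H1; ring.
  rewrite 2!mulf_eq0 (negbTE k10) expf_eq0 /= (negbTE s1n) /= => /eqP ss.
  have {ss} : (s1 - s2) * (s1 + s2) = 0 by rewrite -ss; ring.
  move/eqP; rewrite mulf_eq0 => /orP[/eqP/subr0_eq|/eqP ss]; first by move=> ->.
  exfalso.
  have s2E : s2 = - s1 by apply/eqP; rewrite -addr_eq0 addrC ss.
  have kk : k1 = k2.
    apply/eqP; rewrite -subr_eq0; have /eqP : (k1 - k2) * s1 ^+ 2 = 0.
      by rewrite mulrBl H3 s2E; ring.
    by rewrite mulf_eq0 expf_eq0 /= (negbTE s10) orbF.
  have /eqP : 4 * k1 * s1 = 0.
    transitivity (k1 * (s1 + 1) ^+ 2 - k1 * (1 - s1) ^+ 2); first by ring.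
    by rewrite H1 s2E kk; ring.
  by rewrite !mulf_eq0 pnatr_eq0 (negbTE k10) (negbTE s10).
split=> //; apply/eqP; have /esym/eqP := H3.
by rewrite k1E mul0r mulf_eq0 expf_eq0 /= (negbTE s20) orbF.
Qed.

End SteinerGeometry.

(** * Orders along lines and leading forms *)

Section LeadingForms.
Variable R : realType.
Local Notation C := (R[i]).
Variable N : nat.
Implicit Types (f g : 'cV[C]_N -> C) (v : 'cV[C]_N) (c : C).

Lemma pdisc_line v (r : R) : 0 < r -> exists2 d, 0 < d & forall l, cabs l < d -> pdisc r (l *: v).
Proof.
move=> r0; pose T := 1 + \sum_i cabs (v i 0).
have S0 : 0 <= \sum_i cabs (v i 0) by apply: sumr_ge0 => i _; exact: cabs_ge0.
have T0 : 0 < T by rewrite ltr_pwDl.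
exists (r / T); first by rewrite divr_gt0.
move=> l; rewrite ltr_pdivlMr // => lr i; rewrite mxE cabsM; apply: le_lt_trans lr.
rewrite ler_wpM2l ?cabs_ge0 // /T (bigD1 i) //= addrCA lerDl addr_ge0 //.
by apply: sumr_ge0 => k _; exact: cabs_ge0.
Qed.

(* [f (l v) = c l ^ k + O(l ^ (k + 1))], where [c] may vanish. *)
Definition line_order f v k c := exists d K : R, [/\ 0 < d, 0 < K &
  forall l, cabs l < d -> cabs (f (l *: v) - l ^+ k * c) <= K * cabs l ^+ k.+1].

Lemma line_order_near f g v k c (r : R) : 0 < r -> (forall h, pdisc r h -> f h = g h) ->
  line_order f v k c -> line_order g v k c.
Proof.
move=> r0 fg [d [K [d0 K0 H]]]; have [d' d'0 Hd'] := pdisc_line v r0.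
exists (Num.min d d'), K; split; rewrite ?lt_min ?d0 // => l.
by rewrite lt_min => /andP[ld /Hd'/fg <-]; exact: H.
Qed.

Lemma line_orderM f g v k k' c c' : line_order f v k c -> line_order g v k' c' ->
  line_order (fun h => f h * g h) v (k + k') (c * c').
Proof.
move=> [d [K [d0 K0 H]]] [d' [K' [d'0 K'0 H']]].
exists (Num.min 1 (Num.min d d')), (K * (cabs c' + K') + cabs c * K').
split; first by rewrite !lt_min ltr01 d0.
  by rewrite ltr_pwDl ?mulr_gt0 ?mulr_ge0 ?ltr_pwDr ?cabs_ge0 ?(ltW K'0).
move=> l; rewrite !lt_min => /and3P[l1 /H Hl /H' Hl'].
have l0 := cabs_ge0 l.
have gl : cabs (g (l *: v)) <= (cabs c' + K') * cabs l ^+ k'.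
  rewrite -[g _](subrK (l ^+ k' * c')) (le_trans (cabsD _ _)) // addrC mulrDl lerD //.
    by rewrite cabsM cabsX mulrC.
  by rewrite (le_trans Hl') // ler_wpM2l ?(ltW K'0) // exprS ler_piMl ?exprn_ge0 // ltW.
have -> : f (l *: v) * g (l *: v) - l ^+ (k + k') * (c * c') =
  (f (l *: v) - l ^+ k * c) * g (l *: v) + l ^+ k * c * (g (l *: v) - l ^+ k' * c').
  by rewrite exprD; ring.
rewrite (le_trans (cabsD _ _)) // [leRHS]mulrDl !cabsM; apply: lerD.
  rewrite -addSn exprD mulrACA; apply: ler_pM; rewrite ?cabs_ge0 //.
rewrite -addnS exprD cabsX [cabs l ^+ k * _]mulrC mulrACA.
by apply: ler_pM; rewrite ?cabs_ge0 ?mulr_ge0 ?exprn_ge0 ?cabs_ge0.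
Qed.

Lemma line_orderB0 f v k k' c c' : (k <= k')%N -> line_order f v k c -> line_order f v k' c' ->
  c = if k == k' then c' else 0.
Proof.
move=> kk [d [K [d0 K0 H]]] [d' [K' [d'0 K'0 H']]].
set c1 := if _ then _ else _; apply: cabs_eq_lim => e e0.
pose T := K + cabs c' + K'; have T0 : 0 < T by rewrite ltr_pwDr // addr_ge0 ?cabs_ge0 // ltW.
pose s := Num.min (Num.min 1 (Num.min d d') / 2) (e / T).
have s0 : 0 < s by rewrite !lt_min !divr_gt0 // !lt_min ltr01 d0.
have sT : s * T <= e by rewrite -ler_pdivlMr // /s ge_min lexx orbT.
have [s1 sd sd'] : [/\ s <= 1, s < d & s < d'].
  have m0 : 0 < Num.min 1 (Num.min d d') by rewrite !lt_min ltr01 d0.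
  have : s <= Num.min 1 (Num.min d d') / 2 by rewrite /s ge_min lexx.
  have : Num.min 1 (Num.min d d') <= 1 by rewrite ge_min lexx.
  have : Num.min 1 (Num.min d d') <= d by rewrite !ge_min lexx orbT.
  have : Num.min 1 (Num.min d d') <= d' by rewrite !ge_min lexx !orbT.
  by move: (Num.min _ _) m0 => m *; split; lra.
clearbody s; pose l : C := s%:C%C; have lE : cabs l = s by rewrite cabs_real gtr0_norm.
have := H l; have := H' l; rewrite lE => /(_ sd') H1 /(_ sd) H2.
have H3 : cabs (l ^+ k * c - l ^+ k' * c') <= K * s ^+ k.+1 + K' * s ^+ k'.+1.
  rewrite (le_trans (cabs_tri _ (f (l *: v)) _)) // cabs_distC lerD //.
have sk : 0 < s ^+ k by exact: exprn_gt0.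
have kk' : s ^+ k'.+1 <= s ^+ k.+1 by rewrite ler_wiXn2l ?ltnS ?(ltW s0).
have H4 : K' * s ^+ k'.+1 <= K' * s ^+ k.+1 by rewrite ler_wpM2l // ltW.
have [E|kn] := eqVneq k k'.
  rewrite /c1 E eqxx; rewrite -(ler_pM2l sk) (le_trans _ (ler_wpM2l (ltW sk) sT)) //.
  have -> : s ^+ k * cabs (c - c') = cabs (l ^+ k * c - l ^+ k' * c').
    by rewrite -E -mulrBr cabsM cabsX lE.
  have -> : s ^+ k * (s * T) = K * s ^+ k.+1 + K' * s ^+ k.+1 + s ^+ k.+1 * cabs c'.
    by rewrite exprS /T; ring.
  rewrite (le_trans H3) // -[leLHS]addr0; apply: lerD; first by rewrite lerD2l.
  by rewrite mulr_ge0 ?cabs_ge0 ?exprn_ge0 // ltW.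
rewrite /c1 (negbTE kn) subr0 -(ler_pM2l sk) (le_trans _ (ler_wpM2l (ltW sk) sT)) //.
have -> : s ^+ k * cabs c = cabs (l ^+ k * c) by rewrite cabsM cabsX lE.
rewrite -[l ^+ k * c](subrK (l ^+ k' * c')) (le_trans (cabsD _ _)) //.
have -> : s ^+ k * (s * T) = K * s ^+ k.+1 + K' * s ^+ k.+1 + s ^+ k.+1 * cabs c'.
  by rewrite exprS /T; ring.
apply: lerD; first by rewrite (le_trans H3) // lerD2l.
rewrite cabsM cabsX lE ler_wpM2r ?cabs_ge0 // ler_wiXn2l ?(ltW s0) //.
by rewrite ltn_neqAle kn.
Qed.

Lemma line_order_inj f v k k' c c' : line_order f v k c -> line_order f v k' c' ->
  c != 0 -> c' != 0 -> k = k'.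
Proof.
move=> H H' c0 c'0; case: (ltngtP k k') => // kk; exfalso.
  by have := line_orderB0 (ltnW kk) H H'; rewrite (ltn_eqF kk) => /eqP; rewrite (negbTE c0).
by have := line_orderB0 (ltnW kk) H' H; rewrite (ltn_eqF kk) => /eqP; rewrite (negbTE c'0).
Qed.

Lemma line_order_uniq f v k c c' : line_order f v k c -> line_order f v k c' -> c = c'.
Proof. by move=> H H'; rewrite (line_orderB0 (leqnn k) H H') eqxx. Qed.

Definition leading_form f w k := [/\ polyfun w, forall l h, w (l *: h) = l ^+ k * w h,
  exists v, w v != 0 & forall v, line_order f v k (w v)].

Lemma leading_form_ex f : an f -> ~ (exists2 r : R, 0 < r & forall h, pdisc r h -> f h = 0) ->
  exists w k, leading_form f w k.
Proof.
move=> /analytic_approx/analytic_expansion[w [r [K [r0 K0 pw wZ H]]]] fn0.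
have [exk|nk] := pselect (exists k, `[< exists v, w k v != 0 >]); last first.
  exfalso; apply: fn0; exists (r / 2); first by rewrite divr_gt0.
  move=> h hr; apply: cabs_eq_lim => e e0; rewrite subr0.
  have wk k : w k h = 0.
    by apply: contrapT => /eqP wk; apply: nk; exists k; apply/asboolP; exists h.
  have [n Hn] := half_lt K e0.
  apply: le_trans Hn; have := H n (2^-1) h; rewrite big1 // subr0; apply; first lra.
  by move=> i; rewrite mulrC ltW.
pose k := ex_minn exk; exists (w k), k.
have [[v wv] kmin] : (exists v, w k v != 0) /\ forall j, (j < k)%N -> forall v, w j v = 0.
  rewrite /k; case: ex_minnP => m /asboolP mv mmin; split=> // j jm v.
  by apply/eqP; apply: contraT => wj; have := mmin j (asboolT (ex_intro _ v wj)); rewrite leqNgt jm.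
split=> //; first by exists v.
move=> u; pose T := 1 + \sum_i cabs (u i 0).
have S0 : 0 <= \sum_i cabs (u i 0) by apply: sumr_ge0 => i _; exact: cabs_ge0.
have T0 : 0 < T by rewrite ltr_pwDl.
exists (r / T), (K * (T / r) ^+ k.+1); split; rewrite ?divr_gt0 ?mulr_gt0 ?exprn_gt0 ?divr_gt0 //.
move=> l lr; rewrite -wZ -mulrA -exprMn.
have := H k.+1 (T / r * cabs l) (l *: u); rewrite big_ord_recr /= big1 ?add0r; last first.
  by move=> i _; exact: kmin.
apply.
  rewrite mulr_ge0 ?cabs_ge0 ?divr_ge0 ?(ltW T0) ?(ltW r0) //=.
  by rewrite mulrC -ler_pdivlMr ?divr_gt0 // mul1r invf_div ltW.
move=> i; rewrite mxE cabsM mulrAC divfK ?gt_eqF // mulrC ler_wpM2r ?cabs_ge0 //.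
rewrite /T (bigD1 i) //= addrCA lerDl addr_ge0 //.
by apply: sumr_ge0 => j _; exact: cabs_ge0.
Qed.

Lemma polyfun_line w (a b : 'cV[C]_N) : polyfun w ->
  exists P : {poly C}, forall x, w (a + x *: b) = P.[x].
Proof.
move=> pw; have [P HP] := polyfun_curve (fun i => (a i 0)%:P + (b i 0) *: 'X) pw.
exists P => x; rewrite -HP; congr w; apply/matrixP => i j.
by rewrite !mxE !ord1 hornerD hornerC hornerZ hornerX mulrC.
Qed.

(** On the line through the two given points both functions become nonzero polynomials in one
    variable. *)
Lemma polyfun_neq0M (w w' : 'cV[C]_N -> C) : polyfun w -> polyfun w' ->
  (exists v, w v != 0) -> (exists v, w' v != 0) -> exists v, w v != 0 /\ w' v != 0.
Proof.
move=> pw pw' [a wa] [b wb]; have [P HP] := polyfun_line a (b - a) pw.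
have [P' HP'] := polyfun_line a (b - a) pw'.
have P0 : P != 0 by apply: contra_neq wa => P0; have := HP 0; rewrite scale0r addr0 P0 horner0.
have P'0 : P' != 0.
  by apply: contra_neq wb => P'0; have := HP' 1; rewrite scale1r addrC subrK P'0 horner0.
have [x] := poly_nonroot (mulf_neq0 P0 P'0).
by rewrite hornerM mulf_eq0 negb_or -HP -HP' => /andP[]; exists (a + x *: (b - a)).
Qed.

(** Orders add and leading forms multiply along every line, and some direction is a zero of neither
    leading form. *)
Lemma an_mul_eq0 f g : an f -> an g ->
  (exists2 r : R, 0 < r & forall h, pdisc r h -> f h * g h = 0) ->
  (exists2 r : R, 0 < r & forall h, pdisc r h -> f h = 0) \/
  (exists2 r : R, 0 < r & forall h, pdisc r h -> g h = 0).
Proof.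
move=> af ag [r r0 fg0]; apply/or_asboolP; apply: contraT.
rewrite negb_or => /andP[/asboolPn nf /asboolPn ng].
have [w [k [pw _ w0 wf]]] := leading_form_ex af nf.
have [w' [k' [pw' _ w'0 wg]]] := leading_form_ex ag ng.
have [v [wv wv']] := polyfun_neq0M pw pw' w0 w'0.
have /(line_order_near r0 fg0) H := line_orderM (wf v) (wg v).
have H0 : line_order (fun=> 0) v (k + k') 0.
  exists 1, 1; split=> // l _; rewrite mulr0 subrr cabs0 mul1r exprn_ge0 ?cabs_ge0 //.
by have /eqP := line_order_uniq H H0; rewrite mulf_eq0 (negbTE wv) (negbTE wv').
Qed.

End LeadingForms.

(** * The cone is a reduced and irreducible germ *)

Section SteinerGerm.
Variable R : realType.
Local Notation C := (R[i]).
Implicit Types (v : 'cV[C]_(2 + 1)) (s t : C).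

Definition steiner_eq v : C := steiner_form (v 0 0) (v 1 0) (v 2%:R 0).

Definition steiner : set 'cV[C]_(2 + 1) := [set v | steiner_eq v = 0].

Definition steiner_map s t : 'cV[C]_(2 + 1) :=
  vec3 (steiner_x s t) (steiner_y s t) (steiner_z s t).

Lemma steiner_eqZ l v : steiner_eq (l *: v) = l ^+ 4 * steiner_eq v.
Proof. rewrite /steiner_eq /steiner_form !mxE; ring. Qed.

Lemma polyfun_steiner : polyfun steiner_eq.
Proof.
have pc i : polyfun (fun v : 'cV[C]_(2 + 1) => v i 0) by exact: polyfun_coord.
rewrite /steiner_eq /steiner_form; apply: polyfunB.
  by do ?[apply: polyfunD]; apply: polyfunM; apply: polyfunX.
by apply: polyfunM; [do ?[apply: polyfunM => //]; exact: polyfun_cst | do ?[apply: polyfunD]].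
Qed.

Lemma steiner_map_in s t : steiner (steiner_map s t).
Proof. by rewrite /steiner /= /steiner_eq !mxE /= steiner_form_param. Qed.

Lemma steiner_onto v : steiner v -> exists s t, v = steiner_map s t.
Proof.
move=> /steiner_param_onto[s [t [vx vy vz]]]; exists s, t.
by rewrite (vec3_coord v) vx vy vz.
Qed.

(* The restriction of the equation to this line is [x ^ 4 + 6 x ^ 2 - 3], of
   leading coefficient the value at [steiner_dir]. *)
Definition steiner_base : 'cV[C]_(2 + 1) := vec3 1 1 1.
Definition steiner_dir : 'cV[C]_(2 + 1) := vec3 1 (-1) 0.

Lemma steiner_lineE x : steiner_eq (steiner_base + x *: steiner_dir) = x ^+ 4 + 6 * x ^+ 2 - 3.
Proof. rewrite /steiner_eq /steiner_form !mxE /=; ring. Qed.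

(** On the line through [steiner_base] directed by [steiner_dir] the form has only simple roots, so
    that [w] is constant there. By homogeneity of positive degree, [w] then vanishes at the point at
    infinity [steiner_dir] of this line, where the quartic does not. *)
Lemma steiner_no_square w u k : (0 < k)%N -> polyfun w -> polyfun u ->
  (forall l h, w (l *: h) = l ^+ k * w h) -> ~ (forall v, steiner_eq v = w v ^+ 2 * u v).
Proof.
move=> k0 pw pu wZ E.
have [P HP] := polyfun_line steiner_base steiner_dir pw.
have [Q HQ] := polyfun_line steiner_base steiner_dir pu.
pose q : {poly C} := 'X^4 + 6 *: 'X^2 - 3%:P.
have qx x : q.[x] = x ^+ 4 + 6 * x ^+ 2 - 3.
  by rewrite /q !(hornerD, hornerN, hornerZ, hornerXn, hornerC).
have qE : q = P ^+ 2 * Q.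
  apply/eqP; rewrite -subr_eq0; apply: contraT => /poly_nonroot[x].
  by rewrite hornerD hornerN hornerM horner_exp -HP -HQ -E steiner_lineE qx subrr eqxx.
have [sP|sP] := leqP (size P) 1.
  have [P' HP'] := polyfun_line steiner_dir steiner_base pw.
  have [c0 PC] : exists c0, P = c0%:P by exists P`_0; exact: size1_polyC.
  have P'E : P' = c0 *: 'X^k.
    apply/eqP; rewrite -subr_eq0; apply: contraT => /poly_nonroot H.
    (* The factor ['X] provides a nonzero [y], by which the point can be rescaled to the first
       line. *)
    have : ('X * (P' - c0 *: 'X^k)) != 0.
      by rewrite mulf_neq0 ?polyX_eq0 //; case: H => c; apply: contra_neq => ->; rewrite horner0.
    move=> /poly_nonroot[y]; rewrite hornerM hornerX mulf_eq0 negb_or => /andP[y0].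
    rewrite hornerD hornerN hornerZ hornerXn -HP'.
    have -> : steiner_dir + y *: steiner_base = y *: (steiner_base + y^-1 *: steiner_dir).
      by rewrite scalerDr scalerA divff // scale1r addrC.
    by rewrite wZ HP PC hornerC mulrC subrr eqxx.
  have w0 : w steiner_dir = 0.
    by have := HP' 0; rewrite scale0r addr0 P'E hornerZ hornerXn expr0n gtn_eqF // mulr0.
  have := E steiner_dir; rewrite w0 expr0n mul0r /steiner_eq /steiner_form !mxE /=.
  by apply/eqP; rewrite !(mulr0, mul0r, addr0, expr0n, sqrrN, expr1n, subr0, mulr1) oner_neq0.
have [|c Pc] := closed_rootP P _; first by rewrite gtn_eqF.
have /rootP Pc0 := Pc.
have q0 : q.[c] = 0 by rewrite qE hornerM horner_exp Pc0 expr0n mul0r.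
have q'0 : q^`().[c] = 0.
  by rewrite qE derivM hornerD !hornerM expr2 derivM !hornerE Pc0; ring.
rewrite qx in q0.
clear qx.
rewrite /q !derivE !hornerE /= in q'0.
(* A Bezout identity between [q] and its derivative, evaluated at the common root [c]. *)
have : (48 : C) = 0.
  transitivity ((c ^+ 3 + c ^+ 3 + c ^+ 3 + c ^+ 3 + 6 * (c + c) - 0) * (c ^+ 3 + 7 * c) -
    4 * (c ^+ 4 + 6 * c ^+ 2 - 3) * (c ^+ 2 + 4)); first by ring.
  by rewrite q0 q'0; ring.
by move/eqP; rewrite pnatr_eq0.
Qed.

Lemma steiner_line_order v : line_order steiner_eq v 4 (steiner_eq v).
Proof.
exists 1, 1; split=> // l _; rewrite steiner_eqZ subrr cabs0 mul1r exprn_ge0 ?cabs_ge0 //.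
Qed.

Lemma steiner_eq_neq0 : exists v, steiner_eq v != 0.
Proof.
exists steiner_dir; rewrite /steiner_eq /steiner_form !mxE /=.
by rewrite !(mulr0, mul0r, addr0, expr0n, sqrrN, expr1n, subr0, mulr1) oner_neq0.
Qed.

Lemma steiner_eq0 : steiner_eq 0 = 0.
Proof. by rewrite /steiner_eq /steiner_form !mxE; ring. Qed.

Local Notation K := (Num.NumField.sort (R[i] : numFieldType)).

(** If [steiner_eq = g ^ 2 h] with [g 0 = 0], the leading form [w] of [g] has positive degree. As
    [steiner_eq] is homogeneous, it equals its own leading form, that is the product of [w ^ 2] and
    of the leading form of [h], which [steiner_no_square] excludes. *)
Lemma hypersurface_steiner : @hypersurface_germ (R[i] : numFieldType) (2 + 1) steiner.
Proof.
exists steiner_eq; split.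
- by apply/analytic_approx; exact: an_polyfun polyfun_steiner.
- exact: steiner_eq0.
- move=> g h /analytic_approx ag /analytic_approx ah /near0P[r r0 E].
  apply/eqP => g0.
  have n0 f : (forall v, pdisc r v -> f v = 0 -> steiner_eq v = 0) ->
      ~ (exists2 r : R, 0 < r & forall v, pdisc r v -> f v = 0).
    move=> fE [r' r'0 f0]; have [v /eqP] := steiner_eq_neq0; apply.
    have [d d0 Hd] := pdisc_line v r0; have [d' d'0 Hd'] := pdisc_line v r'0.
    have z : line_order (fun=> 0 : C) v 4 0.
      by exists 1, 1; split=> // l _; rewrite mulr0 subrr cabs0 mul1r exprn_ge0 ?cabs_ge0.
    have m0 : 0 < Num.min r r' by rewrite lt_min r0.
    apply: (line_order_uniq (steiner_line_order v)); apply: line_order_near m0 _ z => u ur.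
    have ur1 : pdisc r u by apply: pdisc_le ur; rewrite ge_min lexx.
    have ur2 : pdisc r' u by apply: pdisc_le ur; rewrite ge_min lexx orbT.
    by rewrite fE // f0.
  have [|w [k [pw wZ w0 wg]]] := leading_form_ex ag.
    by apply: n0 => v vr gv; rewrite E // gv expr0n mul0r.
  have [|u [m [pu _ u0 uh]]] := leading_form_ex ah.
    by apply: n0 => v vr hv; rewrite E // hv mulr0.
  have k0 : (0 < k)%N.
    rewrite lt0n; apply/eqP => k0; have [v /eqP] := w0; apply.
    have [d [B [d0 _ H]]] := wg v; have := H 0; rewrite cabs0 scale0r g0 k0 mul1r sub0r cabsN mulr0.
    by move=> /(_ d0) H0; apply/eqP; rewrite -cabs_eq0 eq_le H0 cabs_ge0.
  have H v : line_order steiner_eq v (k + k + m) (w v ^+ 2 * u v).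
    apply: (line_order_near (f := fun v => g v * g v * h v) r0); first by move=> v' v'r; rewrite E.
    exact: line_orderM (line_orderM (wg v) (wg v)) (uh v).
  have [v1 [wv1 uv1]] := polyfun_neq0M pw pu w0 u0.
  have wu0 : exists v, w v ^+ 2 * u v != 0 by exists v1; rewrite mulf_neq0 ?expf_neq0.
  have [v [Fv wuv]] := polyfun_neq0M polyfun_steiner (polyfunM (polyfunX 2 pw) pu) steiner_eq_neq0 wu0.
  have km := line_order_inj (H v) (steiner_line_order v) wuv Fv; rewrite km in H.
  apply: (steiner_no_square k0 pw pu wZ) => v'.
  exact: line_order_uniq (steiner_line_order v') (H v').
- by apply/near0P; exists 1.
Qed.

(** If [cabs s >= r] while [s (s + t)] and [s t] are less than [r ^ 2 / 2] in modulus, then [s + t]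
    and [t] are less than [r / 2], which contradicts [s = (s + t) - t]. *)
Lemma steiner_map_small (r : R) : 0 < r -> exists2 d, 0 < d & forall s t,
  pdisc d (steiner_map s t) -> cabs s < r /\ cabs t < r.
Proof.
move=> r0; exists (r ^+ 4 / 4); first by rewrite divr_gt0 // exprn_gt0.
have H x y : cabs x ^+ 2 * cabs (x + y) ^+ 2 < r ^+ 4 / 4 -> cabs x ^+ 2 * cabs y ^+ 2 < r ^+ 4 / 4 ->
    cabs x < r.
  rewrite -!exprMn => H1 H2; rewrite ltNge; apply/negP => rx.
  have r4 : r ^+ 4 / 4 = (r * (r / 2)) ^+ 2 by field.
  have rr : 0 <= r * (r / 2) by rewrite mulr_ge0 ?divr_ge0 // ltW.
  have sq z : (cabs x * cabs z) ^+ 2 < r ^+ 4 / 4 -> cabs z < r / 2.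
    rewrite r4 ltr_pXn2r ?nnegrE // ?mulr_ge0 ?cabs_ge0 // => H; rewrite ltNge; apply/negP => rz.
    by have := ler_pM (ltW r0) (divr_ge0 (ltW r0) (ler0n _ 2)) rx rz; rewrite leNgt H.
  have := cabsB (x + y) y; rewrite addrK; have := sq _ H1; have := sq _ H2; lra.
move=> s t st; have := st 0; have := st 1; have := st 2%:R.
have cE x y : cabs (x ^+ 2 * y ^+ 2) = cabs x ^+ 2 * cabs y ^+ 2 by rewrite cabsM !cabsX.
rewrite !mxE /= /steiner_x /steiner_y /steiner_z !cE => H1 H2 H3; split.
  exact: (H s t).
by apply: (H t s); rewrite 1?addrC // mulrC.
Qed.

(** If all the equations of [A1] vanished on the parameter plane near the origin, [A1] would contain
    the germ of the cone, since points near the vertex have small parameters. So one equation of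
    [A1] and one of [A2] pull back to nonzero germs, while their product vanishes because the cone
    is covered by [A1] and [A2]. *)
Lemma irreducible_steiner : @irreducible_germ (R[i] : numFieldType) (2 + 1) steiner.
Proof.
split.
- apply: (@analytic_germ_ex _ _ _ [:: steiner_eq]) => [f [<-|[]]|v].
    exact: an_polyfun polyfun_steiner.
  by split=> [Xv f [<-|[]] //|]; apply; left.
- exact: steiner_eq0.
move=> [A1 [A2 [[k1 [g1 [ag1 /near0P[r1 r10 A1E]]]] [k2 [g2 [ag2 /near0P[r2 r20 A2E]]]]]]].
move=> /near0P[r r0 XE] nA1 nA2.
pose phi (h : 'cV[C]_2) := steiner_map (h 0 0) (h 1 0).
have phi0 : phi 0 = 0.
  by apply/matrixP => -[[|[|[|//]]] ip] j; rewrite !mxE /= /steiner_x /steiner_y /steiner_z ?mxE; ring.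
have aphi i : an (fun h => phi h i 0).
  apply: an_polyfun; have pc i' : polyfun (fun v : 'cV[C]_2 => v i' 0) by exact: polyfun_coord.
  by case: i => -[|[|[|//]]] ip; under eq_fun => ? do rewrite mxE /=;
    apply: polyfunM; apply: polyfunX => //; apply: polyfunD.
have agphi k (g : 'I_k -> 'cV[C]_(2 + 1) -> C) i : analytic_at (g i : 'cV[K]_(2 + 1) -> K) 0 -> an (g i \o phi).
  by move=> /analytic_approx ag; exact: an_comp.
have key (A : set 'cV[C]_(2 + 1)) k (g : 'I_k -> 'cV[C]_(2 + 1) -> C) (r' : R) : 0 < r' ->
    (forall v, pdisc r v -> A v -> steiner v) ->
    (forall v, pdisc r' v -> A v <-> forall i, g i v = 0) ->
    ~ @germ_eq (R[i] : numFieldType) (2 + 1) steiner A ->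
    exists i, ~ (exists2 r : R, 0 < r & forall h, pdisc r h -> (g i \o phi) h = 0).
  move=> r'0 AX AE nA; apply: contrapT => ng; apply: nA.
  have [i s s' s'0 ss Hs h /(pdisc_le ss)/Hs//|i|s s0 Hs] := @fin_radius R 'I_k (fun (i : 'I_k) (s : R) =>
     forall h, pdisc s h -> (g i \o phi) h = 0).
    apply: contrapT => Hi; apply: ng; exists i => -[s s0 Hs]; apply: Hi; by exists s.
  have [d d0 Hd] := steiner_map_small s0.
  apply/near0P; exists (Num.min d (Num.min r r')); first by rewrite !lt_min d0 r0.
  move=> v vr.
  have vd : pdisc d v by apply: pdisc_le vr; rewrite ge_min lexx.
  have vr1 : pdisc r v by apply: pdisc_le vr; rewrite !ge_min lexx orbT.
  have vr' : pdisc r' v by apply: pdisc_le vr; rewrite !ge_min lexx !orbT.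
  split=> [Xv|]; last exact: AX.
  apply/AE => // i; have [s1 [t1 vE]] := steiner_onto Xv.
  pose h : 'cV[C]_2 := \col_i (if i == 0 then s1 else t1).
  have vphi : v = phi h by rewrite vE /phi !mxE.
  rewrite vphi; apply: (Hs i h); move: vd; rewrite vE => /Hd[ss st] j.
  by rewrite mxE; case: ifP.
have [i1 Hi1] := key A1 k1 g1 r1 r10 (fun v vr Av => (XE v vr).2 (or_introl Av)) A1E nA1.
have [i2 Hi2] := key A2 k2 g2 r2 r20 (fun v vr Av => (XE v vr).2 (or_intror Av)) A2E nA2.
have m0 : 0 < Num.min r (Num.min r1 r2) by rewrite !lt_min r0 r10.
have [d d0 Hd] : exists2 d : R, 0 < d & forall h, pdisc d h -> pdisc (Num.min r (Num.min r1 r2)) (phi h).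
  have [i s s' s'0 ss Hs h /(pdisc_le ss)/Hs//|i|s s0 Hs] := @fin_radius R 'I_(2 + 1) (fun i (s : R) =>
     forall h, pdisc s h -> cabs (phi h i 0) < Num.min r (Num.min r1 r2)).
    move: (Num.min _ _) m0 => m m0; have m20 : 0 < m / 2 by rewrite divr_gt0.
    have [s s0 Hs] := an_cont0 (aphi i) m20; exists s => // h /Hs.
    by rewrite phi0 [X in _ - X]mxE subr0; lra.
  by exists s => // h hs i; exact: Hs.
case: (an_mul_eq0 (agphi _ _ _ (ag1 i1)) (agphi _ _ _ (ag2 i2))) => //.
exists d => // h /Hd hr.
have vr : pdisc r (phi h) by apply: pdisc_le hr; rewrite ge_min lexx.
have vr1 : pdisc r1 (phi h) by apply: pdisc_le hr; rewrite !ge_min lexx orbT.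
have vr2 : pdisc r2 (phi h) by apply: pdisc_le hr; rewrite !ge_min lexx !orbT.
case: ((XE _ vr).1 (steiner_map_in _ _)) => [/A1E|/A2E] H.
  by rewrite /= H // mul0r.
by rewrite /= (H vr2) mulr0.
Qed.

End SteinerGerm.

(** * Arc-sections of the images of the cone *)

Section ArcSectionsOfImages.
Variable R : realType.
Local Notation C := (R[i]).
Local Notation K := (Num.NumField.sort (R[i] : numFieldType)).

(** The two forms cut out a line on which [z - c x] is a coordinate; its values at [u] and [u'] are
    the factors of proportionality. *)
Lemma tangent_line (i0 i1 : 'I_2) (bq c v0 : C) (u u' : 'cV[C]_(2 + 1)) : i1 != i0 -> u != 0 ->
  plane_form i0 i1 bq u = 0 -> tangent_form i0 c v0 u = 0 ->
  plane_form i0 i1 bq u' = 0 -> tangent_form i0 c v0 u' = 0 ->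
  exists k k', k' *: u = k *: u' /\ k != 0.
Proof.
move=> i10 un0; rewrite /plane_form /tangent_form.
set j0 := lshift 1 i0; set j1 := lshift 1 i1; set j2 := rshift 2 ord0.
move=> pu tu pu' tu'.
have jP i : [\/ i = j0, i = j1 | i = j2].
  case: (split_ordP i) => k ->; last by rewrite (ord1 k); apply: Or33.
  have : (k == i0) || (k == i1).
    by move: i10; case: k i0 i1 {j0 j1 pu tu pu' tu'} => -[|[|//]] ? [[|[|//]] ?] [[|[|//]] ?].
  by case/orP => /eqP->; [apply: Or31 | apply: Or32].
pose w (u : 'cV[C]_(2 + 1)) := u j2 0 - c * u j0 0.
have uE (v : 'cV[C]_(2 + 1)) : v j1 0 - bq * v j0 0 = 0 -> v0 * (v j2 0 - c * v j0 0) - v j0 0 = 0 ->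
    [/\ v j0 0 = v0 * w v, v j1 0 = bq * (v0 * w v) & v j2 0 = w v + c * (v0 * w v)].
  rewrite -/(w v) => /subr0_eq e1 /subr0_eq e0; rewrite e0 e1; split=> //; rewrite /w; ring.
have [a1 a2 a3] := uE _ pu tu; have [b1 b2 b3] := uE _ pu' tu'.
exists (w u), (w u'); split.
  apply/matrixP => i j; rewrite ord1 !mxE.
  by case: (jP i) => ->; rewrite ?a1 ?a2 ?a3 ?b1 ?b2 ?b3; ring.
apply: contra_neq un0 => w0; apply/matrixP => i j; rewrite ord1 mxE.
by case: (jP i) => ->; rewrite ?a1 ?a2 ?a3 w0; ring.
Qed.

Lemma plane_form_mulmx (i0 i1 : 'I_2) (bq : C) (M : 'M[C]_(2 + 1)) : i1 != i0 -> M \in unitmx ->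
  exists a b d, [|| a != 0, b != 0 | d != 0] /\
    forall s t, plane_form i0 i1 bq (M *m steiner_map s t) = steiner_linear a b d s t.
Proof.
move=> i10 Mu; set j0 := lshift 1 i0; set j1 := lshift 1 i1.
pose a i := M j1 i - bq * M j0 i.
have aE (u : 'cV[C]_(2 + 1)) : plane_form i0 i1 bq (M *m u) = a 0 * u 0 0 + a 1 * u 1 0 + a 2%:R * u 2%:R 0.
  rewrite /plane_form !mxE !big_ord_recl !big_ord0 /a.
  have -> : lift ord0 ord0 = 1 :> 'I_(2 + 1) by exact: val_inj.
  have -> : lift ord0 (lift ord0 ord0) = 2%:R :> 'I_(2 + 1) by exact: val_inj.
  ring.
exists (a 0), (a 1), (a 2%:R); split; last first.
  by move=> s t; rewrite aE !mxE /=.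
apply: contraT; rewrite !negb_or !negbK => /and3P[/eqP e0 /eqP e1 /eqP e2].
have := aE (invmx M *m delta_mx j1 0); rewrite e0 e1 e2 !mul0r !addr0 mulKVmx //.
rewrite /plane_form !mxE !eqxx /= (_ : (_ == j1) = false) ?mulr0 ?subr0.
  by move/eqP; rewrite oner_eq0.
by apply/negbTE; rewrite eq_sym (inj_eq (@lshift_inj _ _)).
Qed.

(** The image of the line that joins the parameters. With [(s', t')] chosen off the plane, it gives
    the curve on the cone that [curve_zeros] requires: it meets the plane at [x = 0] without being
    contained in it. *)
Lemma steiner_curve (s t s' t' : C) : exists Q : 'I_(2 + 1) -> {poly C},
  [/\ poly_curve Q 0 = steiner_map s t, poly_curve Q 1 = steiner_map s' t' &
      forall mu x, steiner (mu *: poly_curve Q x)].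
Proof.
pose S : {poly C} := s%:P + (s' - s) *: 'X; pose T : {poly C} := t%:P + (t' - t) *: 'X.
pose Q (i : 'I_(2 + 1)) : {poly C} :=
  [:: T ^+ 2 * (S + T) ^+ 2; S ^+ 2 * (S + T) ^+ 2; S ^+ 2 * T ^+ 2]`_i.
have QE x : poly_curve Q x = steiner_map S.[x] T.[x].
  by apply/matrixP => -[[|[|[|//]]] ip] j; rewrite !mxE /Q /= hornerM !horner_exp ?hornerD.
have line (a b x : C) : (a%:P + (b - a) *: 'X).[x] = a + (b - a) * x.
  by rewrite hornerD hornerC hornerZ hornerX.
exists Q; split.
- by rewrite QE !line !mulr0 !addr0.
- by rewrite QE !line !mulr1 [s + _]addrC [t + _]addrC !subrK.
by move=> mu x; rewrite QE /steiner /= steiner_eqZ (steiner_map_in _ _) mulr0.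
Qed.

(** In the single-tangent case the images under the derivative [M] of both points of
    [steiner_two_points] would lie on the line cut out by [plane_form] and [tangent_form], although
    [M] is invertible and the points are not proportional. *)
Lemma arc_sections_biholomorphic U (Phi : 'cV[C]_(2 + 1) -> 'cV[C]_(2 + 1)) :
  @biholomorphism_on (R[i] : numFieldType) (2 + 1) U Phi ->
  @all_arc_sections_reducible (R[i] : numFieldType) 2 (Phi @` (U `&` @steiner R)).
Proof.
move=> [oU U0 Phi0 oV [Psi [PsiPhi aPhi aPsi]]] pi _ _ S.
move=> [Delta [r [alpha [[L [P [[Lu piE [n [aP Pmon P0]] _ XE] _]] inj _ SE]]]]].
set X' := Phi @` _ in XE SE.
have [i0 [i1 [q [b [bq [d [B arcA]]]]]]] := arc_param inj.
set A := _ @` _ in arcA; rewrite -/A in SE.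
have [[i10 q0] _ _ _ _] := arcA.
have {XE} [rw rw0 XE] := (near0P _).1 XE.
have {Pmon} Pmon := (near0P _).1 Pmon.
have X'0 : X' 0 by exists 0 => //; split => //; exact: steiner_eq0.
have XP v : pdisc rw (L *m v) -> X' v <-> (P (usubmx (L *m v))).[dsubmx (L *m v) 0 0] = 0.
  move=> /XE H; apply: (iff_trans _ H); split=> [|[v' X'v' /(congr1 (mulmx (invmx L)))]]; first by exists v.
  by rewrite !mulKmx // => <-.
have n0 : (0 < n)%N.
  rewrite lt0n; apply/eqP => n0.
  have H : pdisc rw (L *m 0) by move=> i; rewrite mulmx0 mxE cabs0.
  have := (XP 0 H).1 X'0; rewrite mulmx0.
  have -> : usubmx (0 : 'cV[C]_(2 + 1)) = 0 by apply/matrixP => i j; rewrite !mxE.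
  by rewrite P0 n0 expr0 hornerC => /eqP; rewrite oner_eq0.
have aP' i : an (fun x => (P x)`_i) by apply/analytic_approx; exact: aP.
have [|//|[c [v0 single]]] := section_reducible (S := S) arcA Lu n0 aP' Pmon P0.
  have [r1 r10 H1] := pdisc_mulmx L rw0.
  by exists r1 => // v /H1/XP H; rewrite SE /= piE; split=> -[Av /H].
exfalso.
(* [F] carries the cone to [X'] in the coordinates of the Weierstrass polynomial; its left inverse
   [G] gives the invertibility of [M] and the injectivity of [F] at the origin. *)
pose F h := L *m Phi h; pose G h := Psi (invmx L *m h).
have Psi0 : Psi 0 = 0 by rewrite -{1}Phi0 PsiPhi.
have aPhi' i : an (fun h => Phi h i 0) by apply/analytic_approx; exact: aPhi U0 i.
have aPsi' i : an (fun h => Psi h i 0).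
  by apply/analytic_approx; apply: aPsi; exists 0.
have aF i : an (fun h => F h i 0).
  under eq_fun => h do rewrite mxE.
  by apply: an_sum => j _; apply: anM => //; exact: an_cst.
have aG i : an (fun h => G h i 0).
  apply: (an_comp (g := mulmx (invmx L)) (aPsi' i)); last exact: mulmx0.
  by move=> j; exact: an_mulmx.
have F0 : F 0 = 0 by rewrite /F Phi0 mulmx0.
have G0 : G 0 = 0 by rewrite /G mulmx0 Psi0.
have [M [K1 [r1 [K10 r10 FM]]]] := analytic_derivative aF F0.
have [E [K2 [r2 [K20 r20 GE]]]] := analytic_derivative aG G0.
have [rU rU0 HU] : exists2 rU, 0 < rU & forall h, pdisc rU h -> U h.
  by apply/near0P; apply: open_nbhs_nbhs.
have GF h : pdisc rU h -> G (F h) = h by move=> /HU/PsiPhi; rewrite /G /F mulKmx.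
have Mu : M \in unitmx := derivative_unit K10 r10 K20 r20 rU0 FM GE GF.
have [rF rF0 HF] : exists2 rF, 0 < rF & forall h, pdisc rF h -> pdisc rw (F h).
  have [i s s' s'0 ss Hs h /(pdisc_le ss)/Hs//|i|s s0 Hs] := @fin_radius R 'I_(2 + 1) (fun i s =>
     forall h, pdisc s h -> cabs (F h i 0) < rw).
    have w20 : 0 < rw / 2 by rewrite divr_gt0.
    have [s s0 Hs] := an_cont0 (aF i) w20; exists s => // h /Hs.
    by rewrite F0 [X in _ - X]mxE subr0; lra.
  by exists s => // h hs i; exact: Hs.
have rho0 : 0 < Num.min rU rF by rewrite lt_min rU0.
have VP h : pdisc (Num.min rU rF) h -> steiner h -> (P (usubmx (F h))).[dsubmx (F h) 0 0] = 0.
  move=> hr Vh; apply/XP; first by apply: HF; apply: pdisc_le hr; rewrite ge_min lexx orbT.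
  by exists h => //; split=> //; apply: HU; apply: pdisc_le hr; rewrite ge_min lexx.
have F_inj0 h : pdisc (Num.min rU rF) h -> steiner h -> F h = 0 -> h = 0.
  by move=> hr _ Fh; rewrite -(GF h) ?Fh //; apply: pdisc_le hr; rewrite ge_min lexx.
have [a [b' [d' [abd plE]]]] := plane_form_mulmx bq i10 Mu.
have [s' [t' st']] := steiner_linear_neq0 abd.
have key s t : steiner_linear a b' d' s t = 0 -> steiner_map s t != 0 ->
    tangent_form i0 c v0 (M *m steiner_map s t) = 0.
  move=> st0 phi0; have [Q [Q0 Q1 VQ]] := steiner_curve s t s' t'.
  rewrite -Q0; apply: (tangent_direction arcA aF F0 K10 r10 FM n0 P0 rho0 VP F_inj0 VQ) => //.
  - by rewrite Q0.
  - by rewrite Q0 plE.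
  - by exists 1; rewrite Q1 plE.
have [s1 [t1 [s2 [t2 [st1 st2 indep]]]]] := steiner_two_points abd.
have {}indep k k' : k *: steiner_map s1 t1 = k' *: steiner_map s2 t2 -> k = 0 /\ k' = 0.
  move=> /matrixP H; have := H 0 0; have := H 1 0; have := H 2%:R 0; rewrite !mxE /=.
  by move=> H2 H1 H0; exact: indep.
have n1 : steiner_map s1 t1 != 0.
  apply/eqP => z; have [] := indep 1 0; first by rewrite z scaler0 scale0r.
  by move/eqP; rewrite oner_eq0.
have n2 : steiner_map s2 t2 != 0.
  apply/eqP => z; have [] := indep 0 1; first by rewrite z scaler0 scale0r.
  by move=> _ /eqP; rewrite oner_eq0.
have Mn1 : M *m steiner_map s1 t1 != 0.
  by apply: contra_neq n1 => /(congr1 (mulmx (invmx M))); rewrite mulKmx // mulmx0.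
have p1 := etrans (plE s1 t1) st1; have p2 := etrans (plE s2 t2) st2.
have [k [k' [kE k0]]] := tangent_line i10 Mn1 p1 (key _ _ st1 n1) p2 (key _ _ st2 n2).
have [|_ /eqP] := indep k' k; last by rewrite (negbTE k0).
by apply: (can_inj (mulKmx Mu)); rewrite -!scalemxAr.
Qed.

Lemma biholomorphism_id N : @biholomorphism_on (R[i] : numFieldType) N setT id.
Proof.
have aid (x : 'cV[K]_N) : analytic_map_at id x.
  move=> j; apply: analytic_at_unshift; apply/analytic_approx; apply: an_polyfun.
  under eq_fun => h do rewrite mxE.
  by apply: polyfunD; [exact: polyfun_cst | exact: polyfun_coord].
split=> //; first exact: openT.
  by rewrite image_id; exact: openT.
by exists id; split=> // ? _; exact: aid.
Qed.

End ArcSectionsOfImages.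

Theorem proposition4p2 (R : realType) :
  exists (n : nat) (X : set 'cV[R[i]]_(n + 1)),
    [/\ (1 <= n)%N,
        hypersurface_germ X,
        irreducible_germ X,
        all_arc_sections_reducible X &
        forall (U : set 'cV[R[i]]_(n + 1))
               (Phi : 'cV[R[i]]_(n + 1) -> 'cV[R[i]]_(n + 1)),
          biholomorphism_on U Phi ->
          all_arc_sections_reducible (Phi @` (U `&` X))].
Proof.
exists 2%N, (@steiner R); split=> //.
- exact: hypersurface_steiner.
- exact: irreducible_steiner.
- have := arc_sections_biholomorphic (@biholomorphism_id R (2 + 1)).
  by rewrite setTI image_id.
- by move=> U Phi; exact: arc_sections_biholomorphic.
Qed.
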